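(* Let $b\ge2$ and consider Radix Selection with a Markov source. Let $m_{\max}=\max\{m(v):v\in\Sigma^\infty\}$ and $\Sigma_{\max}=\{v\in\Sigma^\infty:m(v)=m_{\max}\}$. In distribution and with convergence of all moments, as $n\to\infty$, $$\frac{\max_{v\in\Sigma^\infty}Z_n(v)-m_{\max}\,n}{\sqrt n}\to\sup_{v\in\Sigma_{\max}}H(v),$$ where $H$ is the centered $\mathrm C(\Sigma^\infty)$-valued Gaussian process with covariance function $\mathbb E[H(v)H(w)]=\mathrm{Cov}(j(v,S_1),j(w,S_1))$, $v,w\in\Sigma^\infty$.
   Context: Let $b\ge 2$ be an integer, $\Sigma=\{0,\ldots,b-1\}$, $\Sigma^\infty$ the set of infinite strings over $\Sigma$, and $\Sigma^*=\bigcup_{n\ge 0}\Sigma^n$ with $\Sigma^0=\{\emptyset\}$. Markov source: a homogeneous Markov chain on $\Sigma$ with initial distribution $\mu=(\mu_r)_{r\in\Sigma}$ and transition matrix $(p_{ij})_{i,j\in\Sigma}$, where always $0<\mu_i,p_{ij}<1$ for all $i,j\in\Sigma$. $S_1,S_2,\ldots$ are independent infinite strings, each generated by this chain. For $v,w\in\Sigma^\infty$, $j(v,w)=\max\{i\ge 0:(v_1,\ldots,v_i)=(w_1,\ldots,w_i)\}$ ($=\infty$ if $v=w$). $\Lambda_{n,k}(v)=\#\{1\le i\le n: j(v,S_i)\ge k\}$ for $k\ge0$, and $Z_n(v)=\sum_{k\ge 0}\Lambda_{n,k}(v)\mathbf 1_{\{\Lambda_{n,k}(v)>1\}}$ for $v\in\Sigma^\infty$.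 The maximum $\max_{v\in\Sigma^\infty}Z_n(v)$ equals the worst-case-rank complexity (maximal number of bucket operations over all ranks $1,\ldots,n$) of Radix Selection on $\{S_1,\ldots,S_n\}$. For $v=v_1\ldots v_k\in\Sigma^*$ with $k\ge1$, $\pi(v)=\mu_{v_1}p_{v_1v_2}\cdots p_{v_{k-1}v_k}$, and $\pi(\emptyset)=1$; $m(w)=\sum_{v\preceq w,\,v\in\Sigma^*}\pi(v)$ for $w\in\Sigma^\infty$ (sum over finite prefixes $v$ of $w$). $\Sigma^\infty$ carries the compact topology in which $v(n)\to v$ iff $j(v(n),v)\to\infty$; $\mathrm C(\Sigma^\infty)$ is the Banach space of continuous real functions on it with the supremum norm. *)

(* Defs.v *)
From HB Require Import structures.
From mathcomp Require Import all_boot all_order all_algebra.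
From mathcomp Require Import finmap.
From mathcomp Require Import all_classical all_reals all_analysis.

Set Implicit Arguments.
Unset Strict Implicit.
Unset Printing Implicit Defensive.

Import Order.TTheory GRing.Theory Num.Theory.
Import numFieldNormedType.Exports.

Local Open Scope classical_set_scope.
Local Open Scope ring_scope.

(* The product of the discrete topologies is the topology in which v(n) -> v
   iff j(v(n), v) -> oo. Letters and the strings of the sample are numbered
   from 0: [v i] is $v_{i+1}$, and [S i] below is $S_{i+1}$. *)
Definition string (b : nat) : Type :=
  prod_topology (fun _ : nat => discrete_topology 'I_b).

Section Strings.
Context {b : nat}.
Implicit Types (v w u : string b).

Definition agree (k : nat) v w : Prop := forall i, (i < k)%N -> v i = w i.

Definition cylinders : set (set (string b)) :=
  [set C | exists k u, C = [set v | agree k v u]].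

Definition string_measurable : set (set (string b)) := <<s cylinders >>.

(* j(v, w), equal to +oo when v = w. *)
Definition lcp (R : realType) v w : \bar R :=
  ereal_sup [set (k%:R)%:E | k in [set k : nat | agree k v w]].

End Strings.

Section MarkovWeights.
Context {R : realType} {b : nat}.
Variables (mu : 'I_b -> R) (p : 'M[R]_b).

Fixpoint trans_weight (x : 'I_b) (s : seq 'I_b) : R :=
  if s is y :: s' then p x y * trans_weight y s' else 1.

Definition word_weight (s : seq 'I_b) : R :=
  if s is x :: s' then mu x * trans_weight x s' else 1.

(* [mkseq w k] is the prefix of length k of w. *)
Definition m (w : string b) : R :=
  limn (series (fun k => word_weight (mkseq w k))).

(* The supremum is attained, m being continuous on a compact space; so is that
   of [Z_max] below, Z being integer-valued where it is finite. *)
Definition m_max : R := sup (range m).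

Definition Sigma_max : set (string b) := [set v | m v = m_max].

End MarkovWeights.

Section RandomStrings.
Context {R : realType} {d : measure_display} {T : measurableType d}.
Variable (P : probability T R).

(* The Markov property is stated with the conditional probability multiplied
   out, so that conditioning on a null event needs no convention. *)
Record markov_chain {b : nat} (mu : 'I_b -> R) (p : 'M[R]_b)
    (X : T -> string b) : Prop := MarkovChain {
  markov_measurable : forall A, string_measurable A -> measurable (X @^-1` A) ;
  markov_init : forall r, P [set t | X t 0%N = r] = (mu r)%:E ;
  markov_step : forall (n : nat) (u : string b),
    (P [set t | agree n.+2 (X t) u] =
     P [set t | agree n.+1 (X t) u] * (p (u n) (u n.+1))%:E)%E }.

Definition independent_strings {b : nat} (S : nat -> T -> string b) : Prop :=
  forall (J : {fset nat}) (A : nat -> set (string b)),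
    (forall i, i \in J -> string_measurable (A i)) ->
    (P (\bigcap_(i in [set` J]) (S i @^-1` A i)) =
     \prod_(i <- J) P (S i @^-1` A i))%E.

(* The normal law of mean a and standard deviation s. The library's
   [normal_prob a 0] is not the Dirac mass at a. *)
Definition gaussian_law (a s : R) (A : set R) : \bar R :=
  if s == 0 then \d_a A else normal_prob a s A.

Definition gaussian_variable (X : T -> R) : Prop :=
  exists a s : R, 0 <= s /\
    forall A : set R, measurable A -> P (X @^-1` A) = gaussian_law a s A.

Definition gaussian_process {I : Type} (H : I -> {RV P >-> R}) : Prop :=
  forall (n : nat) (v : 'I_n -> I) (c : 'I_n -> R),
    gaussian_variable (fun t => \sum_(i < n) c i * H (v i) t).

End RandomStrings.

Section RadixSelection.
Context {R : realType} {T : Type} {b : nat}.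
Variable (S : nat -> T -> string b).

Definition Lambda (n k : nat) (v : string b) (t : T) : nat :=
  \sum_(i < n) ((k%:R)%:E <= lcp R v (S i t))%E.

(* Z and its maximum are +oo on the null event that two of the first n strings
   coincide, whence their values in \bar R. *)
Definition Z (n : nat) (v : string b) (t : T) : \bar R :=
  (\sum_(0 <= k <oo)
     ((Lambda n k v t)%:R * (1 < Lambda n k v t)%N%:R : R)%:E)%E.

Definition Z_max (n : nat) (t : T) : \bar R :=
  ereal_sup (range (fun v => Z n v t)).

Definition normalized_Z_max (mmax : R) (n : nat) (t : T) : R :=
  (fine (Z_max n t) - mmax * n%:R) / Num.sqrt n%:R.

End RadixSelection.
Arguments Lambda R {T b} S n k v t.
Arguments Z R {T b} S n v t.
Arguments Z_max R {T b} S n t.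

Section Convergence.
Context {R : realType}.
Context {d : measure_display} {T : measurableType d} (P : probability T R).
Context {d' : measure_display} {T' : measurableType d'} (P' : probability T' R).

Definition cvg_in_distribution (X : nat -> T -> R) (Y : T' -> R) : Prop :=
  [/\ forall n, measurable_fun [set: T] (X n),
      measurable_fun [set: T'] Y &
      forall f : R -> R, continuous f -> bounded_fun f ->
        ('E_P[f \o X n] @[n --> \oo] --> 'E_P'[f \o Y])%E].

Definition cvg_moments (X : nat -> T -> R) (Y : T' -> R) : Prop :=
  forall k : nat,
    [/\ forall n, P.-integrable [set: T] (fun t => ((X n t) ^+ k)%:E),
        P'.-integrable [set: T'] (fun t => ((Y t) ^+ k)%:E) &
        ('E_P[fun t => (X n t ^+ k)%R] @[n --> \oo]
         --> 'E_P'[fun t => (Y t ^+ k)%R])%E].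

End Convergence.

(* Main.v *)
Require Import Defs.
From HB Require Import structures.
From mathcomp Require Import all_boot all_order all_algebra.
From mathcomp Require Import finmap.
From mathcomp Require Import all_classical all_reals all_analysis.
From mathcomp Require Import measurable_realfun ring lra complex.

Set Implicit Arguments.
Unset Strict Implicit.
Unset Printing Implicit Defensive.

Import Order.TTheory GRing.Theory Num.Theory.
Import numFieldNormedType.Exports.

Local Open Scope classical_set_scope.
Local Open Scope ring_scope.

(** Let [pi w] be the weight of a word [w] of length [k], and let [D n w] be
    the number of the first [n] strings with prefix [w], set to 0 when it equals
    1, minus [n * pi w]. Then [Z n v - n * m v] is the sum of the [D n w] over
    the prefixes [w] of [v], and the proof consists in controlling all these
    deviations together.

    The number of strings with prefix [w] is binomial. Exponential moments give
    [E |D n w| ^ (2 r) <= C_r * n ^ r * (pi w) ^ 2] for [r > 1]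
    ([truncated_moment_le]); the square of [pi w] is there for small [n * pi w]
    as well, because counts equal to 1 are discarded. The sum of [(pi w) ^ 2]
    over the words of length [k] is at most [q ^ k] with [q < 1], so the sum of
    these moments over all words converges even with geometric weights. This
    yields, for each [r], some [rho < 1] and random variables [V], whose moments
    of order [2 r] are bounded in [n], with [|D n w| <= sqrt n * rho ^ k * V]
    for all words simultaneously ([deviation_control]). Everything else rests on
    this estimate:

    - the normalized maximum is at most [B = V / (1 - rho)] in absolute value,
      so all its moments are bounded;
    - [Z] may be replaced by its truncation at depth [K], at the cost of
      [sqrt n * B * rho ^ K];
    - by compactness [m] stays at a distance [delta] from its maximum on the
      strings that leave the maximizers before depth [K]. Hence the normalized
      maximum is within [2 * B * rho ^ K + 4 * B ^ 2 / (sqrt n * delta)] of the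
      maximum of [(Z n v - n * m v) / sqrt n] over finitely many maximizers [v],
      one for each prefix of length [K] ([normalized_Z_max_approx]).

    It remains to take limits. At a fixed depth, a linear combination of values
    of [Z n v - n * m v] is, up to a bounded term, a sum of independent bounded
    variables, whose characteristic function converges ([prefix_clt]). When the
    depth grows, the variances tend to that of the linear combination of the
    values of [H], whose characteristic function is known from Stein's identity
    ([normal_pdf_stein], [gaussian_characteristic]). So the characteristic
    functions of finitely many values of [Z] converge
    ([joint_characteristic_cvg]).

    This implies the convergence in law of the maximum of finitely many values.
    By Weierstrass' theorem the closure of the trigonometric polynomials, for
    the supremum norm on the whole space, is stable under composition with
    continuous functions; it therefore contains functions that coincide with
    [f (max_i x_i)] on a large cube and are bounded as [f] is, and the first
    moments bound the mass outside of the cube ([levy_max_coord]).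

    Finally the maxima of [H] over the finite sets of maximizers tend to the
    supremum as [K] grows, since [H] is continuous. So the characteristic
    functions of the normalized maxima converge to that of the supremum
    ([cvg_approx]), which gives the convergence in law, and the boundedness of
    all moments gives their convergence ([weak_cvg_moments]). *)

(** * Real-valued expectations *)

Section Expectation.
Context {R : realType} {d : measure_display} {T : measurableType d}.
Variable P : probability T R.
Implicit Types (X Y : T -> R) (C e : R).

Definition integrableR X := P.-integrable [set: T] (EFin \o X).
Definition Ex X : R := Rintegral P [set: T] X.

Lemma integrableR_measurable X : integrableR X -> measurable_fun [set: T] X.
Proof. by move=> /(@measurable_int _ _ _ _ _ _) /measurable_EFinP. Qed.

Lemma expectation_Ex X : integrableR X -> ('E_P[X] = (Ex X)%:E)%E.
Proof.
move=> iX; rewrite unlock /Ex /Rintegral fineK//.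
exact: integrable_fin_num iX.
Qed.

Lemma integrableR_le X Y : measurable_fun [set: T] X ->
  (forall t, `|X t| <= Y t) -> integrableR Y -> integrableR X.
Proof.
move=> mX XY iY; apply: (le_integrable _ _ _ iY) => //.
  exact/measurable_EFinP.
by move=> t _ /=; rewrite lee_fin (le_trans (XY t))// ler_norm.
Qed.

Lemma integrableR_cst C : integrableR (fun=> C).
Proof. exact: finite_measure_integrable_cst. Qed.

Lemma integrableR_bounded X C : measurable_fun [set: T] X ->
  (forall t, `|X t| <= C) -> integrableR X.
Proof. by move=> mX XC; apply: (integrableR_le mX XC); exact: integrableR_cst. Qed.

Lemma integrableRD X Y : integrableR X -> integrableR Y ->
  integrableR (fun t => X t + Y t).
Proof. by move=> iX iY; have := integrableD measurableT iX iY. Qed.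

Lemma integrableRN X : integrableR X -> integrableR (fun t => - X t).
Proof. by move=> iX; have := integrableN iX. Qed.

Lemma integrableRB X Y : integrableR X -> integrableR Y ->
  integrableR (fun t => X t - Y t).
Proof. by move=> iX iY; apply: integrableRD => //; exact: integrableRN. Qed.

Lemma integrableRZ C X : integrableR X -> integrableR (fun t => C * X t).
Proof. by move=> iX; have := @integrableZl _ _ _ _ _ measurableT C _ iX. Qed.

Lemma integrableR_norm X : integrableR X -> integrableR (fun t => `|X t|).
Proof. by move=> iX; have := integrable_norm iX. Qed.

Lemma integrableR_sum (I : Type) (s : seq I) (Q : pred I) (F : I -> T -> R) :
  (forall i, Q i -> integrableR (F i)) ->
  integrableR (fun t => \sum_(i <- s | Q i) F i t).
Proof.
move=> iF; elim: s => [|i s IHs].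
  rewrite (_ : (fun t => _) = fun=> 0); first exact: integrableR_cst.
  by apply/funext => t; rewrite big_nil.
have [Qi|nQi] := boolP (Q i).
  rewrite (_ : (fun t => _) =
      fun t => F i t + \sum_(i <- s | Q i) F i t).
    by apply: integrableRD IHs; exact: iF.
  by apply/funext => t; rewrite big_cons Qi.
rewrite (_ : (fun t => _) = fun t => \sum_(i <- s | Q i) F i t)//.
by apply/funext => t; rewrite big_cons (negbTE nQi).
Qed.

Lemma ExD X Y : integrableR X -> integrableR Y ->
  Ex (fun t => X t + Y t) = Ex X + Ex Y.
Proof. exact: RintegralD. Qed.

Lemma ExB X Y : integrableR X -> integrableR Y ->
  Ex (fun t => X t - Y t) = Ex X - Ex Y.
Proof. exact: RintegralB. Qed.

Lemma ExZ C X : integrableR X -> Ex (fun t => C * X t) = C * Ex X.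
Proof. exact: RintegralZl. Qed.

Lemma ExN X : integrableR X -> Ex (fun t => - X t) = - Ex X.
Proof.
move=> iX; rewrite -mulN1r -ExZ//; congr Rintegral.
by apply/funext => t; rewrite mulN1r.
Qed.

Lemma Ex_cst C : Ex (fun=> C) = C.
Proof.
rewrite /Ex Rintegral_cst// [X in fine X](_ : _ = 1%E) ?mulr1//.
exact: (probability_setT P).
Qed.

Lemma Ex_sum (I : Type) (s : seq I) (Q : pred I) (F : I -> T -> R) :
  (forall i, Q i -> integrableR (F i)) ->
  Ex (fun t => \sum_(i <- s | Q i) F i t) = \sum_(i <- s | Q i) Ex (F i).
Proof.
move=> iF; elim: s => [|i s IHs].
  rewrite big_nil -[RHS](Ex_cst 0); congr Rintegral.
  by apply/funext => t; rewrite big_nil.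
rewrite big_cons; case: ifPn => [Qi|nQi]; rewrite -IHs; last first.
  by congr Rintegral; apply/funext => t; rewrite big_cons (negbTE nQi).
rewrite -ExD//; [|exact: iF|exact: integrableR_sum].
by congr Rintegral; apply/funext => t; rewrite big_cons Qi.
Qed.

Lemma Ex_ge0 X : (forall t, 0 <= X t) -> 0 <= Ex X.
Proof. by move=> X0; apply: Rintegral_ge0. Qed.

Lemma Ex_le X Y : integrableR X -> integrableR Y ->
  (forall t, X t <= Y t) -> Ex X <= Ex Y.
Proof. by move=> iX iY XY; apply: le_Rintegral. Qed.

Lemma Ex_norm X : integrableR X -> `|Ex X| <= Ex (fun t => `|X t|).
Proof. by move=> iX; apply: le_normr_Rintegral. Qed.

Lemma Ex_bound X C : integrableR X -> (forall t, `|X t| <= C) -> `|Ex X| <= C.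
Proof.
move=> iX XC; apply: (le_trans (Ex_norm iX)); rewrite -[leRHS]Ex_cst.
by apply: Ex_le => //; [exact: integrableR_norm|exact: integrableR_cst].
Qed.

Lemma Ex_dist X Y Z : integrableR X -> integrableR Y -> integrableR Z ->
  (forall t, `|X t - Y t| <= Z t) -> `|Ex X - Ex Y| <= Ex Z.
Proof.
move=> iX iY iZ XYZ; have iXY := integrableRB iX iY.
rewrite -ExB//; apply: (le_trans (Ex_norm iXY)).
by apply: Ex_le => //; exact: integrableR_norm.
Qed.

Lemma ae_eq_integrableR X Y : {ae P, forall t, X t = Y t} ->
  measurable_fun [set: T] Y -> integrableR X -> integrableR Y.
Proof.
move=> XY mY iX; apply/integrableP; split; first exact/measurable_EFinP.
have /integrableP[mX] := iX; apply: le_lt_trans.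
have mX' := integrableR_measurable iX.
rewrite (@ae_eq_integral _ _ _ P _ (fun t => `|(EFin \o X) t|)%E)//.
- by apply: measurableT_comp => //; exact/measurable_EFinP.
- by apply: measurableT_comp => //; exact/measurable_EFinP.
- by apply: filterS XY => t /= ->.
Qed.

Lemma ae_eq_Ex X Y : measurable_fun [set: T] X -> measurable_fun [set: T] Y ->
  {ae P, forall t, X t = Y t} -> Ex X = Ex Y.
Proof.
move=> mX mY XY; congr fine; apply: ae_eq_integral => //.
- exact/measurable_EFinP.
- exact/measurable_EFinP.
- by apply: filterS XY => t /= ->.
Qed.

Lemma ae_integrableR_le X Y : measurable_fun [set: T] X ->
  {ae P, forall t, `|X t| <= Y t} -> integrableR Y -> integrableR X.
Proof.
move=> mX XY iY; have mY := integrableR_measurable iY.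
apply/integrableP; split; first exact/measurable_EFinP.
have /integrableP[_] := iY; apply: le_lt_trans.
apply: ae_ge0_le_integral => //.
- by apply: measurableT_comp => //; exact/measurable_EFinP.
- by apply: measurableT_comp => //; exact/measurable_EFinP.
- by apply: filterS XY => t /= XYt _; rewrite lee_fin (le_trans XYt)// ler_norm.
Qed.

Lemma ae_Ex_le X Y : integrableR X -> integrableR Y ->
  {ae P, forall t, X t <= Y t} -> Ex X <= Ex Y.
Proof.
move=> iX iY XY.
have mX := integrableR_measurable iX; have mY := integrableR_measurable iY.
rewrite (@ae_eq_Ex X (fun t => Num.min (X t) (Y t)))//.
- apply: Ex_le => //; last by move=> t; rewrite ge_min lexx orbT.
  apply: (@integrableR_le _ (fun t => `|X t| + `|Y t|)).
  + exact: measurable_minr.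
  + by move=> t; rewrite /Num.min; case: ifP; rewrite ?lerDl ?lerDr.
  + by apply: integrableRD; exact: integrableR_norm.
- exact: measurable_minr.
- by apply: filterS XY => t /= XYt; rewrite min_l.
Qed.

Lemma ae_Ex_dist X Y Z : integrableR X -> integrableR Y -> integrableR Z ->
  {ae P, forall t, `|X t - Y t| <= Z t} -> `|Ex X - Ex Y| <= Ex Z.
Proof.
move=> iX iY iZ XYZ; have iXY := integrableRB iX iY.
rewrite -ExB//; apply: (le_trans (Ex_norm iXY)).
by apply: ae_Ex_le => //; exact: integrableR_norm.
Qed.

Lemma Ex_dominated (X : nat -> T -> R) Y Z :
  (forall n, measurable_fun [set: T] (X n)) -> measurable_fun [set: T] Y ->
  {ae P, forall t, X n t @[n --> \oo] --> Y t} ->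
  integrableR Z -> {ae P, forall t n, `|X n t| <= Z t} ->
  integrableR Y /\ Ex (X n) @[n --> \oo] --> Ex Y.
Proof.
move=> mX mY XY iZ XZ.
have [||||iY _ cY] := @dominated_convergence _ _ _ P _ measurableT
    (fun n => EFin \o X n) (EFin \o Y) (EFin \o Z) _ _ _ iZ _.
- by move=> n; exact/measurable_EFinP.
- exact/measurable_EFinP.
- apply: filterS XY => t /= XYt _; apply: cvg_EFin => //.
  exact: nearW.
- by apply: filterS XZ => t /= XZt n _; rewrite lee_fin.
split=> //; apply: (@fine_cvg _ _ _ _ (fun n => \int[P]_x (EFin \o X n) x)%E).
rewrite /Ex /Rintegral fineK//.
exact: integrable_fin_num iY.
Qed.

Lemma integrableR_of_truncations (Y : T -> R) (C : R) :
  measurable_fun [set: T] Y -> (forall t, 0 <= Y t) ->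
  (forall A : nat, Ex (fun t => Num.min (Y t) A%:R) <= C) ->
  integrableR Y /\ Ex Y <= C.
Proof.
move=> mY Y0 YC; pose g (n : nat) t := Num.min (Y t) n%:R.
have mg n : measurable_fun [set: T] (g n) by exact: measurable_minr.
have g0 n t : 0 <= g n t by rewrite le_min Y0 ler0n.
have ig n : integrableR (g n).
  apply: (@integrableR_bounded _ n%:R) => // t.
  by rewrite ger0_norm// ge_min lexx orbT.
have cY : (\int[P]_t (g n t)%:E)%E @[n --> \oo] --> (\int[P]_t (Y t)%:E)%E.
  have -> : (\int[P]_t (Y t)%:E = \int[P]_t limn (fun n => (g n t)%:E))%E.
    apply: eq_integral => t _; apply/esym/cvg_lim => //.
    apply: cvg_EFin; first exact: nearW.
    apply: cvg_near_cst; near=> n; rewrite /comp/= /g min_l//.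
    near: n; exact: nbhs_infty_ger.
  apply: cvg_monotone_convergence => //.
  - by move=> n; apply/measurable_EFinP; exact: mg.
  - by move=> n t _; rewrite lee_fin.
  - move=> t _ m n mn; rewrite lee_fin /g le_min ge_min lexx/= ge_min.
    by rewrite [X in _ || X](_ : _ = true) ?orbT// ler_nat.
have leC : (\int[P]_t (Y t)%:E <= C%:E)%E.
  rewrite -(cvg_lim _ cY)//; apply: lime_le; first by apply/cvg_ex; eexists; exact: cY.
  apply: nearW => n; have := expectation_Ex (ig n); rewrite unlock => ->.
  by rewrite lee_fin YC.
have iY : integrableR Y.
  apply/integrableP; split; first exact/measurable_EFinP.
  under eq_integral do rewrite /= ger0_norm//.
  exact: le_lt_trans leC (ltry _).
split=> //; rewrite -lee_fin.
by have := expectation_Ex iY; rewrite unlock => <-.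
Unshelve. all: by end_near. Qed.

End Expectation.

(** * Approximation by polynomials *)

Section Weierstrass.
Context {R : realType}.
Implicit Types (h : R -> R) (e x : R).

Lemma segment_modulus h (a b e : R) : continuous h -> 0 < e ->
  exists2 delta, 0 < delta &
    forall x, x \in `[a, b] -> forall u, `|u - x| < delta -> `|h u - h x| <= e.
Proof.
move=> hc e0.
have /compact_near_coveringP/(_ R (0^'+) (fun delta x =>
    forall u, `|u - x| < delta -> `|h u - h x| <= e) _) := @segment_compact R a b.
case.
- move=> x _.
  have e20 : 0 < e / 2 by rewrite divr_gt0.
  have /cvgrPdist_lt/(_ _ e20)/nbhs_ballP[r /= r0 xr] := hc x.
  have hx u : `|u - x| < r -> `|h u - h x| < e / 2.
    by move=> ux; rewrite distrC; apply: xr => /=; rewrite /ball/= distrC.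
  exists (ball x (r / 2), [set y : R | y < r / 2]).
    split; first by apply: nbhsx_ballx; rewrite divr_gt0.
    by apply: nbhs_right_lt; rewrite divr_gt0.
  move=> [y delta] /= [xy dr] u uy.
  have yx : `|y - x| < r / 2 by rewrite distrC.
  have ux : `|u - x| < r.
    rewrite (le_lt_trans (ler_distD y _ _))// (splitr r).
    by rewrite ltrD//; exact: lt_trans uy dr.
  rewrite (le_trans (ler_distD (h x) _ _))// [leRHS]splitr lerD// ltW//.
    exact: hx.
  by rewrite distrC hx// (lt_trans yx)// ltr_pdivrMr// ltr_pMr// ltr1n.
- move=> r /= r0 H; exists (r / 2); first by rewrite divr_gt0.
  move=> x xab u ux; apply: (H (r / 2)) => //=.
    by rewrite sub0r normrN gtr0_norm ?divr_gt0// ltr_pdivrMr// ltr_pMr// ltr1n.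
  by rewrite divr_gt0.
Qed.

(** The Bernstein polynomial of [g] evaluated at [x] is the mean of [g] at a
    binomial variable with parameters [n] and [x]; conditioning on the first
    trial gives this recursion, which is what the proofs use. *)
Fixpoint bernstein (n : nat) (g : nat -> R) : {poly R} :=
  if n is n'.+1 then
    (1 - 'X) * bernstein n' g + 'X * bernstein n' (fun k => g k.+1)
  else (g 0%N)%:P.

Lemma bernsteinS n g x : (bernstein n.+1 g).[x] =
  (1 - x) * (bernstein n g).[x] + x * (bernstein n (fun k => g k.+1)).[x].
Proof. by rewrite /= !(hornerD, hornerN, hornerM, hornerX, hornerC). Qed.

Lemma bernstein_le n (g g' : nat -> R) x : 0 <= x <= 1 ->
  (forall k, g k <= g' k) -> (bernstein n g).[x] <= (bernstein n g').[x].
Proof.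
move=> /andP[x0 x1]; elim: n g g' => [|n IHn] g g' gg'.
  by rewrite /= !hornerC.
by rewrite !bernsteinS lerD// ler_wpM2l ?subr_ge0// IHn.
Qed.

Lemma bernstein_affine n (g : nat -> R) a c x :
  (bernstein n (fun k => a + c * g k)).[x] = a + c * (bernstein n g).[x].
Proof.
elim: n g => [|n IHn] g; first by rewrite /= !hornerC.
rewrite !bernsteinS IHn (IHn (fun k => g k.+1)); ring.
Qed.

Lemma bernstein_sqr n c x : (bernstein n (fun k => (k%:R - c) ^+ 2)).[x] =
  n%:R * (x * (1 - x)) + (n%:R * x - c) ^+ 2.
Proof.
elim: n c => [|n IHn] c; first by rewrite /= !hornerC; ring.
rewrite bernsteinS IHn.
rewrite (_ : (fun k => _) = (fun k => (k%:R - (c - 1)) ^+ 2)).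
  by rewrite IHn -(natr1 n); ring.
by apply/funext => k; rewrite -(natr1 k); ring.
Qed.

(** The error at [x] is at most [e] plus a multiple of the variance, of order
    [1 / n], of the proportion of successes. *)
Lemma bernstein_cvg h e : continuous h -> 0 < e ->
  exists q : {poly R}, forall x, 0 <= x <= 1 -> `|q.[x] - h x| <= e.
Proof.
move=> hc e0; pose e2 := e / 2.
have e20 : 0 < e2 by rewrite divr_gt0.
have [delta d0 hd] := @segment_modulus h 0 1 e2 hc e20.
have [M M0 hM] : exists2 M, 0 < M & forall x, 0 <= x <= 1 -> `|h x| <= M.
  have /compact_bounded [M [Mr hM]] : compact (h @` `[0, 1]).
    apply: continuous_compact; last exact: segment_compact.
    exact: continuous_subspaceT.
  exists (`|M| + 1); first by rewrite ltr_wpDl.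
  move=> x x01; apply: (hM (`|M| + 1)); first by rewrite ltr_pwDr// ler_norm.
  by exists x => //=; rewrite in_itv/=.
pose c := 2 * M / delta ^+ 2.
have c0 : 0 <= c by rewrite divr_ge0 ?exprn_ge0// ?mulr_ge0// ltW.
pose cl (u : R) := Num.min u 1.
have key x u : 0 <= x <= 1 -> 0 <= u ->
    `|h (cl u) - h x| <= e2 + c * (u - x) ^+ 2.
  move=> x01 u0; have /andP[x0 x1] := x01.
  have cl01 : 0 <= cl u <= 1 by rewrite /cl le_min u0 ler01/= ge_min lexx orbT.
  have [clx|clx] := ltrP `|cl u - x| delta.
    rewrite (le_trans (hd x _ _ clx)) ?in_itv//= lerDl.
    by rewrite mulr_ge0// sqr_ge0.
  have ux : delta <= `|u - x|.
    rewrite (le_trans clx)// /cl /Num.min; case: ltP => // u1.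
    by rewrite !ger0_norm ?subr_ge0// ?lerD2r// (le_trans x1).
  rewrite (le_trans (ler_normB _ _))// (@le_trans _ _ (2 * M))//.
    by rewrite mulr_natl mulr2n lerD// hM.
  rewrite ler_wpDl ?(ltW e20)// /c mulrAC ler_pdivlMr ?exprn_gt0//.
  rewrite ler_wpM2l ?mulr_ge0 ?(ltW M0)//.
  rewrite -(real_normK (num_real (u - x))) lerXn2r ?nnegrE// ltW//.
have [n nc] : exists n : nat, c / e2 <= n.+1%:R.
  exists (Num.truncn (c / e2)); apply: ltW; exact: truncnS_gt.
exists (bernstein n.+1 (fun k => h (cl (k%:R / n.+1%:R)))) => x x01.
have /andP[x0 x1] := x01.
have n0 : 0 < n.+1%:R :> R by rewrite ltr0n.
set g := fun k : nat => (k%:R / n.+1%:R - x) ^+ 2.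
have Bg : (bernstein n.+1 g).[x] = x * (1 - x) / n.+1%:R.
  rewrite (_ : g = fun k => 0 + n.+1%:R ^- 2 * (k%:R - n.+1%:R * x) ^+ 2).
    rewrite bernstein_affine bernstein_sqr; field; exact: lt0r_neq0.
  by apply/funext => k; rewrite /g; field; exact: lt0r_neq0.
have bnd : e2 + c * (bernstein n.+1 g).[x] <= e.
  rewrite Bg [leRHS]splitr lerD2l mulrA ler_pdivrMr//.
  rewrite ler_pdivrMr// mulrC -/e2 in nc.
  rewrite (le_trans _ nc)// ler_piMr// mulr_ile1 ?subr_ge0//.
  by rewrite gerBl.
have lo : (h x - e2) + (- c) * (bernstein n.+1 g).[x] <=
    (bernstein n.+1 (fun k => h (cl (k%:R / n.+1%:R)))).[x].
  rewrite -bernstein_affine; apply: bernstein_le => // k.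
  have /(key _ _ x01) : 0 <= k%:R / n.+1%:R :> R by rewrite divr_ge0.
  by rewrite ler_distl -/(g k) => /andP[+ _]; apply: le_trans; rewrite mulNr; lra.
have hi : (bernstein n.+1 (fun k => h (cl (k%:R / n.+1%:R)))).[x] <=
    (h x + e2) + c * (bernstein n.+1 g).[x].
  rewrite -bernstein_affine; apply: bernstein_le => // k.
  have /(key _ _ x01) : 0 <= k%:R / n.+1%:R :> R by rewrite divr_ge0.
  by rewrite ler_distl -/(g k) => /andP[_]; move/le_trans; apply; lra.
rewrite ler_distl; apply/andP; split.
- by apply: le_trans lo; lra.
- by apply: (le_trans hi); lra.
Qed.

Lemma weierstrass h (B e : R) : continuous h -> 0 < B -> 0 < e ->
  exists q : {poly R}, forall x, `|x| <= B -> `|q.[x] - h x| <= e.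
Proof.
move=> hc B0 e0.
have hc' : continuous (fun x => h (2 * B * x - B)).
  move=> x; apply: continuous_comp; last exact: hc.
  apply: cvgB; last exact: cvg_cst.
  by apply: cvgM; [exact: cvg_cst|exact: cvg_id].
have [q hq] := bernstein_cvg hc' e0.
exists (q \Po ((2 * B)^-1 *: ('X + B%:P))) => x xB.
rewrite horner_comp !hornerE.
have B20 : 0 < 2 * B by rewrite mulr_gt0.
have B2 : 2 * B != 0 by exact: lt0r_neq0.
have := hq ((2 * B)^-1 * (x + B)).
rewrite mulrA divff// mul1r addrK; apply.
move: xB; rewrite ler_norml => /andP[xl xr].
rewrite mulrC ler_pdivlMr// mul0r ler_pdivrMr// mul1r; apply/andP; split; lra.
Qed.

End Weierstrass.

(** * Convergence in law from characteristic functions *)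

Section AlmostPeriodic.
Context {R : realType} {N : nat}.
Implicit Types (g h : ('I_N -> R) -> R) (c x : 'I_N -> R) (f : R -> R).

(** Trigonometric polynomials in [N] variables with arbitrary frequencies; the
    phase [a] covers sines and constants. *)
Inductive trig_poly : (('I_N -> R) -> R) -> Prop :=
| trig_cos c a : trig_poly (fun x => cos (\sum_i c i * x i + a))
| trigD g h : trig_poly g -> trig_poly h -> trig_poly (fun x => g x + h x)
| trigZ a g : trig_poly g -> trig_poly (fun x => a * g x).

Lemma trig_cst a : trig_poly (fun=> a).
Proof.
rewrite (_ : (fun=> a) = fun x => a * cos (\sum_i 0 * x i + 0)).
  by apply: trigZ; exact: (trig_cos (fun=> 0)).
by apply/funext => x; rewrite big1 ?addr0 ?cos0 ?mulr1// => i _; rewrite mul0r.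
Qed.

Lemma trig_sin c : trig_poly (fun x => sin (\sum_i c i * x i)).
Proof.
rewrite (_ : (fun x => _) = fun x => cos (\sum_i c i * x i + - (pi / 2))).
  exact: trig_cos.
by apply/funext => x; rewrite cosBpihalf.
Qed.

(** The product-to-sum formula. *)
Lemma trigM g h : trig_poly g -> trig_poly h -> trig_poly (fun x => g x * h x).
Proof.
move=> tg th; elim: tg h th => {g}.
- move=> c a h; elim=> {h}.
  + move=> c' a'; rewrite (_ : (fun x => _) = fun x =>
        2^-1 * (cos (\sum_i (c i + c' i) * x i + (a + a')) +
                cos (\sum_i (c i - c' i) * x i + (a - a')))).
      by apply: trigZ; apply: trigD; exact: trig_cos.
    apply/funext => x; set A := \sum_i c i * x i; set A' := \sum_i c' i * x i.
    have -> : \sum_i (c i + c' i) * x i + (a + a') = (A + a) + (A' + a').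
      by rewrite addrACA -big_split/=; under eq_bigr do rewrite mulrDl.
    have -> : \sum_i (c i - c' i) * x i + (a - a') = (A + a) - (A' + a').
      by rewrite opprD addrACA -sumrB; under eq_bigr do rewrite mulrBl.
    by move: (A + a) (A' + a') => u w; rewrite cosD cosB; field.
  + move=> g h _ IHg _ IHh; rewrite (_ : (fun x => _) = fun x =>
        cos (\sum_i c i * x i + a) * g x + cos (\sum_i c i * x i + a) * h x).
      exact: trigD.
    by apply/funext => x; rewrite mulrDr.
  + move=> a' g _ IHg; rewrite (_ : (fun x => _) = fun x =>
        a' * (cos (\sum_i c i * x i + a) * g x)); first exact: trigZ.
    by apply/funext => x; rewrite mulrCA.
- move=> g g' _ IHg _ IHg' h th; rewrite (_ : (fun x => _) = fun x =>
      g x * h x + g' x * h x); first by apply: trigD; [exact: IHg|exact: IHg'].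
  by apply/funext => x; rewrite mulrDl.
- move=> a g _ IHg h th; rewrite (_ : (fun x => _) = fun x => a * (g x * h x)).
    by apply: trigZ; exact: IHg.
  by apply/funext => x; rewrite mulrA.
Qed.

Lemma trig_horner g (q : {poly R}) : trig_poly g -> trig_poly (fun x => q.[g x]).
Proof.
move=> tg; elim/poly_ind: q => [|q a IHq].
  rewrite (_ : (fun x => _) = fun=> 0); first exact: trig_cst.
  by apply/funext => x; rewrite horner0.
rewrite (_ : (fun x => _) = fun x => q.[g x] * g x + a).
  by apply: trigD; [exact: trigM|exact: trig_cst].
by apply/funext => x; rewrite hornerMXaddC.
Qed.

Lemma trig_bounded g : trig_poly g ->
  exists2 B, 0 < B & forall x, `|g x| <= B.
Proof.
elim=> {g}.
- by move=> c a; exists 1 => // x; exact: cos_max.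
- move=> g h _ [B B0 gB] _ [C C0 hC]; exists (B + C); first exact: addr_gt0.
  by move=> x; rewrite (le_trans (ler_normD _ _))// lerD.
- move=> a g _ [B B0 gB]; exists (`|a| * B + 1).
    by rewrite ltr_wpDl// mulr_ge0// ltW.
  by move=> x; rewrite normrM ler_wpDr// ler_wpM2l.
Qed.

(** Uniformly almost periodic functions: the closure of the trigonometric
    polynomials for the supremum norm over the whole space. *)
Definition almost_periodic g : Prop := forall e, 0 < e ->
  exists2 h, trig_poly h & forall x, `|h x - g x| <= e.

Lemma trig_almost_periodic g : trig_poly g -> almost_periodic g.
Proof. by move=> tg e e0; exists g => // x; rewrite subrr normr0 ltW. Qed.

Lemma almost_periodicD g h : almost_periodic g -> almost_periodic h ->
  almost_periodic (fun x => g x + h x).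
Proof.
move=> ag ah e e0; have e20 : 0 < e / 2 by rewrite divr_gt0.
have [g' tg' gg'] := ag _ e20; have [h' th' hh'] := ah _ e20.
exists (fun x => g' x + h' x); first exact: trigD.
move=> x; rewrite opprD addrACA (le_trans (ler_normD _ _))//.
by rewrite [leRHS]splitr lerD.
Qed.

Lemma almost_periodicZ a g : almost_periodic g ->
  almost_periodic (fun x => a * g x).
Proof.
move=> ag e e0; have e20 : 0 < e / (`|a| + 1) by rewrite divr_gt0// ltr_wpDl.
have [g' tg' gg'] := ag _ e20.
exists (fun x => a * g' x); first exact: trigZ.
move=> x; rewrite -mulrBr normrM (le_trans (ler_wpM2l _ (gg' x)))//.
by rewrite mulrCA ger_pMr// ler_pdivrMr ?ltr_wpDl// mul1r lerDl.
Qed.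

Lemma almost_periodic_bounded g : almost_periodic g ->
  exists2 B, 0 < B & forall x, `|g x| <= B.
Proof.
move=> ag; have [g' /trig_bounded[B B0 gB] gg'] := ag 1 ltr01.
exists (B + 1) => [|x]; first exact: addr_gt0.
rewrite -(subrK (g' x) (g x)) addrC.
by rewrite (le_trans (ler_normD _ _))// lerD// distrC.
Qed.

(** The reason for working with a class of functions that are bounded on the
    whole space: polynomial approximation of [f] on the range of [g] suffices. *)
Lemma almost_periodic_comp f g : continuous f -> almost_periodic g ->
  almost_periodic (fun x => f (g x)).
Proof.
move=> cf ag e e0; have e20 : 0 < e / 2 by rewrite divr_gt0.
have [B B0 gB] := almost_periodic_bounded ag.
have [delta d0 fd] := segment_modulus (- B) B cf e20.
pose delta' := Num.min (delta / 2) 1.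
have d'0 : 0 < delta' by rewrite lt_min ltr01 divr_gt0.
have [g' tg' gg'] := ag _ d'0.
have [q fq] := weierstrass cf (addr_gt0 B0 ltr01) e20.
exists (fun x => q.[g' x]); first exact: trig_horner.
move=> x; rewrite (le_trans (ler_distD (f (g' x)) _ _))// [leRHS]splitr lerD//.
  apply: fq; rewrite -(subrK (g x) (g' x)) addrC.
  rewrite (le_trans (ler_normD _ _))// lerD//.
  by rewrite (le_trans (gg' x))// ge_min lexx orbT.
apply: fd; first by rewrite in_itv/= -ler_norml.
rewrite (le_lt_trans (gg' x))// gt_min; apply/orP; left.
by rewrite ltr_pdivrMr// ltr_pMr// ltr1n.
Qed.

Lemma almost_periodic_max g h : almost_periodic g -> almost_periodic h ->
  almost_periodic (fun x => Num.max (g x) (h x)).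
Proof.
move=> ag ah; rewrite (_ : (fun x => _) = fun x =>
    2^-1 * ((g x + h x) + `|g x + (-1) * h x|)).
  apply: almost_periodicZ; apply: almost_periodicD; first exact: almost_periodicD.
  apply: (@almost_periodic_comp (fun y => `|y|)); first exact: norm_continuous.
  by apply: almost_periodicD => //; exact: almost_periodicZ.
apply/funext => x; rewrite mulN1r maxr_absE mulrC; congr (_ * _).
Qed.

Lemma almost_periodic_bigmax (I : Type) (s : seq I)
    (g0 : ('I_N -> R) -> R) (g : I -> ('I_N -> R) -> R) :
  almost_periodic g0 -> (forall i, almost_periodic (g i)) ->
  almost_periodic (fun x => \big[Num.max/g0 x]_(i <- s) g i x).
Proof.
move=> ag0 ag; elim: s => [|i s IHs].
  rewrite (_ : (fun x => _) = g0)//; by apply/funext => x; rewrite big_nil.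
rewrite (_ : (fun x => _) = fun x =>
    Num.max (g i x) (\big[Num.max/g0 x]_(i <- s) g i x)).
  exact: almost_periodic_max.
by apply/funext => x; rewrite big_cons.
Qed.

End AlmostPeriodic.

Section MaxOfCoordinates.
Context {R : realType} {N : nat}.
Implicit Types (x : 'I_N.+1 -> R) (f : R -> R).

Definition max_coord x : R := \big[Num.max/x ord0]_i x i.

Lemma max_coord_ub x i : x i <= max_coord x.
Proof. exact: le_bigmax_cond. Qed.

Lemma max_coord_le x a : (forall i, x i <= a) -> max_coord x <= a.
Proof. by move=> xa; apply: bigmax_le => // i _; exact: xa. Qed.

Lemma max_coord_norm_le x a : (forall i, `|x i| <= a) -> `|max_coord x| <= a.
Proof.
move=> xa; rewrite ler_norml; apply/andP; split.
  apply: le_trans (max_coord_ub x ord0).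
  by have := xa ord0; rewrite ler_norml => /andP[].
by apply: max_coord_le => i; rewrite (le_trans (ler_norm _)).
Qed.

Let in_pihalf (y : R) : `|y| <= 1 -> y \in `[- (pi / 2), pi / 2].
Proof.
move=> y1; rewrite in_itv/= -ler_norml (le_trans y1)//.
by rewrite ler_pdivlMr// mul1r pi_ge2.
Qed.

Let sin_max_coord x M : 0 < M -> (forall i, `|x i| <= M) ->
  \big[Num.max/sin (x ord0 / M)]_i sin (x i / M) = sin (max_coord x / M) :> R.
Proof.
move=> M0 xM; have xM1 y : `|y| <= M -> `|y / M| <= 1.
  by move=> yM; rewrite normrM normfV (gtr0_norm M0) ler_pdivrMr// mul1r.
have [] // : (\big[Num.max/sin (x ord0 / M)]_i sin (x i / M) =
    sin (max_coord x / M)) /\ `|max_coord x| <= M.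
rewrite /max_coord; apply: (big_ind2 (fun a c => a = sin (c / M) /\ `|c| <= M)).
- by split=> //; exact: xM.
- move=> _ c _ c' [-> cM] [-> c'M].
  have [sl|sl] := leP (sin (c / M)) (sin (c' / M));
    have [cl|cl] := leP c c' => //.
  + split=> //; apply/eqP; rewrite eq_le leNgt sl andbT -leNgt.
    by rewrite leNgt ltr_sin ?in_pihalf ?xM1// ltr_pM2r ?invr_gt0// -leNgt ltW.
  + split=> //; move: sl; rewrite ltr_sin ?in_pihalf ?xM1//.
    by rewrite ltr_pM2r ?invr_gt0// ltNge cl.
- by move=> i _; split=> //; exact: xM.
Qed.

(** On the cube of half-side [M] the monotone map [y -> sin (y / (2 * M))] has
    its angles within [-1/2, 1/2] and commutes with the maximum; undoing it by
    [asin] expresses [f (max_coord x)] there as an almost periodic function that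
    keeps the bound of [f] on the whole space. *)
Lemma max_coord_almost_periodic f (B M : R) : continuous f ->
  (forall y, `|f y| <= B) -> 0 < M ->
  exists g, [/\ almost_periodic g, forall x, `|g x| <= B &
    forall x, (forall i, `|x i| <= M) -> g x = f (max_coord x)].
Proof.
move=> cf fB M0; pose M2 := 2 * M; have M20 : 0 < M2 by rewrite mulr_gt0.
have half1 : `|2^-1 : R| <= 1 by rewrite ger0_norm// invf_le1// ler1n.
pose s1 : R := sin 2^-1.
have s10 : 0 < s1.
  by rewrite /s1 sin2_gt0// invr_gt0 ltr0n/= invf_plt ?posrE// (@lt_trans _ _ 1)//
    ?ltr1n// invf_lt1// ltr1n.
have s11 : s1 < 1.
  have pin : pi / 2 \in `[- (pi / 2 : R), pi / 2].
    by rewrite in_itv/= lexx andbT -subr_ge0 opprK addr_ge0// divr_ge0// pi_ge0.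
  have : s1 < sin (pi / 2).
    rewrite ltr_sin ?(in_pihalf half1)//.
    by rewrite (lt_le_trans _ (@pihalf_ge1 R))// invf_lt1// ltr1n.
  by rewrite sin_pihalf.
pose cl (s : R) := Num.max (- s1) (Num.min s s1).
pose h (s : R) := f (asin (cl s) * M2).
have hc : continuous h.
  move=> s; apply: continuous_comp; last exact: cf.
  apply: (@continuousM _ _ (fun s => asin (cl s)) (fun=> M2)); last exact: cvg_cst.
  apply: (@continuous_comp _ _ _ cl asin).
    apply: (@continuous_max _ _ (fun=> - s1) (fun s => Num.min s s1)); first exact: cvg_cst.
    apply: (@continuous_min _ _ id (fun=> s1)); first exact: cvg_id.
    exact: cvg_cst.
  apply: continuous_asin; rewrite /cl lt_max ltrN2 s11/= gt_max.
  rewrite gt_min s11 orbT andbT; lra.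
have xM1 y : `|y| <= M -> `|y / M2| <= 2^-1.
  move=> yM; rewrite normrM normfV (gtr0_norm M20) ler_pdivrMr//.
  by rewrite /M2 mulrA mulVf// mul1r.
exists (fun x => h (\big[Num.max/sin (x ord0 / M2)]_i sin (x i / M2))); split.
- apply: almost_periodic_comp => //.
  have asinx i : almost_periodic (fun x : 'I_N.+1 -> R => sin (x i / M2)).
    apply: trig_almost_periodic.
    rewrite (_ : (fun x => _) =
        fun x : 'I_N.+1 -> R => sin (\sum_j (M2^-1 * (j == i)%:R) * x j)).
      exact: trig_sin.
    apply/funext => x; congr sin; rewrite (bigD1 i)//= eqxx mulr1 big1 ?addr0.
      by rewrite mulrC.
    by move=> j /negbTE ->; rewrite mulr0 mul0r.
  exact: almost_periodic_bigmax.
- by move=> x; exact: fB.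
- move=> x xM; rewrite sin_max_coord//; last first.
    by move=> i; rewrite (le_trans (xM i))// ler_peMl ?(ltW M0)// ler1n.
  rewrite /h; have mM := xM1 _ (max_coord_norm_le xM).
  have mM1 := le_trans mM (le_trans (ler_norm _) half1).
  have clE : cl (sin (max_coord x / M2)) = sin (max_coord x / M2).
    have lesin a c : `|a| <= 1 -> `|c| <= 1 -> a <= c -> sin a <= sin c :> R.
      by move=> a1 c1 ac; rewrite leNgt ltr_sin ?in_pihalf// -leNgt.
    move: mM; rewrite ler_norml => /andP[ml mu].
    rewrite /cl min_l; last exact: lesin.
    by rewrite max_r// -sinN; apply: lesin; rewrite ?normrN.
  by rewrite clE sinK ?in_pihalf// divfK// lt0r_neq0.
Qed.

End MaxOfCoordinates.

Lemma measurable_max_coord {R : realType} (d : measure_display) (T : measurableType d)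
    (N : nat) (W : 'I_N.+1 -> T -> R) : (forall i, measurable_fun [set: T] (W i)) ->
  measurable_fun [set: T] (fun t => max_coord (fun i => W i t)).
Proof.
move=> mW; rewrite /max_coord; elim: (index_enum _) => [|i s IHs].
  rewrite (_ : (fun t => _) = W ord0)//.
  by apply/funext => t; rewrite big_nil.
rewrite (_ : (fun t => _) = fun t => Num.max (W i t)
    (\big[Num.max/W ord0 t]_(j <- s) W j t)); first exact: measurable_maxr.
by apply/funext => t; rewrite big_cons.
Qed.

Section Levy.
Context {R : realType} {N : nat}.
Context {d : measure_display} {T : measurableType d} (P : probability T R).
Implicit Types (g : ('I_N -> R) -> R) (W : 'I_N -> T -> R).

Lemma measurable_trig g W : (forall i, measurable_fun [set: T] (W i)) ->
  trig_poly g -> measurable_fun [set: T] (fun t => g (W^~ t)).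
Proof.
move=> mW; elim=> {g}.
- move=> c a; apply: (@measurableT_comp _ _ _ _ _ _ (@cos R)).
    by apply: continuous_measurable_fun; exact: continuous_cos.
  by apply: measurable_funD => //; apply: measurable_sum => i; exact: measurable_funM.
- by move=> g h _ mg _ mh; exact: measurable_funD.
- by move=> a g _ mg; exact: measurable_funM.
Qed.

Lemma integrableR_trig g W : (forall i, measurable_fun [set: T] (W i)) ->
  trig_poly g -> integrableR P (fun t => g (W^~ t)).
Proof.
move=> mW tg; have [B _ gB] := trig_bounded tg.
by apply: integrableR_bounded (measurable_trig mW tg) _ => t; exact: gB.
Qed.

Lemma integrableR_almost_periodic g W :
  (forall i, measurable_fun [set: T] (W i)) ->
  almost_periodic g -> integrableR P (fun t => g (W^~ t)).
Proof.
move=> mW ag; have [B _ gB] := almost_periodic_bounded ag.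
apply: (@integrableR_bounded _ _ _ _ _ B) => [|t]; last exact: gB.
have /choice[h hP] : forall n : nat, exists h, trig_poly h /\
    forall x, `|h x - g x| <= n.+1%:R^-1.
  by move=> n; have [|h th hg] := ag n.+1%:R^-1; [rewrite invr_gt0|exists h].
apply: (@measurable_fun_cvg _ _ _ _ (fun n t => h n (W^~ t))).
  by move=> n; apply: measurable_trig => //; have [] := hP n.
move=> t _; apply/cvgrPdist_le => e e0.
near=> n; rewrite distrC; have [_ hg] := hP n.
rewrite (le_trans (hg _))// ltW//; near: n.
exact: near_infty_natSinv_lt (PosNum e0).
Unshelve. all: by end_near. Qed.

End Levy.

Section LevyContinuity.
Context {R : realType} {N : nat}.
Context {d : measure_display} {T : measurableType d} (P : probability T R).
Context {d' : measure_display} {T' : measurableType d'} (P' : probability T' R).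
Variables (V : nat -> 'I_N.+1 -> T -> R) (W : 'I_N.+1 -> T' -> R) (C : R).
Hypothesis iV : forall n i, integrableR P (V n i).
Hypothesis iW : forall i, integrableR P' (W i).
Hypothesis VC : forall n i, Ex P (fun t => `|V n i t|) <= C.
Hypothesis WC : forall i, Ex P' (fun t => `|W i t|) <= C.
Hypothesis cvg_cos : forall c : 'I_N.+1 -> R,
  Ex P (fun t => cos (\sum_i c i * V n i t)) @[n --> \oo] -->
  Ex P' (fun t => cos (\sum_i c i * W i t)).
Hypothesis cvg_sin : forall c : 'I_N.+1 -> R,
  Ex P (fun t => sin (\sum_i c i * V n i t)) @[n --> \oo] -->
  Ex P' (fun t => sin (\sum_i c i * W i t)).

Let mV n i : measurable_fun [set: T] (V n i).
Proof. exact: integrableR_measurable (iV n i). Qed.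
Let mW i : measurable_fun [set: T'] (W i).
Proof. exact: integrableR_measurable (iW i). Qed.

Lemma cvg_trig g : trig_poly g ->
  Ex P (fun t => g ((V n)^~ t)) @[n --> \oo] --> Ex P' (fun t => g (W^~ t)).
Proof.
elim=> {g}.
- move=> c a; have phase d0 (S0 : measurableType d0) (Q : probability S0 R)
      (U : 'I_N.+1 -> S0 -> R) : (forall i, measurable_fun [set: S0] (U i)) ->
      Ex Q (fun t => cos (\sum_i c i * U i t + a)) =
      cos a * Ex Q (fun t => cos (\sum_i c i * U i t)) -
      sin a * Ex Q (fun t => sin (\sum_i c i * U i t)).
    move=> mU; have is1 := integrableR_trig Q mU (trig_sin c).
    have ic1 : integrableR Q (fun t => cos (\sum_i c i * U i t)).
      have := integrableR_trig Q mU (trig_cos c 0); congr (integrableR _ _).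
      by apply/funext => t; rewrite addr0.
    rewrite -!ExZ// -ExB; [|exact: integrableRZ|exact: integrableRZ].
    by congr Rintegral; apply/funext => t; rewrite cosD mulrC [sin a * _]mulrC.
  rewrite phase// (_ : (fun n => _) = fun n =>
      cos a * Ex P (fun t => cos (\sum_i c i * V n i t)) -
      sin a * Ex P (fun t => sin (\sum_i c i * V n i t))).
    apply: cvgB; apply: cvgM; [exact: cvg_cst|exact: cvg_cos|exact: cvg_cst|].
    exact: cvg_sin.
  by apply/funext => n; rewrite phase.
- move=> g h tg cg th ch; rewrite ExD; [|exact: integrableR_trig..].
  rewrite (_ : (fun n => _) = fun n =>
    Ex P (fun t => g ((V n)^~ t)) + Ex P (fun t => h ((V n)^~ t))).
    exact: cvgD cg ch.
  by apply/funext => n; rewrite ExD//; exact: integrableR_trig.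
- move=> a g tg cg; rewrite ExZ; last exact: integrableR_trig.
  rewrite (_ : (fun n => _) = fun n => a * Ex P (fun t => g ((V n)^~ t))).
    by apply: cvgM cg; exact: cvg_cst.
  by apply/funext => n; rewrite ExZ//; exact: integrableR_trig.
Qed.

Lemma cvg_almost_periodic g : almost_periodic g ->
  Ex P (fun t => g ((V n)^~ t)) @[n --> \oo] --> Ex P' (fun t => g (W^~ t)).
Proof.
move=> ag; apply/cvgrPdist_le => e e0.
have e30 : 0 < e / 3 by rewrite divr_gt0.
have [h th hg] := ag _ e30.
have /cvgrPdist_le/(_ _ e30) := cvg_trig th.
apply: filterS => n hn.
have lP : `|Ex P (fun t => h ((V n)^~ t)) - Ex P (fun t => g ((V n)^~ t))| <= e / 3.
  rewrite -[leRHS](Ex_cst P); apply: Ex_dist => //.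
  - exact: integrableR_trig.
  - exact: integrableR_almost_periodic.
  - exact: integrableR_cst.
have lP' : `|Ex P' (fun t => h (W^~ t)) - Ex P' (fun t => g (W^~ t))| <= e / 3.
  rewrite -[leRHS](Ex_cst P'); apply: Ex_dist => //.
  - exact: integrableR_trig.
  - exact: integrableR_almost_periodic.
  - exact: integrableR_cst.
move: hn lP lP'; rewrite !ler_norml => /andP[? ?] /andP[? ?] /andP[? ?].
by apply/andP; split; lra.
Qed.

(** Cubes carry almost all the mass by the bound on the first moments. *)
Lemma levy_max_coord f (B : R) : continuous f -> (forall y, `|f y| <= B) ->
  Ex P (fun t => f (max_coord ((V n)^~ t))) @[n --> \oo] -->
  Ex P' (fun t => f (max_coord (W^~ t))).
Proof.
move=> cf fB; apply/cvgrPdist_le => e e0.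
have B0 : 0 <= B by rewrite (le_trans _ (fB 0)).
have C0 : 0 <= C by apply: le_trans (VC 0 ord0); exact: Ex_ge0.
(* With this [M], replacing [f (max_coord x)] by [g x] costs [e / 3]. *)
pose M := 6 * B * N.+1%:R * C / e + 1.
have M0 : 0 < M.
  by rewrite /M ltr_wpDl// divr_ge0 ?(ltW e0)// !mulr_ge0.
have [g [ag gB gf]] := @max_coord_almost_periodic R N f B M cf fB M0.
have e30 : 0 < e / 3 by rewrite divr_gt0.
have /cvgrPdist_le/(_ _ e30) := cvg_almost_periodic ag.
have close x : `|f (max_coord x) - g x| <= 2 * B / M * \sum_i `|x i|.
  have [xM|] := pselect (forall i, `|x i| <= M).
    by rewrite gf// subrr normr0 mulr_ge0 ?divr_ge0 ?(ltW M0) ?mulr_ge0 ?sumr_ge0.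
  move=> /existsNP[i /negP]; rewrite -ltNge => xi.
  rewrite (le_trans (ler_normB _ _))// (@le_trans _ _ (2 * B))//.
    by rewrite mulr_natl mulr2n lerD.
  rewrite mulrAC ler_pdivlMr// ler_wpM2l ?mulr_ge0// (le_trans (ltW xi))//.
  by rewrite (bigD1 i)//= lerDl sumr_ge0.
have tail : 2 * B / M * (N.+1%:R * C) <= e / 3.
  rewrite mulrAC ler_pdivrMr// /M mulrDr mulr1 ler_wpDr ?(ltW e30)//.
  rewrite le_eqVlt; apply/orP; left; apply/eqP; field.
  exact: lt0r_neq0.
have mmax d0 (S0 : measurableType d0) (U : 'I_N.+1 -> S0 -> R) :
    (forall i, measurable_fun [set: S0] (U i)) ->
    measurable_fun [set: S0] (fun t => f (max_coord (U^~ t))).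
  move=> mU; apply: (@measurableT_comp _ _ _ _ _ _ f).
    exact: continuous_measurable_fun.
  exact: measurable_max_coord.
have lem d0 (S0 : measurableType d0) (Q : probability S0 R)
    (U : 'I_N.+1 -> S0 -> R) : (forall i, integrableR Q (U i)) ->
    (forall i, Ex Q (fun t => `|U i t|) <= C) ->
    `|Ex Q (fun t => f (max_coord (U^~ t))) - Ex Q (fun t => g (U^~ t))| <= e / 3.
  move=> iU UC; have mU i := integrableR_measurable (iU i).
  apply: le_trans tail.
  apply: (@le_trans _ _ (Ex Q (fun t => 2 * B / M * \sum_i `|U i t|))).
    apply: Ex_dist => [|||t].
    - by apply: integrableR_bounded (mmax _ _ _ mU) _ => t; exact: fB.
    - exact: integrableR_almost_periodic.
    - by apply: integrableRZ; apply: integrableR_sum => i _; exact: integrableR_norm.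
    - exact: close.
  rewrite ExZ; last by apply: integrableR_sum => i _; exact: integrableR_norm.
  rewrite ler_wpM2l ?divr_ge0 ?mulr_ge0 ?(ltW M0)//.
  rewrite Ex_sum => [|i _]; last exact: integrableR_norm.
  rewrite (le_trans (ler_sum _ (fun i _ => UC i)))//.
  by rewrite sumr_const card_ord mulr_natl.
apply: filterS => n hn.
have l1 := lem _ _ P (V n) (iV n) (VC n); have l2 := lem _ _ P' W iW WC.
move: hn l1 l2.
rewrite !ler_norml => /andP[? ?] /andP[? ?] /andP[? ?].
by apply/andP; split; lra.
Qed.

End LevyContinuity.

(** * Moments and characteristic function of normal variables *)

Section IntegralOfDerivative.
Context {R : realType}.
Notation mu := (@lebesgue_measure R).

(** Integration by parts without boundary terms: an integrable derivative of a
    function that vanishes at infinity has integral 0. *)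
Lemma Rintegral_derive0 (F f : R -> R) : (forall x : R, is_derive x 1 F (f x)) ->
  continuous f -> mu.-integrable [set: R] (EFin \o f) ->
  F n%:R @[n --> \oo] --> 0 -> F (- n%:R) @[n --> \oo] --> 0 ->
  Rintegral mu [set: R] f = 0.
Proof.
move=> dF cf fi Fy FNy.
pose A (n : nat) : set R := `[(- n%:R)%R, n%:R]%classic.
have mA n : measurable (A n) by exact: measurable_itv.
have cv : Rintegral mu [set: R] (fun x => f x * \1_(A n) x) @[n --> \oo] -->
    Rintegral mu [set: R] f.
  have mf := @measurable_int _ _ _ _ _ _ fi.
  have [|||||_ _ cY] := @dominated_convergence _ _ _ mu _ measurableT
    (fun n x => (f x * \1_(A n) x)%:E) (EFin \o f) (abse \o (EFin \o f)).
  - move=> n; apply/measurable_EFinP/measurable_funM.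
      by move/measurable_EFinP : mf.
    by apply: measurable_indic; exact: mA.
  - exact: mf.
  - apply: aeW => x _; apply: cvg_EFin; first exact: nearW.
    apply: cvg_near_cst; near=> n; rewrite /comp/= indicE mem_set ?mulr1//.
    rewrite /A/= in_itv/= -ler_norml; near: n; exact: nbhs_infty_ger.
  - exact: integrable_abse.
  - apply: aeW => x n _ /=; rewrite lee_fin normrM indicE.
    by case: (_ \in _); rewrite ?normr1 ?mulr1// normr0 mulr0.
  apply: (@fine_cvg _ _ _ _ (fun n => \int[mu]_x (f x * \1_(A n) x)%:E)%E).
  rewrite /Rintegral fineK; first exact: cY.
  exact: integrable_fin_num fi.
have eqF n : Rintegral mu [set: R] (fun x => f x * \1_(A n.+1) x) =
    F n.+1%:R - F (- n.+1%:R).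
  rewrite /Rintegral -[RHS]/(fine ((F n.+1%:R)%:E - (F (- n.+1%:R))%:E)%E).
  congr fine.
  rewrite -(@continuous_FTC2 _ f F).
  - rewrite [RHS]integral_mkcond; apply: eq_integral => x _.
    by rewrite patchE indicE /A; case: ifPn => _; rewrite ?mulr1 ?mulr0.
  - by rewrite -subr_gt0 opprK -natrD ltr0n.
  - exact: continuous_subspaceT.
  - have cF x : {for x, continuous F}.
      by apply: differentiable_continuous; apply/derivable1_diffP; have [] := dF x.
    split.
    + by move=> x _; have [] := dF x.
    + by apply: cvg_at_right_filter; exact: cF.
    + by apply: cvg_at_left_filter; exact: cF.
  - by move=> x _; rewrite derive1E; have [_ ->] := dF x.
have cv0 : F n.+1%:R - F (- n.+1%:R) @[n --> \oo] --> 0.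
  rewrite -[X in _ --> X](subr0 0); apply: cvgB.
    by rewrite (cvg_shiftS (fun n : nat => F n%:R)).
  by rewrite (cvg_shiftS (fun n : nat => F (- n%:R))).
move: cv; rewrite -cvg_shiftS /= => cv.
rewrite (_ : (fun n => F n.+1%:R - F (- n.+1%:R)) = (fun n =>
  Rintegral mu [set: R] (fun x => f x * \1_(A n.+1) x))) in cv0; last first.
  by apply/funext => n; rewrite eqF.
by rewrite -(cvg_lim _ cv)// (cvg_lim _ cv0).
Unshelve. all: by end_near. Qed.

End IntegralOfDerivative.

Section NormalDensity.
Context {R : realType} (a s : R).
Hypothesis s0 : s != 0.
Notation mu := (@lebesgue_measure R).
Notation p := (normal_pdf a s).

Let s20 : 0 < s ^+ 2. Proof. by rewrite exprn_even_gt0. Qed.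
Let c40 : 0 <= 4 * s ^+ 2. Proof. by rewrite mulr_ge0// sqr_ge0. Qed.

Let pE x : p x = normal_peak s * expR (- (x - a) ^+ 2 / (s ^+ 2 *+ 2)).
Proof. by rewrite normal_pdfE. Qed.

Lemma is_derive_normal_pdf (x : R) :
  is_derive x 1 p (- ((x - a) / s ^+ 2) * p x).
Proof.
rewrite (_ : p = fun x => normal_peak s *
    (expR \o (fun x => (- (s ^+ 2 *+ 2)^-1) * ((x - a) * (x - a)))) x).
  apply: is_derive_eq; rewrite /= /GRing.scale/=; field; exact: s0.
apply/funext => y; rewrite pE; congr (_ * expR _).
by rewrite expr2; field; exact: s0.
Qed.

(** The polynomial factor costs a constant and doubles the variance. *)
Lemma sqr_normal_pdf_le x : (x - a) ^+ 2 * p x <=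
  4 * s ^+ 2 * normal_peak s * expR (- (x - a) ^+ 2 / ((Num.sqrt 2 * s) ^+ 2 *+ 2)).
Proof.
pose u := (x - a) ^+ 2 / (4 * s ^+ 2).
rewrite exprMn sqr_sqrtr// pE.
have -> : - (x - a) ^+ 2 / ((2 * s ^+ 2) *+ 2) = - u.
  by rewrite /u; field; exact: s0.
have -> : - (x - a) ^+ 2 / (s ^+ 2 *+ 2) = - u + - u.
  by rewrite /u; field; exact: s0.
have -> : (x - a) ^+ 2 = 4 * s ^+ 2 * u.
  by rewrite /u; field; exact: s0.
rewrite expRD [leLHS](_ : _ = 4 * s ^+ 2 * normal_peak s * expR (- u) * (u * expR (- u))).
  rewrite ler_piMr//.
    by rewrite mulr_ge0 ?expR_ge0// mulr_ge0 ?normal_peak_ge0// c40.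
  rewrite expRN ler_pdivrMr ?expR_gt0// mul1r.
  by have := @expR_ge1Dx R u; lra.
ring.
Qed.

Lemma integrable_sqr_normal_pdf :
  mu.-integrable [set: R] (fun x => ((x - a) ^+ 2 * p x)%:E).
Proof.
have s2 : Num.sqrt 2 * s != 0 by rewrite mulf_neq0// gt_eqF// sqrtr_gt0.
have := @integrable_normal_pdf R a (Num.sqrt 2 * s).
rewrite (normal_pdfE _ s2) => i2.
have c0 : 0 <= 4 * s ^+ 2 * normal_peak s.
  by rewrite mulr_ge0 ?normal_peak_ge0.
have := @integrableZl _ _ _ mu _ measurableT
  (4 * s ^+ 2 * normal_peak s / normal_peak (Num.sqrt 2 * s)) _ i2.
apply: le_integrable => //.
  apply/measurable_EFinP/measurable_funM; last exact: measurable_normal_pdf.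
  by apply: measurable_funX; exact: measurable_funB.
move=> x _ /=; rewrite lee_fin ger0_norm; last first.
  by apply: mulr_ge0; [exact: sqr_ge0|exact: normal_pdf_ge0].
rewrite ger0_norm; last first.
  rewrite mulr_ge0 ?divr_ge0 ?normal_peak_ge0//.
  by rewrite mulr_ge0 ?normal_peak_ge0 ?normal_fun_ge0.
rewrite (le_trans (sqr_normal_pdf_le x))// [leRHS]mulrA divfK; first exact: lexx.
by rewrite gt_eqF// normal_peak_gt0.
Qed.

Lemma integrable_mul_normal_pdf (g : R -> R) (C : R) :
  measurable_fun [set: R] g -> (forall x, `|g x| <= C * (1 + (x - a) ^+ 2)) ->
  mu.-integrable [set: R] (fun x => (g x * p x)%:E).
Proof.
move=> mg gC.
have := @integrableZl _ _ _ mu _ measurableT C _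
  (integrableD measurableT (@integrable_normal_pdf R a s) integrable_sqr_normal_pdf).
apply: le_integrable => //.
  by apply/measurable_EFinP/measurable_funM => //; exact: measurable_normal_pdf.
move=> x _ /=; rewrite lee_fin normrM (ger0_norm (normal_pdf_ge0 _ _ _)).
rewrite (le_trans (ler_wpM2r (normal_pdf_ge0 _ _ _) (gC x)))//.
by rewrite -mulrA mulrDl mul1r ler_norm.
Qed.

Lemma normal_pdf_decay (F : R -> R) (C : R) (u : nat -> R) :
  (forall x, `|F x| <= C * ((1 + `|x - a|) * p x)) ->
  (forall n, n%:R <= `|u n|) -> F (u n) @[n --> \oo] --> 0.
Proof.
move=> FC un.
have C0 : 0 <= C.
  have := FC a; rewrite subrr normr0 addr0 mul1r => /(le_trans (normr_ge0 _)).
  by rewrite pmulr_lge0// normal_pdfE// mulr_gt0 ?normal_peak_gt0 ?expR_gt0.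
pose D := C * (normal_peak s * (2 + 4 * s ^+ 2)).
have D0 : 0 <= D.
  by rewrite mulr_ge0// mulr_ge0 ?normal_peak_ge0// addr_ge0.
have FD x : `|F x| * `|x - a| <= D.
  rewrite (le_trans (ler_wpM2r (normr_ge0 _) (FC x)))//.
  rewrite -!mulrA ler_wpM2l// pE.
  set E := expR _; rewrite [leLHS](_ : _ = normal_peak s *
    ((`|x - a| + `|x - a| ^+ 2) * E)); last by ring.
  rewrite ler_wpM2l ?normal_peak_ge0//.
  have yE : `|x - a| ^+ 2 * E <= 2 * s ^+ 2.
    rewrite real_normK ?num_real// /E mulNr expRN ler_pdivrMr ?expR_gt0//.
    set v := (x - a) ^+ 2 / _; have -> : (x - a) ^+ 2 = 2 * s ^+ 2 * v.
      by rewrite /v; field; exact: s0.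
    rewrite ler_wpM2l//; first by rewrite mulr_ge0// ltW.
    by have := @expR_ge1Dx R v; lra.
  have E1 : E <= 1.
    rewrite -expR0 ler_expR mulNr oppr_le0 divr_ge0 ?sqr_ge0//.
    by rewrite mulrn_wge0// ltW.
  have E0 : 0 <= E by exact: expR_ge0.
  have yy : `|x - a| <= 1 + `|x - a| ^+ 2 by have := sqr_ge0 (`|x - a| - 1); nra.
  have := ler_wpM2r E0 yy; nra.
apply/cvgrPdist_le => e e0; rewrite /=.
have [m me] : exists m : nat, D / e + `|a| + 1 <= m%:R.
  exists (Num.truncn (D / e + `|a| + 1)).+1; apply: ltW; exact: truncnS_gt.
exists m => // n /= mn; rewrite sub0r normrN.
have De0 : 0 <= D / e by rewrite divr_ge0// ltW.
have ya : D / e + 1 <= `|u n - a|.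
  have : m%:R <= `|u n| by rewrite (le_trans _ (un n))// ler_nat.
  have := ler_normD (u n - a) a; rewrite subrK; lra.
have y0 : 0 < `|u n - a| by lra.
rewrite -(ler_pM2r y0) (le_trans (FD _))// -ler_pdivrMl// mulrC.
by rewrite (le_trans _ ya)// lerDl.
Qed.

(** Stein's identity. The choices [h = 1] and [h x = x - a] give the mean and the
    variance, and [h x = sin (t * x + c)] makes the characteristic function solve
    a differential equation of first order. *)
Lemma normal_pdf_stein (h dh : R -> R) (C : R) :
  (forall x : R, is_derive x 1 h (dh x)) -> continuous dh ->
  (forall x, `|h x| <= C * (1 + `|x - a|)) ->
  (forall x, `|dh x| <= C * (1 + (x - a) ^+ 2)) ->
  [/\ mu.-integrable [set: R] (fun x => ((x - a) * h x * p x)%:E),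
      mu.-integrable [set: R] (fun x => (dh x * p x)%:E) &
      Rintegral mu [set: R] (fun x => (x - a) * h x * p x) =
      s ^+ 2 * Rintegral mu [set: R] (fun x => dh x * p x)].
Proof.
move=> dhP cdh hC dhC.
have p0 x : 0 <= p x by exact: normal_pdf_ge0.
have C0 : 0 <= C.
  by have := hC a; rewrite subrr normr0 addr0 mulr1; exact: le_trans.
have cp : continuous p by exact: continuous_normal_pdf.
have ch : continuous h.
  by move=> x; apply: differentiable_continuous; apply/derivable1_diffP; have [] := dhP x.
have csub : continuous (fun x : R => x - a).
  by move=> x; apply: cvgB; [exact: cvg_id|exact: cvg_cst].
have cxh : continuous (fun x => (x - a) * h x).
  by move=> x; apply: cvgM; [exact: csub|exact: ch].
have i1 : mu.-integrable [set: R] (EFin \o (fun x => (x - a) * h x * p x)).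
  apply: (@integrable_mul_normal_pdf _ (2 * C)) => [|x].
    exact: continuous_measurable_fun.
  rewrite normrM (le_trans (ler_wpM2l (normr_ge0 _) (hC x)))//.
  rewrite mulrCA [2 * C]mulrC -mulrA ler_wpM2l// -(real_normK (num_real (x - a))).
  have := sqr_ge0 (`|x - a| - 1); nra.
have i2 : mu.-integrable [set: R] (EFin \o (fun x => dh x * p x)).
  by apply: (@integrable_mul_normal_pdf _ C) => //; exact: continuous_measurable_fun.
split=> //.
have i3 : mu.-integrable [set: R] (EFin \o (fun x => s ^+ 2 * (dh x * p x))).
  exact: (@integrableZl _ _ _ mu _ measurableT (s ^+ 2) _ i2).
have dec x : `|- s ^+ 2 * (h x * p x)| <= s ^+ 2 * C * ((1 + `|x - a|) * p x).
  rewrite normrM normrN (ger0_norm (sqr_ge0 s)) -mulrA ler_wpM2l ?sqr_ge0//.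
  by rewrite normrM (ger0_norm (p0 x)) mulrA ler_wpM2r.
have : Rintegral mu [set: R] (fun x => (x - a) * h x * p x -
    s ^+ 2 * (dh x * p x)) = 0.
  apply: (@Rintegral_derive0 _ (fun x => - s ^+ 2 * (h x * p x))
    (fun x => (x - a) * h x * p x - s ^+ 2 * (dh x * p x))).
  - move=> x; have dhp := is_deriveM (dhP x) (is_derive_normal_pdf x).
    apply: (is_derive_eq (is_deriveZ (- s ^+ 2) dhp)).
    by rewrite /GRing.scale/=; field; exact: s0.
  - move=> x; apply: cvgB; first by apply: cvgM; [exact: cxh|exact: cp].
    apply: cvgM; first exact: cvg_cst.
    by apply: cvgM; [exact: cdh|exact: cp].
  - exact: (integrableB measurableT i1 i3).
  - by apply: normal_pdf_decay dec _ => // n; rewrite ger0_norm.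
  - by apply: normal_pdf_decay dec _ => // n; rewrite normrN ger0_norm.
rewrite RintegralB// RintegralZl//.
by move=> /eqP; rewrite subr_eq0 => /eqP.
Qed.

End NormalDensity.

Section NormalExpectation.
Context {R : realType} (a s : R).
Notation mu := (@lebesgue_measure R).
Notation p := (normal_pdf a s).

(** The density is almost everywhere the Radon-Nikodym derivative. *)
Let change_of_density (f : R -> R) : measurable_fun [set: R] f ->
  integrableR (normal_prob a s) f ->
  (\int[normal_prob a s]_x (f x)%:E = \int[mu]_x (f x * p x)%:E)%E.
Proof.
move=> mf fi.
rewrite -(Radon_Nikodym_change_of_variables (@normal_prob_dominates R a s))//=.
under [RHS]eq_integral do rewrite EFinM.
apply: ae_eq_integral => //.
- apply: emeasurable_funM; first exact/measurable_EFinP.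
  apply: (measurable_int mu); apply: Radon_Nikodym_integrable.
  exact: normal_prob_dominates.
- apply: emeasurable_funM; first exact/measurable_EFinP.
  by apply/measurable_EFinP; exact: measurable_normal_pdf.
- apply: ae_eqe_mul2l => /=.
  rewrite Radon_NikodymE//=; first exact: normal_prob_dominates.
  move=> dom; case: cid => /= h [h1 h2 h3].
  apply: integral_ae_eq => //=.
  + by apply/measurable_EFinP; exact: measurable_normal_pdf.
  + by move=> E _ mE; rewrite -h3.
Qed.

Lemma normal_prob_integrable (f : R -> R) : measurable_fun [set: R] f ->
  mu.-integrable [set: R] (fun x => (f x * p x)%:E) ->
  integrableR (normal_prob a s) f /\
  Ex (normal_prob a s) f = Rintegral mu [set: R] (fun x => f x * p x).
Proof.
move=> mf fi.
have p0 x : 0 <= p x by exact: normal_pdf_ge0.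
suff fin : integrableR (normal_prob a s) f.
  by split=> //; congr fine; exact: change_of_density.
have mnf : measurable_fun [set: R] (fun x => `|f x|) by exact: measurableT_comp.
have [||A|ifn _] := @integrableR_of_truncations _ _ (measurableTypeR R)
    (normal_prob a s) (fun x => `|f x|)
    (Rintegral mu [set: R] (fun x => `|f x * p x|)).
- exact: mnf.
- by move=> x; exact: normr_ge0.
- pose g x := Num.min `|f x| A%:R.
  have mg : measurable_fun [set: R] g by exact: measurable_minr.
  have g0 x : 0 <= g x by rewrite le_min normr_ge0 ler0n.
  have ig : integrableR (normal_prob a s) g.
    apply: (@integrableR_bounded _ _ (measurableTypeR R) _ _ A%:R) => [|x]; first exact: mg.
    by rewrite ger0_norm// ge_min lexx orbT.
  rewrite /Ex /Rintegral (change_of_density mg ig).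
  have gf x : `|g x * p x| <= `|f x * p x|.
    rewrite !normrM (ger0_norm (p0 x)) ler_wpM2r// ger0_norm//.
    by rewrite ge_min lexx.
  have igp : mu.-integrable [set: R] (EFin \o (fun x => g x * p x)).
    apply: (le_integrable measurableT _ _ fi) => [|x _]; last by rewrite lee_fin gf.
    by apply/measurable_EFinP/measurable_funM => //; exact: measurable_normal_pdf.
  apply: (@le_Rintegral _ _ _ mu _ (fun x => g x * p x) (fun x => `|f x * p x|)) => //.
    exact: (integrable_norm fi).
  by move=> x _; rewrite (le_trans (ler_norm _)).
apply: (@integrableR_le _ _ (measurableTypeR R) _ _ (fun x => `|f x|)) => //.
Qed.

End NormalExpectation.

Section GaussianVariable.
Context {R : realType} {d : measure_display} {T : measurableType d}.
Variable P : probability T R.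
Notation mu := (@lebesgue_measure R).

Lemma transfer_law (Q : probability (measurableTypeR R) R)
    (X : T -> measurableTypeR R) (f : measurableTypeR R -> R) :
  measurable_fun [set: T] X ->
  (forall A : set (measurableTypeR R), measurable A -> P (X @^-1` A) = Q A) ->
  measurable_fun [set: measurableTypeR R] f -> integrableR Q f ->
  integrableR P (f \o X) /\ Ex P (f \o X) = Ex Q f.
Proof.
move=> mX XQ mf fi.
have push (g : measurableTypeR R -> \bar R) :
    (\int[pushforward P X]_y g y = \int[Q]_y g y)%E.
  by apply: eq_measure_integral => A mA _; exact: XQ.
have int_abs : (\int[P]_x (`|f (X x)|)%:E = \int[Q]_y (`|f y|)%:E)%E.
  rewrite -push ge0_integral_pushforward//.
  - by apply/measurable_EFinP; exact: measurableT_comp.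
have fXi : integrableR P (f \o X).
  apply/integrableP; split.
    by apply/measurable_EFinP; exact: measurableT_comp.
  by rewrite /= int_abs; have /integrableP[] := fi.
split=> //; congr fine.
by rewrite -push integral_pushforward//; exact/measurable_EFinP.
Qed.

(** The degenerate case [s = 0] is a point mass and is treated apart. *)
Lemma gaussian_law_expectation (X : T -> R) (f : R -> R) (a s : R) :
  measurable_fun [set: T] X ->
  (forall A : set R, measurable A -> P (X @^-1` A) = gaussian_law a s A) ->
  measurable_fun [set: R] f ->
  (s != 0 -> mu.-integrable [set: R] (fun x => (f x * normal_pdf a s x)%:E)) ->
  integrableR P (f \o X) /\ Ex P (f \o X) =
    if s == 0 then f a else Rintegral mu [set: R] (fun x => f x * normal_pdf a s x).
Proof.
move=> mX Xlaw mf fi; have [s0|s0] := eqVneq s 0; last first.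
  have [fQ eQ] := normal_prob_integrable mf (fi s0).
  rewrite -eQ; apply: (@transfer_law (normal_prob a s) X f) => //.
  by move=> A mA; rewrite Xlaw// /gaussian_law (negbTE s0).
have mfX : measurable_fun [set: T] (f \o X) by exact: measurableT_comp.
have aeX : {ae P, forall t, f a = f (X t)}.
  exists (~` (X @^-1` [set a])); split.
  - by apply: measurableC; rewrite -[X in measurable X]setTI; exact: mX.
  - rewrite probability_setC; last by rewrite -[X in measurable X]setTI; exact: mX.
    by rewrite Xlaw// /gaussian_law s0 eqxx diracE mem_set// subee.
  - by move=> t /= h Xt; apply: h; rewrite Xt.
split; first exact: ae_eq_integrableR aeX mfX (integrableR_cst _ _).
by rewrite -(ae_eq_Ex (measurable_cst _) mfX aeX) Ex_cst.
Qed.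

Lemma gaussian_stein (X : T -> R) (a s : R) (h dh : R -> R) (C : R) :
  measurable_fun [set: T] X ->
  (forall A : set R, measurable A -> P (X @^-1` A) = gaussian_law a s A) ->
  (forall x : R, is_derive x 1 h (dh x)) -> continuous dh ->
  (forall x, `|h x| <= C * (1 + `|x - a|)) ->
  (forall x, `|dh x| <= C * (1 + (x - a) ^+ 2)) ->
  [/\ integrableR P (fun t => (X t - a) * h (X t)), integrableR P (fun t => dh (X t)) &
      Ex P (fun t => (X t - a) * h (X t)) = s ^+ 2 * Ex P (fun t => dh (X t))].
Proof.
move=> mX Xlaw dhP cdh hC dhC.
have ch : continuous h.
  by move=> x; apply: differentiable_continuous; apply/derivable1_diffP; have [] := dhP x.
have mh : measurable_fun [set: R] (fun x => (x - a) * h x).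
  apply: measurable_funM; first exact: measurable_funB.
  exact: continuous_measurable_fun.
have mdh : measurable_fun [set: R] dh by exact: continuous_measurable_fun.
have stein s0 := @normal_pdf_stein R a s s0 h dh C dhP cdh hC dhC.
have [|i1 E1] := gaussian_law_expectation mX Xlaw mh.
  by move=> s0; have [] := stein s0.
have [|i2 E2] := gaussian_law_expectation mX Xlaw mdh.
  by move=> s0; have [] := stein s0.
split; [exact: i1|exact: i2|].
rewrite [LHS]E1 [Ex P (fun t => dh (X t))]E2.
have [->|s0] := eqVneq s 0; first by rewrite subrr mul0r expr0n mul0r.
by have [] := stein s0.
Qed.

Lemma gaussian_mean_variance (X : T -> R) (a s : R) :
  measurable_fun [set: T] X ->
  (forall A : set R, measurable A -> P (X @^-1` A) = gaussian_law a s A) ->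
  [/\ integrableR P X, Ex P X = a, integrableR P (fun t => (X t - a) ^+ 2) &
      Ex P (fun t => (X t - a) ^+ 2) = s ^+ 2].
Proof.
move=> mX Xlaw.
have y1 (y : R) : 1 <= 1 * (1 + y ^+ 2) by rewrite mul1r lerDl sqr_ge0.
have d1 (x : R) : is_derive x 1 (fun=> 1 : R) 0 by exact: is_derive_cst.
have d2 (x : R) : is_derive x 1 (fun x => x - a) 1.
  by apply: is_derive_eq; rewrite subr0.
have [|||i1 _] := @gaussian_stein X a s _ _ 1 mX Xlaw d1.
- by move=> x; exact: cvg_cst.
- by move=> x; rewrite normr1 mul1r lerDl.
- by move=> x; rewrite normr0 (le_trans ler01).
rewrite Ex_cst mulr0 => E1.
have [|||i2 _] := @gaussian_stein X a s _ _ 1 mX Xlaw d2.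
- by move=> x; exact: cvg_cst.
- by move=> x; rewrite mul1r lerDr.
- by move=> x; rewrite normr1.
rewrite Ex_cst mulr1 => E2.
have ic := integrableR_cst P a.
have iX : integrableR P X.
  have := integrableRD i1 ic; congr (integrableR _ _).
  by apply/funext => t; rewrite mulr1 subrK.
split=> //.
- apply/eqP; rewrite -subr_eq0 -[X in _ - X](Ex_cst P) -ExB//; apply/eqP.
  by rewrite -[RHS]E1; congr Rintegral; apply/funext => t; rewrite mulr1.
Qed.

Lemma derive_cos_expectation (X : T -> R) (c t : R) : integrableR P X ->
  is_derive t 1 (fun t => Ex P (fun w => cos (t * X w + c)))
    (- Ex P (fun w => X w * sin (t * X w + c))).
Proof.
move=> iX; have mX := integrableR_measurable iX.
have mtX r : measurable_fun [set: T] (fun w => r * X w + c).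
  by apply: measurable_funD => //; exact: measurable_funM.
have dcos (r : R) w : is_derive r 1 (fun r : R => cos (r * X w + c))
    (- (X w * sin (r * X w + c))).
  have dl : is_derive r 1 (fun r : R => r * X w + c) (X w).
    by apply: is_derive_eq; rewrite /GRing.scale/=; ring.
  have := @is_derive1_comp _ cos (fun r : R => r * X w + c) r _ _ (is_derive_cos _) dl.
  by move=> h; apply: (is_derive_eq h); rewrite mulNr mulrC.
have part (r : R) w : partial1of2 (fun r w => cos (r * X w + c)) r w =
    - (X w * sin (r * X w + c)).
  by rewrite partial1of2E; have [_ ->] := dcos r w.
have It : `]t - 1, t + 1[%classic t by rewrite /= in_itv/= gtrBl ltrDl ltr01.
have intf r : `]t - 1, t + 1[%classic r ->
    P.-integrable [set: T] (EFin \o (fun w => cos (r * X w + c))).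
  move=> _; apply: (@integrableR_bounded _ _ _ P _ 1) => [|w].
    apply: (@measurableT_comp _ _ _ _ _ _ cos) => //.
    by apply: continuous_measurable_fun; exact: continuous_cos.
  exact: cos_max.
have der r w : `]t - 1, t + 1[%classic r -> [set: T] w ->
    derivable ((fun r w => cos (r * X w + c)) ^~ w) r 1.
  by move=> _ _; have [] := dcos r w.
have iG : P.-integrable [set: T] (EFin \o (fun w => `|X w|)).
  exact: integrableR_norm.
have ub r w : `]t - 1, t + 1[%classic r -> [set: T] w ->
    `|partial1of2 (fun r w => cos (r * X w + c)) r w| <= `|X w|.
  by move=> _ _; rewrite part normrN normrM ler_piMr// sin_max.
apply: DeriveDef.
  exact: (derivable_under_integral measurableT It intf der
    (fun w => normr_ge0 (X w)) iG ub).
rewrite -derive1E.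
rewrite (differentiation_under_integral measurableT It intf der
  (fun w => normr_ge0 (X w)) iG ub).
rewrite -ExN; first by congr Rintegral; apply/funext => w; rewrite part.
apply: (integrableR_le _ _ (integrableR_norm iX)) => [|w].
  apply: measurable_funM => //; apply: (@measurableT_comp _ _ _ _ _ _ sin) => //.
  by apply: continuous_measurable_fun; exact: continuous_sin.
by rewrite normrM ler_piMr// sin_max.
Qed.

Lemma gaussian_characteristic (X : T -> R) : measurable_fun [set: T] X ->
  gaussian_variable P X -> Ex P X = 0 -> forall c,
  Ex P (fun t => cos (X t + c)) = expR (- Ex P (fun t => X t ^+ 2) / 2) * cos c.
Proof.
move=> mX [a [s [_ Xlaw]]] EX0 c.
have [iX EXa _ EX2] := gaussian_mean_variance mX Xlaw.
have a0 : a = 0 by rewrite -EXa.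
rewrite (_ : (fun t => X t ^+ 2) = fun t => (X t - a) ^+ 2); last first.
  by apply/funext => t; rewrite a0 subr0.
rewrite EX2; pose phi t := Ex P (fun w => cos (t * X w + c)).
have dphi (t : R) : is_derive t 1 phi (- (s ^+ 2 * t * phi t)).
  have dl (x : R) : is_derive x 1 (fun x : R => t * x + c) t.
    by apply: is_derive_eq; rewrite /GRing.scale/=; ring.
  have cl : continuous (fun x : R => t * x + c).
    move=> x; apply: cvgD; last exact: cvg_cst.
    by apply: cvgM; [exact: cvg_cst|exact: cvg_id].
  have ds (x : R) : is_derive x 1 (fun x => sin (t * x + c)) (t * cos (t * x + c)).
    by rewrite mulrC; exact: (is_derive1_comp (is_derive_sin _) (dl x)).
  have [|||_ _] := @gaussian_stein X a s _ _ (1 + `|t|) mX Xlaw ds.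
  - move=> x; apply: cvgM; first exact: cvg_cst.
    apply: (@continuous_comp _ _ _ (fun x : R => t * x + c) cos); first exact: cl.
    exact: continuous_cos.
  - move=> x; rewrite (le_trans (sin_max _))// -[leLHS]mulr1.
    by rewrite ler_pM// lerDl.
  - move=> x; rewrite normrM -[leRHS]mulr1 -mulrA.
    rewrite ler_pM ?lerDr// (le_trans (cos_max _))// mulr1 lerDl sqr_ge0//.
  have icos : integrableR P (fun w => cos (t * X w + c)).
    apply: (@integrableR_bounded _ _ _ _ _ 1) => [|w]; last exact: cos_max.
    apply: (@measurableT_comp _ _ _ _ _ _ cos).
      by apply: continuous_measurable_fun; exact: continuous_cos.
    by apply: measurable_funD => //; exact: measurable_funM.
  rewrite ExZ// mulrA => E.
  have <- : Ex P (fun w => X w * sin (t * X w + c)) = s ^+ 2 * t * phi t.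
    by rewrite -[RHS]E; congr Rintegral; apply/funext => w; rewrite a0 subr0.
  exact: derive_cos_expectation.
pose psi t := phi t * expR (s ^+ 2 / 2 * (t * t)).
have dpsi (t : R) : is_derive t 1 psi 0.
  have dsq : is_derive t 1 (fun t : R => s ^+ 2 / 2 * (t * t)) (s ^+ 2 * t).
    by apply: is_derive_eq; rewrite /GRing.scale/=; field.
  have de := @is_derive1_comp _ expR (fun t : R => s ^+ 2 / 2 * (t * t)) t _ _
    (is_derive_expR _) dsq.
  have := is_deriveM (dphi t) de => h; apply: (is_derive_eq h).
  by rewrite /GRing.scale/=; ring.
have := @is_derive_0_is_cst _ psi 1 0 dpsi.
rewrite /psi /phi mul0r mulr0 expR0 !mulr1.
rewrite (_ : (fun w => cos (0 * X w + c)) = fun=> cos c); last first.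
  by apply/funext => w; rewrite mul0r add0r.
rewrite Ex_cst (_ : (fun w => cos (1 * X w + c)) = fun w => cos (X w + c)); last first.
  by apply/funext => w; rewrite mul1r.
move=> <-; rewrite mulrC -mulrA -expRD.
by rewrite (_ : _ + _ = 0) ?expR0 ?mulr1//; ring.
Qed.

End GaussianVariable.

(** * Weak convergence and convergence of moments *)

Section MomentBounds.
Context {R : realType} {d : measure_display} {T : measurableType d}.
Variable P : probability T R.

Lemma measurable_normX (Y : T -> R) k : measurable_fun [set: T] Y ->
  measurable_fun [set: T] (fun t => `|Y t| ^+ k).
Proof.
by move=> mY; apply: (measurable_funX (f := fun t => `|Y t|)); exact: measurableT_comp.
Qed.

Lemma integrableR_expr (Y : T -> R) k : measurable_fun [set: T] Y ->
  integrableR P (fun t => `|Y t| ^+ k) -> integrableR P (fun t => Y t ^+ k).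
Proof.
move=> mY; apply: integrableR_le; first exact: measurable_funX.
by move=> t; rewrite normrX.
Qed.

(** Compare with 1 where [|Y| <= 1] and with the higher moment elsewhere. *)
Lemma integrableR_expr_le (Y : T -> R) (k l : nat) : (k <= l)%N ->
  measurable_fun [set: T] Y -> integrableR P (fun t => `|Y t| ^+ l) ->
  integrableR P (fun t => `|Y t| ^+ k) /\
  Ex P (fun t => `|Y t| ^+ k) <= 1 + Ex P (fun t => `|Y t| ^+ l).
Proof.
move=> kl mY il.
have le1 t : `|Y t| ^+ k <= 1 + `|Y t| ^+ l.
  have [Y1|Y1] := leP `|Y t| 1.
    by rewrite (le_trans (exprn_ile1 _ (normr_ge0 _) Y1))// lerDl exprn_ge0.
  by rewrite ler_wpDl// ler_eXn2l.
have iD : integrableR P (fun t => 1 + `|Y t| ^+ l).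
  by apply: integrableRD => //; exact: integrableR_cst.
have ik : integrableR P (fun t => `|Y t| ^+ k).
  apply: (integrableR_le _ _ iD) => [|t]; first exact: measurable_normX.
  by rewrite ger0_norm ?exprn_ge0.
split=> //; rewrite -[X in X + _](Ex_cst P) -ExD//; last exact: integrableR_cst.
exact: Ex_le.
Qed.

End MomentBounds.

Section WeakConvergence.
Context {R : realType}.
Context {d : measure_display} {T : measurableType d} (P : probability T R).
Context {d' : measure_display} {T' : measurableType d'} (P' : probability T' R).
Variables (X : nat -> T -> R) (Y : T' -> R).

Definition weak_cvg := forall (f : R -> R) (B : R), continuous f ->
  (forall y, `|f y| <= B) -> Ex P (f \o X n) @[n --> \oo] --> Ex P' (f \o Y).

Lemma weak_cvg_characteristic (C : R) :
  (forall n, integrableR P (X n)) -> integrableR P' Y ->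
  (forall n, Ex P (fun t => `|X n t|) <= C) -> Ex P' (fun t => `|Y t|) <= C ->
  (forall r, Ex P (fun t => cos (r * X n t)) @[n --> \oo] -->
     Ex P' (fun t => cos (r * Y t))) ->
  (forall r, Ex P (fun t => sin (r * X n t)) @[n --> \oo] -->
     Ex P' (fun t => sin (r * Y t))) -> weak_cvg.
Proof.
move=> iX iY XC YC ccos csin f B cf fB.
have max1 (x : R) : max_coord (fun _ : 'I_1 => x) = x.
  by rewrite /max_coord big_ord_recl big_ord0 maxxx.
have sum1 (c : 'I_1 -> R) (x : R) : \sum_i c i * x = c ord0 * x.
  by rewrite big_ord_recl big_ord0 addr0.
have fE1 d0 (S : measurableType d0) (Q : probability S R) (U : S -> R) (g : R -> R) c :
    Ex Q (fun t => g (\sum_(i < 1) c i * U t)) = Ex Q (fun t => g (c ord0 * U t)).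
  by congr Rintegral; apply/funext => t; rewrite sum1.
have := @levy_max_coord R 0 _ _ P _ _ P' (fun n _ => X n) (fun _ => Y) C
  (fun n _ => iX n) (fun _ => iY) (fun n _ => XC n) (fun _ => YC) _ _ f B cf fB.
rewrite (_ : (fun t => f (max_coord (fun _ : 'I_1 => Y t))) = f \o Y); last first.
  by apply/funext => t; rewrite max1.
rewrite (_ : (fun n => Ex P (fun t => f (max_coord (fun _ : 'I_1 => X n t)))) =
    (fun n => Ex P (f \o X n))); last first.
  by apply/funext => n; congr Rintegral; apply/funext => t; rewrite max1.
apply => c; rewrite fE1.
- rewrite (_ : (fun n => _) = (fun n => Ex P (fun t => cos (c ord0 * X n t)))) => //.
  by apply/funext => n; rewrite fE1.
- rewrite (_ : (fun n => _) = (fun n => Ex P (fun t => sin (c ord0 * X n t)))) => //.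
  by apply/funext => n; rewrite fE1.
Qed.

Hypothesis mX : forall n, measurable_fun [set: T] (X n).
Hypothesis mY : measurable_fun [set: T'] Y.
Hypothesis XY : weak_cvg.

Lemma weak_cvg_moment_bound (k : nat) (C : R) :
  (forall n, integrableR P (fun t => `|X n t| ^+ k)) ->
  (forall n, Ex P (fun t => `|X n t| ^+ k) <= C) ->
  integrableR P' (fun t => `|Y t| ^+ k) /\ Ex P' (fun t => `|Y t| ^+ k) <= C.
Proof.
move=> iX XC; apply: integrableR_of_truncations => [|t|A].
- exact: measurable_normX.
- by rewrite exprn_ge0.
have cf : continuous (fun y : R => Num.min (`|y| ^+ k) A%:R).
  move=> y; apply: (@continuous_min _ _ (fun y => `|y| ^+ k) (fun=> A%:R)).
    apply: (@continuous_comp _ _ _ (fun y : R => `|y|) (fun y => y ^+ k)).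
      exact: norm_continuous.
    exact: exprn_continuous.
  exact: cvg_cst.
have fA (y : R) : `|Num.min (`|y| ^+ k) A%:R| <= A%:R.
  by rewrite ger0_norm ?le_min ?exprn_ge0 ?ler0n// ge_min lexx orbT.
have := XY cf fA; rewrite /comp => cXY.
rewrite -(cvg_lim _ cXY)//; apply: limr_le; first by apply/cvg_ex; eexists; exact: cXY.
apply: nearW => n; apply: le_trans (XC n); apply: Ex_le => //.
  apply: (@integrableR_bounded _ _ _ _ _ A%:R) => [|t]; last exact: fA.
  apply: (@measurableT_comp _ _ _ _ _ _ (fun y : R => Num.min (`|y| ^+ k) A%:R)) => //.
  exact: continuous_measurable_fun.
by move=> t; rewrite ge_min lexx.
Qed.

(** Uniform integrability of the [k]-th powers comes from the bound on the
    moments of order [2 k]. *)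
Lemma weak_cvg_moments (k : nat) (C : R) :
  (forall n, integrableR P (fun t => `|X n t| ^+ k.*2)) ->
  (forall n, Ex P (fun t => `|X n t| ^+ k.*2) <= C) ->
  [/\ forall n, integrableR P (fun t => X n t ^+ k),
      integrableR P' (fun t => Y t ^+ k) &
      Ex P (fun t => X n t ^+ k) @[n --> \oo] --> Ex P' (fun t => Y t ^+ k)].
Proof.
move=> iX XC; have [iY YC] := weak_cvg_moment_bound iX XC.
have kk : (k <= k.*2)%N by rewrite -addnn leq_addr.
have iXk n : integrableR P (fun t => X n t ^+ k).
  by apply: integrableR_expr => //; have [] := integrableR_expr_le kk (mX n) (iX n).
have iYk : integrableR P' (fun t => Y t ^+ k).
  by apply: integrableR_expr => //; have [] := integrableR_expr_le kk mY iY.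
split=> //; apply/cvgrPdist_le => e e0.
have C0 : 0 <= C by apply: le_trans (XC 0); apply: Ex_ge0 => t; rewrite exprn_ge0.
pose A : R := 3 * C / e + 1.
have A0 : 0 < A by rewrite /A ltr_wpDl// divr_ge0 ?mulr_ge0// ltW.
pose f (y : R) : R := Num.max (- A) (Num.min (y ^+ k) A).
have cf : continuous f.
  move=> y; apply: (@continuous_max _ _ (fun=> - A)
    (fun y : R => Num.min (y ^+ k) A)); first exact: cvg_cst.
  apply: (@continuous_min _ _ (fun y : R => y ^+ k) (fun=> A)); last exact: cvg_cst.
  exact: exprn_continuous.
have fA y : `|f y| <= A.
  rewrite ler_norml /f le_max lexx/= ge_max; apply/andP; split; first lra.
  by rewrite ge_min lexx orbT.
have fk y : `|f y - y ^+ k| <= `|y| ^+ k.*2 / A.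
  rewrite -muln2 exprM -normrX; set z := y ^+ k.
  have z2 : 0 <= `|z| ^+ 2 / A by rewrite divr_ge0 ?exprn_ge0// ltW.
  have [zA|zA] := leP `|z| A.
    move: zA; rewrite ler_norml /f => /andP[zl zr].
    by rewrite min_l// max_r// subrr normr0.
  apply: (@le_trans _ _ `|z|).
    rewrite /f -/z; have [z0|z0] := leP 0 z.
      move: zA; rewrite ger0_norm// => zA.
      by rewrite min_r ?(ltW zA)// max_r ?ler0_norm; lra.
    move: zA; rewrite ltr0_norm// => zA.
    by rewrite min_l ?max_l ?ger0_norm; lra.
  by rewrite ler_pdivlMr// expr2 ler_wpM2l// ltW.
have small : C / A <= e / 3.
  rewrite ler_pdivrMr// /A mulrDr mulr1 ler_wpDr ?divr_ge0 ?(ltW e0)//.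
  by rewrite le_eqVlt; apply/orP; left; apply/eqP; field; exact: lt0r_neq0.
have close d0 (S : measurableType d0) (Q : probability S R) (U : S -> R) :
    measurable_fun [set: S] U -> integrableR Q (fun t => U t ^+ k) ->
    integrableR Q (fun t => `|U t| ^+ k.*2) ->
    Ex Q (fun t => `|U t| ^+ k.*2) <= C ->
    `|Ex Q (f \o U) - Ex Q (fun t => U t ^+ k)| <= e / 3.
  move=> mU iUk iU UC; apply: le_trans small.
  apply: (@le_trans _ _ (Ex Q (fun t => A^-1 * `|U t| ^+ k.*2))).
    apply: Ex_dist => //.
    - apply: (@integrableR_bounded _ _ _ _ _ A) => [|t]; last exact: fA.
      by apply: measurableT_comp => //; exact: continuous_measurable_fun.
    - exact: integrableRZ.
    - by move=> t; rewrite mulrC; exact: fk.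
  by rewrite ExZ// mulrC ler_wpM2r// invr_ge0 ltW.
have e30 : 0 < e / 3 by rewrite divr_gt0.
have /cvgrPdist_le/(_ _ e30) := XY cf fA.
apply: filterS => n.
have l1 := close _ _ P _ (mX n) (iXk n) (iX n) (XC n).
have l2 := close _ _ P' _ mY iYk iY YC.
move: l1 l2; rewrite !ler_norml => /andP[? ?] /andP[? ?] /andP[? ?].
by apply/andP; split; lra.
Qed.

End WeakConvergence.

(** * Strings, prefixes and the function m *)

Section GeometricSeries.
Context {R : realType}.

Lemma sum_geometric_le (q : R) (L n : nat) : 0 <= q < 1 ->
  \sum_(L <= k < n) q ^+ k <= q ^+ L / (1 - q).
Proof.
move=> /andP[q0 q1]; have q10 : 0 < 1 - q by rewrite subr_gt0.
have [nL|Ln] := leqP n L.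
  by rewrite big_geq// divr_ge0 ?exprn_ge0// ltW.
rewrite -(subnKC (ltnW Ln)); elim: (n - L)%N => [|k IHk].
  by rewrite addn0 big_geq// divr_ge0 ?exprn_ge0// ltW.
suff : \sum_(L <= i < L + k.+1) q ^+ i <= q ^+ L / (1 - q) - q ^+ (L + k.+1) / (1 - q).
  by move/le_trans; apply; rewrite gerBl divr_ge0 ?exprn_ge0// ltW.
elim: k.+1 => [|j IHj]; first by rewrite addn0 subrr big_geq.
rewrite addnS big_nat_recr/= ?leq_addr// exprS.
apply: (le_trans (lerD IHj (lexx _))); rewrite le_eqVlt; apply/orP; left.
by apply/eqP; field; rewrite subr_eq0 eq_sym lt_eqF.
Qed.

Lemma geometric_series_tail (a : nat -> R) (C q : R) : 0 <= q < 1 ->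
  (forall k, `|a k| <= C * q ^+ k) ->
  cvgn (series a) /\
  forall L, `|limn (series a) - \sum_(0 <= k < L) a k| <= C * q ^+ L / (1 - q).
Proof.
move=> q01 aC; have /andP[q0 q1] := q01.
have C0 : 0 <= C by have := aC 0%N; rewrite expr0 mulr1; apply: le_trans.
have ca : cvgn (series a).
  apply: normed_cvg; apply: (@series_le_cvg _ _ (geometric C q)).
  - by move=> n; rewrite /= normr_ge0.
  - by move=> n; rewrite /= mulr_ge0// exprn_ge0.
  - by move=> n; exact: aC.
  - by apply: is_cvg_geometric_series; rewrite ger0_norm.
split=> // L.
have bnd n : (L <= n)%N ->
    `|series a n - \sum_(0 <= k < L) a k| <= C * q ^+ L / (1 - q).
  move=> Ln; rewrite /series/= (@big_cat_nat _ _ _ L 0 n)//= addrAC subrr add0r.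
  rewrite (le_trans (ler_norm_sum _ _ _))//.
  apply: (@le_trans _ _ (\sum_(L <= k < n) C * q ^+ k)).
    by apply: ler_sum => k _; exact: aC.
  rewrite -mulr_sumr -mulrA ler_wpM2l//; exact: sum_geometric_le.
have cc : `|series a n - \sum_(0 <= k < L) a k| @[n --> \oo] -->
    `|limn (series a) - \sum_(0 <= k < L) a k|.
  by apply: cvg_norm; apply: cvgB; [exact: ca|exact: cvg_cst].
rewrite -(cvg_lim _ cc)//; apply: limr_le; first by apply/cvg_ex; eexists; exact: cc.
by exists L => // n /= Ln; exact: bnd.
Qed.

Lemma eseries_EFin (x : nat -> R) (l : R) : series x @ \oo --> l ->
  (\sum_(0 <= k <oo) (x k)%:E = l%:E)%E.
Proof.
move=> xl; apply/cvg_lim => //.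
rewrite (_ : (fun n => _) = EFin \o series x); last first.
  by apply/funext => n /=; rewrite sumEFin.
apply: cvg_EFin; first exact: nearW.
by rewrite (_ : fine \o (EFin \o series x) = series x).
Qed.

End GeometricSeries.

Section Prefixes.
Context {b : nat}.
Implicit Types (u v w : string b).

Lemma agree_sym k v w : agree k v w -> agree k w v.
Proof. by move=> vw i ik; rewrite vw. Qed.
Lemma agree_trans k u v w : agree k u v -> agree k v w -> agree k u w.
Proof. by move=> uv vw i ik; rewrite uv// vw. Qed.
Lemma agree_le k l v w : (k <= l)%N -> agree l v w -> agree k v w.
Proof. by move=> kl vw i ik; rewrite vw// (leq_trans ik). Qed.

Definition prefix k v : k.-tuple 'I_b := [tuple v i | i < k].

Lemma prefix_mkseq k v : prefix k v = mkseq v k :> seq 'I_b.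
Proof. by rewrite /= /mkseq -val_enum_ord -map_comp. Qed.

Lemma agreeP k v w : reflect (agree k v w) (prefix k v == prefix k w).
Proof.
apply: (iffP eqP) => [vw i ik|vw].
  by have := congr1 (fun x => tnth x (Ordinal ik)) vw; rewrite !tnth_mktuple.
by apply: eq_from_tnth => i; rewrite !tnth_mktuple vw.
Qed.

Lemma agree_lcp (R : realType) k v w :
  ((k%:R)%:E <= lcp R v w)%E = (prefix k v == prefix k w).
Proof.
apply/idP/idP => [kl|/agreeP vw]; last by apply: ereal_sup_ubound; exists k.
apply/agreeP; have [//|nvw] := pselect (agree k v w).
have : (lcp R v w <= (k%:R - 1)%:E)%E.
  apply: ub_ereal_sup => _ [l vwl <-]; rewrite lee_fin lerBrDr natr1 ler_nat.
  by rewrite ltnNge; apply/negP => kle; apply: nvw; exact: agree_le vwl.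
move=> /(le_trans kl); rewrite lee_fin => h.
by exfalso; move: h; rewrite leNgt ltrBlDr ltrDl ltr01.
Qed.

Lemma LambdaE (R : realType) (T : Type) (S : nat -> T -> string b) n k v t :
  Lambda R S n k v t = (\sum_(i < n) (prefix k (S i t) == prefix k v))%N.
Proof. by apply: eq_bigr => i _; rewrite agree_lcp eq_sym. Qed.

End Prefixes.

Section StringTopology.
Context {b : nat}.
Implicit Types (u v w : string b).

Lemma nbhs_agree v (U : set (string b)) : nbhs v U ->
  exists K, forall u, agree K u v -> U u.
Proof.
pose F : set_system (string b) :=
  filter_from [set: nat] (fun K => [set u | agree K u v]).
have FF : Filter F.
  apply: filter_from_filter; first by exists 0%N.
  move=> i j _ _; exists (maxn i j) => // u /= uv.
  by split; apply: agree_le uv; rewrite ?leq_maxl ?leq_maxr.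
have : F --> v.
  apply/cvg_sup => N W [V] [[A] oA <-] AvN AW.
  by exists N.+1 => // u /= uv; apply: AW => /=; rewrite /= uv.
by move=> Fv /Fv[K _ KU]; exists K.
Qed.

Lemma agree_nbhs v K : nbhs v [set u | agree K u v].
Proof.
elim: K => [|K IHK]; first by apply: filterS filterT => u _ i.
have projK : nbhs v [set u | u K = v K].
  have pc := @proj_continuous nat (fun=> discrete_topology 'I_b) K v.
  by apply: (pc [set v K]); exact: discrete_set1.
apply: filterS2 IHK projK => u uv uvK i; rewrite ltnS leq_eqVlt => /orP[/eqP->//|].
exact: uv.
Qed.

Lemma string_continuous (R : realType) (f : string b -> R) :
  (forall v e, 0 < e -> exists K, forall u, agree K u v -> `|f u - f v| <= e) ->
  continuous f.
Proof.
move=> fc v U /nbhs_ballP[e /= e0 eU].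
have e20 : 0 < e / 2 by rewrite divr_gt0.
have [K Kf] := fc v _ e20.
rewrite nbhs_simpl/=; apply: filterS (agree_nbhs v K) => u /= uv; apply: eU.
rewrite /ball/= distrC (le_lt_trans (Kf u uv))//.
by rewrite ltr_pdivrMr// ltr_pMr// ltr1n.
Qed.

Lemma string_compact : compact [set: string b].
Proof.
have := @tychonoff nat (fun=> discrete_topology 'I_b) (fun=> setT).
rewrite (_ : [set f | forall i, [set: discrete_topology 'I_b] (f i)] = setT).
  by apply => i; apply: finite_compact; exact: (@finite_finset 'I_b).
by apply/seteqP; split.
Qed.

(** Sets that only depend on a prefix of fixed length are clopen. *)
Lemma prefix_set_compact K (A : set (string b)) :
  (forall u v, agree K u v -> A u -> A v) -> compact A.
Proof.
move=> Aagree; apply: (subclosed_compact _ string_compact) => //.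
rewrite -openC openE => v nAv; apply: filterS (agree_nbhs v K) => u uv Au.
by apply: nAv; exact: Aagree uv Au.
Qed.

End StringTopology.

Section Weights.
Context {R : realType} {b : nat} (mu : 'I_b -> R) (p : 'M[R]_b).
Hypothesis hmu : forall i, 0 < mu i < 1.
Hypothesis hp : forall i j, 0 < p i j < 1.

Lemma weight_ratio_ex : exists2 q : R, 0 < q < 1 &
  (forall i, mu i <= q) /\ (forall i j, p i j <= q).
Proof.
pose q := \big[Num.max/2^-1]_i Num.max (mu i) (\big[Num.max/2^-1]_j p i j).
have half0 : 0 < 2^-1 :> R by rewrite invr_gt0.
have half1 : 2^-1 < 1 :> R by rewrite invf_lt1// ltr1n.
exists q.
  rewrite (lt_le_trans half0) /q ?bigmax_ge_id//=.
  apply: bigmax_lt => // i _; rewrite gt_max; have /andP[_ ->] /= := hmu i.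
  by apply: bigmax_lt => // j _; have /andP[] := hp i j.
have qi i : Num.max (mu i) (\big[Num.max/2^-1]_j p i j) <= q.
  exact: (@le_bigmax_cond _ _ _ _ _ _ (fun i =>
    Num.max (mu i) (\big[Num.max/2^-1]_j p i j))).
split=> [i|i j]; apply: le_trans (qi i); rewrite le_max ?lexx//.
by apply/orP; right; exact: (@le_bigmax_cond _ _ _ _ _ _ (fun j => p i j)).
Qed.

Lemma word_weight_ge0 s : 0 <= word_weight mu p s.
Proof.
case: s => //= x s; rewrite mulr_ge0//; first by have /andP[/ltW] := hmu x.
elim: s x => //= y s IHs x; rewrite mulr_ge0//.
by have /andP[/ltW] := hp x y.
Qed.

Variable q : R.
Hypothesis q01 : 0 < q < 1.
Hypothesis muq : forall i, mu i <= q.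
Hypothesis pq : forall i j, p i j <= q.

Lemma word_weight_le s : word_weight mu p s <= q ^+ size s.
Proof.
have /andP[q0 _] := q01.
case: s => //= x s; rewrite exprS ler_pM//; first by have /andP[/ltW] := hmu x.
  elim: s x => //= y s IHs x; rewrite mulr_ge0//.
  by have /andP[/ltW] := hp x y.
elim: s x => //= y s IHs x; rewrite exprS ler_pM//; first by have /andP[/ltW] := hp x y.
elim: s y {IHs} => //= z s IHs y; rewrite mulr_ge0//.
by have /andP[/ltW] := hp y z.
Qed.

Lemma word_weight_rcons s x y :
  word_weight mu p (rcons (rcons s x) y) = word_weight mu p (rcons s x) * p x y.
Proof.
case: s => [|z s] /=; first by rewrite !mulr1.
rewrite -mulrA; congr (_ * _).
by elim: s z => [|z' s IHs] z /=; rewrite ?mulr1// IHs mulrA.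
Qed.

Let weight_norm (v : string b) k :
  `|word_weight mu p (mkseq v k)| <= 1 * q ^+ k.
Proof.
rewrite mul1r ger0_norm ?word_weight_ge0//.
by rewrite -[X in q ^+ X](size_mkseq v); exact: word_weight_le.
Qed.

Let q01' : 0 <= q < 1. Proof. by have /andP[/ltW -> ->] := q01. Qed.

Lemma m_cvg (v : string b) : cvgn (series (fun k => word_weight mu p (mkseq v k))).
Proof. by have [] := geometric_series_tail q01' (weight_norm v). Qed.

Lemma m_tail (v : string b) L :
  `|m mu p v - \sum_(0 <= k < L) word_weight mu p (mkseq v k)| <= q ^+ L / (1 - q).
Proof.
by have [_ /(_ L)] := geometric_series_tail q01' (weight_norm v); rewrite mul1r.
Qed.

Lemma m_agree K (u v : string b) : agree K u v ->
  `|m mu p u - m mu p v| <= 2 * (q ^+ K / (1 - q)).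
Proof.
move=> uv.
have E : \sum_(0 <= k < K) word_weight mu p (mkseq u k) =
    \sum_(0 <= k < K) word_weight mu p (mkseq v k).
  apply: eq_big_nat => k /andP[_ kK]; rewrite -!prefix_mkseq.
  by have /agreeP/eqP -> := agree_le (ltnW kK) uv.
have := m_tail u K; have := m_tail v K; rewrite E.
move: (\sum_(_ <= _ < _) _) => x; rewrite !ler_norml => /andP[? ?] /andP[? ?].
by apply/andP; split; lra.
Qed.

Lemma m_continuous : continuous (m mu p : string b -> R).
Proof.
have /andP[q0 q1] := q01.
apply: string_continuous => v e e0.
have q10 : 0 < 1 - q by rewrite subr_gt0.
have qe : q ^+ K @[K --> \oo] --> 0 by apply: cvg_expr; rewrite ger0_norm// ltW.
have e1 : 0 < e * (1 - q) / 2 by rewrite divr_gt0// mulr_gt0.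
have /cvgrPdist_le/(_ _ e1)[K _ /(_ K (leqnn K))/=] := qe.
rewrite sub0r normrN ger0_norm ?exprn_ge0 ?(ltW q0)// => Ke; exists K => u uv.
rewrite (le_trans (m_agree uv))// mulrA ler_pdivrMr//.
by rewrite mulrC -ler_pdivlMr.
Qed.

Lemma m_le_m_max (b0 : (0 < b)%N) v : m mu p v <= m_max mu p.
Proof.
have cr : compact (range (m mu p : string b -> R)).
  apply: continuous_compact; last exact: string_compact.
  by apply: continuous_subspaceT; exact: m_continuous.
have [_ ub] : has_sup (range (m mu p : string b -> R)).
  by apply: compact_has_sup => //; exists (m mu p v), v.
by apply: (ub_le_sup ub); exists v.
Qed.

Lemma Sigma_max_nonempty (b0 : (0 < b)%N) : Sigma_max mu p !=set0.
Proof.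
pose v0 : string b := fun=> Ordinal b0.
have [|||v _ vmax] := @compact_EVT_max _ R (m mu p : string b -> R) setT.
- by exists v0.
- exact: string_compact.
- by apply: continuous_subspaceT; exact: m_continuous.
exists v; apply/eqP; rewrite eq_le m_le_m_max//=.
apply: ge_sup; first by exists (m mu p v), v.
by move=> _ [u _ <-]; apply: vmax; rewrite inE.
Qed.

(** By compactness, the strings whose prefix of length [K] is not the prefix of
    a maximizer stay away from the maximum. *)
Lemma m_max_gap (b0 : (0 < b)%N) K : exists2 delta, 0 < delta &
  forall v, (forall u, Sigma_max mu p u -> ~ agree K u v) ->
  m mu p v <= m_max mu p - delta.
Proof.
pose A := [set v : string b | forall u, Sigma_max mu p u -> ~ agree K u v].
have cA : compact A.
  apply: (@prefix_set_compact _ K) => u v uv Au w Sw wv.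
  by apply: (Au w Sw); apply: agree_trans wv _; exact: agree_sym.
have [A0|/set0P An0] := eqVneq A set0.
  exists 1 => // v Av; have : A v by [].
  by rewrite A0.
have [|v0 v0A vmax] := @compact_EVT_max _ R (m mu p : string b -> R) A An0 cA.
  by apply: continuous_subspaceT; exact: m_continuous.
exists (m_max mu p - m mu p v0).
  rewrite subr_gt0 lt_neqAle m_le_m_max// andbT; apply/eqP => v0max.
  by have := set_mem v0A; move=> /(_ v0 v0max); apply.
by move=> v Av; rewrite opprB addrC subrK; apply: vmax; exact: mem_set.
Qed.

End Weights.

(** * Moments of a truncated binomial count *)

Section BinomialMoments.
Context {R : realType} {d : measure_display} {T : measurableType d}.
Variable P : probability T R.

Lemma exprD_le (x y : R) (s : nat) : 0 <= x -> 0 <= y ->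
  (x + y) ^+ s <= 2 ^+ s * (x ^+ s + y ^+ s).
Proof.
move=> x0 y0; wlog xy : x y x0 y0 / x <= y.
  move=> H; have [xy|/ltW yx] := leP x y; first exact: H.
  by rewrite addrC [x ^+ s + _]addrC; exact: H.
rewrite (@le_trans _ _ ((2 * y) ^+ s))//.
  by rewrite lerXn2r ?nnegrE ?addr_ge0 ?mulr_ge0//; lra.
by rewrite exprMn ler_wpM2l ?exprn_ge0// lerDr exprn_ge0.
Qed.

Lemma expr_le_fact_expR (x : R) (s : nat) : 0 <= x -> x ^+ s <= s`!%:R * expR x.
Proof.
move=> x0; case: s => [|s].
  by rewrite expr0 fact0 mul1r; have := expR_ge1Dx x; lra.
have := expR_ge1Dxn s x0 => h.
rewrite mulrC -ler_pdivrMr ?ltr0n ?fact_gt0//; apply: le_trans h.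
by rewrite lerDr.
Qed.

Lemma expR_quadratic_le (x : R) : `|x| <= 2^-1 -> expR x <= 1 + x + 2 * x ^+ 2.
Proof.
rewrite ler_norml => /andP[xl xr].
have := expR_ge1Dx (- x); rewrite expRN => h.
have x1 : 0 < 1 - x by lra.
have e0 := expR_gt0 x.
have : expR x * (1 - x) <= 1.
  by rewrite -ler_pdivlMl// mulr1.
move=> hx; rewrite -(ler_pM2r x1) (le_trans hx)//.
have x2 := sqr_ge0 x.
rewrite [leRHS](_ : _ = 1 + x ^+ 2 * (1 - 2 * x)); last by ring.
by rewrite lerDl mulr_ge0//; lra.
Qed.

Lemma expR_remainder_le (y : R) : 0 <= y -> expR y - 1 - y <= y ^+ 2 * expR y.
Proof.
move=> y0; have e0 := expR_gt0 y.
have := expR_ge1Dx (- y); rewrite expRN => h.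
have : (1 - y) * expR y <= 1 by rewrite -ler_pdivlMr// mul1r.
have := mulr_ge0 y0 (ltW e0); nra.
Qed.

(** The affine function [1 + (a - 1) * x] coincides with [a ^+ x] at 0 and at 1,
    so the difference detects the counts greater than 1. *)
Lemma expr_first_order (a : R) (x : nat) : 4 <= a -> (1 < x)%N ->
  a ^+ x <= 2 * (a ^+ x - 1 - (a - 1) * x%:R).
Proof.
move=> a4; elim: x => [//|x IHx].
rewrite ltnS leq_eqVlt => /orP[/eqP <-|x1]; first by rewrite !expr2; nra.
have {}IHx := IHx x1; rewrite exprS -(natr1 x).
have a10 : 0 <= a - 1 by lra.
have ax0 := mulr_ge0 a10 (ler0n R x).
have ax : 2 <= a ^+ x by lra.
have := ler_wpM2l a10 ax; lra.
Qed.

Definition small_mean_constant (s : nat) : R :=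
  2 ^+ s * (2 * s`!%:R * ((expR 2 - 1) ^+ 2 * expR (expR 2 - 1)) + 1).

Definition large_mean_constant (r : nat) : R :=
  2 ^+ r.*2 * ((r.*2)`!%:R * 4 ^+ r * (2 * expR 1) + 1).

Definition moment_constant (r : nat) : R :=
  large_mean_constant r + small_mean_constant r.*2.

Lemma small_mean_constant_ge0 s : 0 <= small_mean_constant s.
Proof.
by rewrite mulr_ge0 ?exprn_ge0// addr_ge0// mulr_ge0 ?mulr_ge0 ?expR_ge0 ?sqr_ge0.
Qed.

Lemma large_mean_constant_ge0 r : 0 <= large_mean_constant r.
Proof.
by rewrite mulr_ge0 ?exprn_ge0// addr_ge0// mulr_ge0 ?mulr_ge0 ?expR_ge0 ?exprn_ge0.
Qed.

Lemma moment_constant_ge0 r : 0 <= moment_constant r.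
Proof.
by apply: addr_ge0; [exact: large_mean_constant_ge0|exact: small_mean_constant_ge0].
Qed.

Section Binomial.
Variables (L : T -> nat) (n : nat) (w : R).
Hypothesis mL : measurable_fun [set: T] (fun t => (L t)%:R : R).
Hypothesis Ln : forall t, (L t <= n)%N.
Hypothesis w01 : 0 <= w <= 1.
Hypothesis mean : Ex P (fun t => (L t)%:R) = n%:R * w.
Hypothesis mgf : forall y,
  Ex P (fun t => expR (y * (L t)%:R)) = (1 + w * (expR y - 1)) ^+ n.

Let lam := n%:R * w.
Let lam0 : 0 <= lam. Proof. by have /andP[w0 _] := w01; rewrite mulr_ge0. Qed.

Let mexp (y c : R) : measurable_fun [set: T] (fun t => expR (y * (L t)%:R + c)).
Proof.
apply: (@measurableT_comp _ _ _ _ _ _ expR) => //.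
by apply: measurable_funD => //; exact: measurable_funM.
Qed.

Let bounded_L (f : R -> R) : measurable_fun [set: T] (fun t => f (L t)%:R) ->
  integrableR P (fun t => f (L t)%:R).
Proof.
move=> mf; apply: (@integrableR_bounded _ _ _ _ _ (\sum_(i < n.+1) `|f i%:R|)) => // t.
have Lt : (L t < n.+1)%N by rewrite ltnS.
by rewrite (bigD1 (Ordinal Lt))//= lerDl sumr_ge0.
Qed.

Let iexp (y c : R) : integrableR P (fun t => expR (y * (L t)%:R + c)).
Proof. exact: (bounded_L (f := fun x => expR (y * x + c))). Qed.

Let iL : integrableR P (fun t => (L t)%:R).
Proof. exact: (bounded_L (f := id)). Qed.

Lemma mgf_le (y : R) : Ex P (fun t => expR (y * (L t)%:R)) <= expR (lam * (expR y - 1)).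
Proof.
rewrite mgf /lam -mulrA expRM_natl lerXn2r ?nnegrE ?expR_ge0//; last first.
  by rewrite expR_ge1Dx.
have /andP[w0 w1] := w01; have := expR_gt0 y; nra.
Qed.

(** The exponential moments at the scale of the standard deviation. *)
Lemma centered_moment_le (r : nat) : 1 <= lam ->
  Ex P (fun t => `|(L t)%:R - lam| ^+ r.*2) <=
    (r.*2)`!%:R * 4 ^+ r * (2 * expR 1) * lam ^+ r.
Proof.
move=> lam1; have lamp : 0 < lam by exact: lt_le_trans ltr01 lam1.
pose th := (2 * Num.sqrt lam)^-1.
have sl : 0 < Num.sqrt lam by rewrite sqrtr_gt0.
have th0 : 0 < th by rewrite invr_gt0 mulr_gt0.
have sl1 : 1 <= Num.sqrt lam by rewrite -[leLHS](sqrtr1 R) ler_sqrt.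
have th2 : lam * th ^+ 2 = 4^-1.
  rewrite /th exprVn exprMn sqr_sqrtr//; field; exact: lt0r_neq0.
have thhalf : th <= 2^-1.
  by rewrite lef_pV2 ?posrE ?mulr_gt0//; lra.
have bnd y : `|y| <= 2^-1 -> lam * y ^+ 2 <= 4^-1 ->
    Ex P (fun t => expR (y * (L t)%:R + - (y * lam))) <= expR 1.
  move=> y1 y2.
  have -> : (fun t => expR (y * (L t)%:R + - (y * lam))) =
      (fun t => expR (- (y * lam)) * expR (y * (L t)%:R)).
    by apply/funext => t; rewrite expRD mulrC.
  rewrite ExZ; last by have := iexp y 0; under eq_fun do rewrite addr0.
  rewrite (le_trans (ler_wpM2l (expR_ge0 _) (mgf_le y)))// -expRD ler_expR.
  have := expR_quadratic_le y1 => h.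
  have := ler_wpM2l lam0 h; nra.
have b1 := bnd th; have b2 := bnd (- th).
rewrite normrN sqrrN (ger0_norm (ltW th0)) th2 in b2.
rewrite (ger0_norm (ltW th0)) th2 in b1.
have {}b1 := b1 thhalf (lexx _); have {}b2 := b2 thhalf (lexx _).
set c := (r.*2)`!%:R * 4 ^+ r * lam ^+ r.
have c0 : 0 <= c by rewrite !mulr_ge0 ?exprn_ge0.
have pw t : `|(L t)%:R - lam| ^+ r.*2 <=
    c * (expR (th * (L t)%:R + - (th * lam)) +
         expR (- th * (L t)%:R + - (- th * lam))).
  set z := (L t)%:R - lam.
  have -> : th * (L t)%:R + - (th * lam) = th * z by rewrite /z; ring.
  have -> : - th * (L t)%:R + - (- th * lam) = - (th * z) by rewrite /z; ring.
  have := @expr_le_fact_expR `|th * z| r.*2 (normr_ge0 _).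
  have -> : `|th * z| ^+ r.*2 = (4 * lam) ^- r * `|z| ^+ r.*2.
    rewrite normrM exprMn (ger0_norm (ltW th0)); congr (_ * _).
    rewrite -muln2 mulnC exprM -exprVn; congr (_ ^+ _).
    by rewrite /th exprVn exprMn sqr_sqrtr//; congr (_^-1); ring.
  have p4 : 0 < (4 * lam) ^+ r by rewrite exprn_gt0// mulr_gt0.
  rewrite ler_pdivrMl// => /le_trans; apply.
  rewrite /c exprMn mulrA [leLHS](_ : _ = (r.*2)`!%:R * 4 ^+ r * lam ^+ r *
    expR `|th * z|); last by ring.
  rewrite ler_wpM2l//; have [z0|z0] := leP 0 (th * z).
    by rewrite ger0_norm// lerDl expR_ge0.
  by rewrite ltr0_norm// lerDr expR_ge0.
apply: (@le_trans _ _ (Ex P (fun t => c * (expR (th * (L t)%:R + - (th * lam)) +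
         expR (- th * (L t)%:R + - (- th * lam)))))).
  apply: Ex_le => //.
  - apply: (bounded_L (f := fun x => `|x - lam| ^+ r.*2)).
    by apply: (@measurable_normX _ _ _ (fun t => (L t)%:R - lam)); exact: measurable_funB.
  - by apply: integrableRZ; apply: integrableRD; exact: iexp.
rewrite ExZ; last by apply: integrableRD; exact: iexp.
rewrite ExD; [|exact: iexp..].
rewrite [leRHS](_ : _ = c * (expR 1 + expR 1)); last by rewrite /c; ring.
by rewrite ler_wpM2l// lerD.
Qed.

Let D t : R := (L t * (1 < L t))%:R - lam.

Let fD (x : R) : R := (if 1 < x then x else 0) - lam.

Let DE t : D t = fD (L t)%:R.
Proof.
rewrite /D /fD ltr1n; case: ifP => _; first by rewrite muln1.
by rewrite muln0.
Qed.

Let mD : measurable_fun [set: T] D.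
Proof.
rewrite (_ : D = fD \o (fun t => (L t)%:R)); last by apply/funext => t; rewrite /= DE.
apply: measurableT_comp => //; apply: measurable_funB => //.
apply: measurable_fun_ifT => //.
exact: measurable_fun_ltr.
Qed.

Let iD s : integrableR P (fun t => `|D t| ^+ s).
Proof.
rewrite (_ : (fun t => _) = (fun t => `|fD (L t)%:R| ^+ s)); last first.
  by apply/funext => t; rewrite DE.
apply: (bounded_L (f := fun x => `|fD x| ^+ s)).
have := measurable_normX s mD; congr (measurable_fun _ _).
by apply/funext => t; rewrite DE.
Qed.

Lemma truncated_moment_small (s : nat) : (1 < s)%N -> lam < 1 ->
  Ex P (fun t => `|D t| ^+ s) <=
  small_mean_constant s * lam ^+ 2.
Proof.
move=> s1 lam1; rewrite /small_mean_constant; pose a : R := expR 2.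
have a4 : 4 <= a.
  have := expR_ge1Dx (1 : R) => e1.
  have -> : a = expR 1 * expR 1 by rewrite -expRD.
  have e1' : 2 <= expR 1 :> R by apply: le_trans e1; lra.
  have := expR_ge0 (1 : R); nra.
have apow t : a ^+ L t = expR (2 * (L t)%:R) by rewrite expRM_natr.
have pw t : `|D t| ^+ s <= 2 ^+ s * (2 * s`!%:R * (expR (2 * (L t)%:R) - 1 -
    (a - 1) * (L t)%:R) + lam ^+ s).
  rewrite -apow; have [L1|L1] := ltnP 1 (L t).
    rewrite /D L1 muln1 (le_trans (lerXn2r _ _ _ (ler_normB _ _))) ?nnegrE ?addr_ge0//.
    rewrite (ger0_norm (ler0n _ _)) (ger0_norm lam0).
    rewrite (le_trans (exprD_le _ _ _))// ler_wpM2l ?exprn_ge0// lerD2r.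
    rewrite (le_trans (expr_le_fact_expR _ _))// -mulrA mulrCA ler_wpM2l//.
    apply: le_trans (expr_first_order a4 L1).
    rewrite apow ler_expR; have : 0 <= (L t)%:R :> R by []. 
    lra.
  rewrite /D ltnNge L1 /= muln0 sub0r normrN (ger0_norm lam0).
  have -> : a ^+ L t - 1 - (a - 1) * (L t)%:R = 0.
    by move: L1; case: (L t) => [|[|//]] _; rewrite ?expr0 ?expr1; ring.
  by rewrite mulr0 add0r ler_peMl ?exprn_ge0// exprn_ege1// ler1n.
have i2 : integrableR P (fun t => expR (2 * (L t)%:R)).
  by have := iexp 2 0; under eq_fun do rewrite addr0.
have i3 : integrableR P (fun t => expR (2 * (L t)%:R) - 1 - (a - 1) * (L t)%:R).
  apply: integrableRB; last exact: integrableRZ.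
  by apply: integrableRB => //; exact: integrableR_cst.
apply: (@le_trans _ _ (Ex P (fun t => 2 ^+ s * (2 * s`!%:R *
    (expR (2 * (L t)%:R) - 1 - (a - 1) * (L t)%:R) + lam ^+ s)))).
  apply: Ex_le => //; apply: integrableRZ; apply: integrableRD.
    exact: integrableRZ.
  exact: integrableR_cst.
rewrite ExZ; last first.
  by apply: integrableRD; [exact: integrableRZ|exact: integrableR_cst].
rewrite -mulrA ler_wpM2l ?exprn_ge0//.
rewrite ExD; [|exact: integrableRZ|exact: integrableR_cst].
rewrite Ex_cst [leRHS]mulrDl mul1r lerD//; last first.
  by rewrite ler_wiXn2l// ltW.
rewrite ExZ// -[leRHS]mulrA ler_wpM2l//.
rewrite ExB; [|by apply: integrableRB => //; exact: integrableR_cst|exact: integrableRZ].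
rewrite ExB; [|by []|exact: integrableR_cst].
rewrite Ex_cst ExZ// mean -/lam.
have := mgf_le 2; rewrite -/a => h.
set y := lam * (a - 1) in h *.
have y0 : 0 <= y by rewrite mulr_ge0//; lra.
have := expR_remainder_le y0 => h2.
apply: (@le_trans _ _ (y ^+ 2 * expR y)).
  by apply: le_trans h2; rewrite /y; lra.
rewrite -/a /y exprMn -[leLHS]mulrA [leRHS]mulrC.
rewrite ler_wpM2l ?sqr_ge0// ler_wpM2l ?sqr_ge0//.
rewrite ler_expR ler_piMl ?(ltW lam1)//; lra.
Qed.

Lemma truncated_moment_large (r : nat) : 1 <= lam ->
  Ex P (fun t => `|D t| ^+ r.*2) <=
  large_mean_constant r * lam ^+ r.
Proof.
move=> lam1; rewrite /large_mean_constant.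
have pw t : `|D t| ^+ r.*2 <= 2 ^+ r.*2 * (`|(L t)%:R - lam| ^+ r.*2 + 1).
  have : `|D t| <= `|(L t)%:R - lam| + 1.
    rewrite /D; have [L1|L1] := ltnP 1 (L t); first by rewrite muln1 lerDl.
    rewrite muln0 (_ : 0%:R - lam = ((L t)%:R - lam) - (L t)%:R); last by ring.
    rewrite (le_trans (ler_normB _ _))// lerD2l ger0_norm//.
    by rewrite (_ : 1 = 1%:R)// ler_nat.
  move=> h; rewrite (le_trans (lerXn2r _ _ _ h)) ?nnegrE ?addr_ge0//.
  by rewrite (le_trans (exprD_le _ _ _))// expr1n.
have i1 : integrableR P (fun t => `|(L t)%:R - lam| ^+ r.*2).
  apply: (bounded_L (f := fun x => `|x - lam| ^+ r.*2)).
  by apply: (@measurable_normX _ _ _ (fun t => (L t)%:R - lam)); exact: measurable_funB.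
apply: (@le_trans _ _ (Ex P (fun t => 2 ^+ r.*2 * (`|(L t)%:R - lam| ^+ r.*2 + 1)))).
  apply: Ex_le => //; apply: integrableRZ; apply: integrableRD => //.
  exact: integrableR_cst.
rewrite ExZ; last by apply: integrableRD => //; exact: integrableR_cst.
rewrite -mulrA ler_wpM2l ?exprn_ge0// ExD//; last exact: integrableR_cst.
rewrite Ex_cst [leRHS]mulrDl mul1r lerD ?centered_moment_le//.
by rewrite exprn_ege1.
Qed.

(** The exponent 2 of [w] is what makes the sum over all words of a given length
    decay geometrically, uniformly in [n]. *)
Lemma truncated_moment_le (r : nat) : (1 < r)%N ->
  Ex P (fun t => `|(L t * (1 < L t))%:R - n%:R * w| ^+ r.*2) <=
  moment_constant r * (n%:R ^+ r * w ^+ 2).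
Proof.
move=> r1; have /andP[w0 w1] := w01.
have w2 : 0 <= n%:R ^+ r * w ^+ 2 by rewrite mulr_ge0 ?exprn_ge0.
have c1 := large_mean_constant_ge0 r; have c2 := small_mean_constant_ge0 r.*2.
rewrite /moment_constant; have [lam1|lam1] := leP 1 lam.
  apply: (le_trans (truncated_moment_large r lam1)).
  apply: (@le_trans _ _ (large_mean_constant r * (n%:R ^+ r * w ^+ 2))).
    rewrite ler_wpM2l// /lam exprMn ler_wpM2l ?exprn_ge0//.
    by rewrite ler_wiXn2l.
  by rewrite ler_wpM2r// lerDl.
have r2 : (1 < r.*2)%N by rewrite -addnn ltn_addr.
apply: (le_trans (truncated_moment_small r2 lam1)).
apply: (@le_trans _ _ (small_mean_constant r.*2 * (n%:R ^+ r * w ^+ 2))).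
  rewrite ler_wpM2l// /lam exprMn ler_wpM2r ?sqr_ge0//; case: (n) => [|n'].
    by rewrite !expr0n/= (gtn_eqF (ltnW r1)).
  by rewrite ler_weXn2l ?ler1n.
by rewrite ler_wpM2r// lerDr.
Qed.

End Binomial.
End BinomialMoments.

(** * The joint law of the prefixes of the sample *)

Section MarkovSource.
Context {R : realType} {b : nat}.
Hypothesis b0 : (0 < b)%N.
Variables (mu : 'I_b -> R) (p : 'M[R]_b).
Context {d : measure_display} {T : measurableType d} (P : probability T R).
Variable S : nat -> T -> string b.
Hypothesis hS : forall i, markov_chain P mu p (S i).
Hypothesis hSind : independent_strings P S.

Definition word_string (w : seq 'I_b) : string b := nth (Ordinal b0) w.

Lemma prefix_word_string k (w : k.-tuple 'I_b) : prefix k (word_string w) = w.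
Proof.
by apply: eq_from_tnth => i; rewrite tnth_mktuple /word_string -tnth_nth.
Qed.

Lemma string_measurable_prefix k (w : k.-tuple 'I_b) :
  string_measurable [set v | prefix k v = w].
Proof.
apply: sub_gen_smallest; exists k, (word_string w).
apply/seteqP; split=> v /=.
  by rewrite -{1}(prefix_word_string w) => /eqP/agreeP.
by move=> /agreeP/eqP; rewrite prefix_word_string.
Qed.

Lemma measurable_prefix i k (w : k.-tuple 'I_b) :
  measurable [set t | prefix k (S i t) = w].
Proof. exact: (markov_measurable (hS i) (string_measurable_prefix w)). Qed.

Lemma markov_agree_law i k (u : string b) :
  P [set t | agree k (S i t) u] = (word_weight mu p (mkseq u k))%:E.
Proof.
case: k => [|n].
  rewrite (_ : [set t | _] = setT) ?probability_setT//.
  by apply/seteqP; split.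
elim: n => [|n IHn].
  rewrite /= mulr1 -(markov_init (hS i)); congr (P _).
  apply/seteqP; split=> t /= h; first exact: h.
  by move=> j; rewrite ltnS leqn0 => /eqP ->.
rewrite (markov_step (hS i)) IHn -EFinM; congr EFin.
have mkseq_rcons j : mkseq u j.+1 = rcons (mkseq u j) (u j).
  by rewrite /mkseq -addn1 iotaD map_cat /= cats1 add0n.
by rewrite (mkseq_rcons n.+1) (mkseq_rcons n) word_weight_rcons.
Qed.

Lemma markov_prefix_law i k (w : k.-tuple 'I_b) :
  P [set t | prefix k (S i t) = w] = (word_weight mu p w)%:E.
Proof.
rewrite -[in RHS](prefix_word_string w) prefix_mkseq -(markov_agree_law i).
congr (P _); apply/seteqP; split=> t /=.
  by rewrite -{1}(prefix_word_string w) => /eqP/agreeP.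
by move=> /agreeP/eqP; rewrite prefix_word_string.
Qed.

Definition sample (n k : nat) (t : T) : {ffun 'I_n -> k.-tuple 'I_b} :=
  [ffun i => prefix k (S (nat_of_ord i) t)].

Lemma sample_event n k (x : {ffun 'I_n -> k.-tuple 'I_b}) :
  measurable [set t | sample n k t = x] /\
  P [set t | sample n k t = x] = (\prod_i word_weight mu p (x i))%:E.
Proof.
pose A (j : nat) : set (string b) :=
  if insub j is Some i then [set v | prefix k v = x i] else setT.
pose J : {fset nat} := [fset j in iota 0 n]%fset.
have JP j : (j \in J) = (j < n)%N by rewrite !inE /= mem_iota.
have mA j : j \in J -> string_measurable (A j).
  rewrite JP => jn; rewrite /A insubT; exact: string_measurable_prefix.
have E : [set t | sample n k t = x] = \bigcap_(j in [set` J]) (S j @^-1` A j).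
  apply/seteqP; split=> [t /= tx j /=|t h].
    rewrite JP => jn; rewrite /A insubT /=.
    by rewrite -tx ffunE.
  apply/ffunP => i; rewrite ffunE.
  have := h (nat_of_ord i); rewrite /= JP => /(_ (ltn_ord i)).
  rewrite /A (insubT (fun j => (j < n)%N) (ltn_ord i)) /= => ->; congr (x _).
  exact: val_inj.
rewrite E; split.
  apply: fin_bigcap_measurable; first exact: finite_fset.
  move=> j /= jJ; exact: (markov_measurable (hS j) (mA j jJ)).
rewrite hSind// (perm_big (iota 0 n)); last first.
  apply: uniq_perm; [exact: fset_uniq|exact: iota_uniq|].
  by move=> j; rewrite JP mem_iota.
rewrite -{1}(subn0 n) -/(index_iota 0 n) big_mkord.
rewrite (big_morph EFin (id1 := 1%E) (op1 := *%E) EFinM erefl).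
apply: eq_bigr => i _; rewrite -(markov_prefix_law i); congr (P _).
rewrite /A (insubT (fun j => (j < n)%N) (ltn_ord i)) /=.
apply: eq_set => t; congr (_ = x _); exact: val_inj.
Qed.

Let sample_sum n k (Phi : {ffun 'I_n -> k.-tuple 'I_b} -> R) :
  (fun t => Phi (sample n k t)) =
  (fun t => \sum_x Phi x * \1_[set t | sample n k t = x] t).
Proof.
apply/funext => t; rewrite (bigD1 (sample n k t))//= indicE mem_set// mulr1.
rewrite big1 ?addr0// => x /eqP xt; rewrite indicE memNset ?mulr0// => /= E.
by apply: xt.
Qed.

Lemma sample_law n k (Phi : {ffun 'I_n -> k.-tuple 'I_b} -> R) :
  integrableR P (fun t => Phi (sample n k t)) /\
  Ex P (fun t => Phi (sample n k t)) = \sum_x Phi x * \prod_i word_weight mu p (x i).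
Proof.
have i1 (x : {ffun 'I_n -> k.-tuple 'I_b}) :
    integrableR P (\1_[set t | sample n k t = x]).
  by apply: integrable_indic => //; exact: (sample_event x).1.
rewrite sample_sum; split.
  by apply: integrableR_sum => x _; exact: integrableRZ.
rewrite Ex_sum => [|x _]; last exact: integrableRZ.
apply: eq_bigr => x _; rewrite ExZ//; congr (_ * _).
have [mx Px] := sample_event x.
rewrite /Ex /Rintegral integral_indic// setIT [X in fine X](_ : _ =
  (\prod_i word_weight mu p (x i))%:E)//; exact: Px.
Qed.

Lemma sum_word_weight k : \sum_(w : k.-tuple 'I_b) word_weight mu p w = 1.
Proof.
have [_] := @sample_law 1 k (fun=> 1); rewrite Ex_cst => h; rewrite [RHS]h.
under [RHS]eq_bigr do rewrite mul1r.
rewrite -(bigA_distr_bigA (fun (i : 'I_1) (w : k.-tuple 'I_b) => word_weight mu p w)).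
by rewrite big_ord1.
Qed.

(** The sum that expresses the mean is expanded from a product of sums. *)
Lemma sample_prod n k (f : k.-tuple 'I_b -> R) :
  Ex P (fun t => \prod_(i < n) f (prefix k (S i t))) =
  (\sum_w f w * word_weight mu p w) ^+ n.
Proof.
rewrite (_ : (fun t => _) = fun t =>
    (fun x : {ffun 'I_n -> k.-tuple 'I_b} => \prod_i f (x i)) (sample n k t)); last first.
  by apply/funext => t /=; apply: eq_bigr => i _; rewrite ffunE.
rewrite (sample_law (fun x : {ffun 'I_n -> k.-tuple 'I_b} => \prod_i f (x i))).2.
under eq_bigr do rewrite -big_split.
rewrite -(bigA_distr_bigA (fun (i : 'I_n) w => f w * word_weight mu p w)).
by rewrite prodr_const card_ord.
Qed.

Definition count_prefix (k : nat) (w : k.-tuple 'I_b) (n : nat) (t : T) : nat :=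
  (\sum_(i < n) (prefix k (S i t) == w))%N.

Lemma count_prefix_le k (w : k.-tuple 'I_b) n t : (count_prefix w n t <= n)%N.
Proof.
rewrite -[leqRHS]card_ord -sum1_card; apply: leq_sum => i _.
by case: (_ == _).
Qed.

Lemma measurable_count_fun k (w : k.-tuple 'I_b) n (f : nat -> R) :
  measurable_fun [set: T] (fun t => f (count_prefix w n t)).
Proof.
rewrite (_ : (fun t => _) = (fun t =>
  (fun x : {ffun 'I_n -> k.-tuple 'I_b} => f (\sum_i (x i == w))%N) (sample n k t))).
  exact: (integrableR_measurable (sample_law
    (fun x : {ffun 'I_n -> k.-tuple 'I_b} => f (\sum_i (x i == w))%N)).1).
by apply/funext => t; congr f; apply: eq_bigr => i _; rewrite ffunE.
Qed.

Lemma mgf_count_prefix k (w : k.-tuple 'I_b) n y :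
  Ex P (fun t => expR (y * (count_prefix w n t)%:R)) =
  (1 + word_weight mu p w * (expR y - 1)) ^+ n.
Proof.
pose f (v : k.-tuple 'I_b) : R := if v == w then expR y else 1.
rewrite (_ : (fun t => _) = fun t => \prod_(i < n) f (prefix k (S i t))).
  rewrite (sample_prod n f) /f; congr (_ ^+ _).
  rewrite (eq_bigr (fun v : k.-tuple 'I_b => word_weight mu p v +
      (v == w)%:R * (word_weight mu p v * (expR y - 1)))).
    rewrite big_split/= sum_word_weight; congr (_ + _).
    rewrite (bigD1 w)//= eqxx mul1r big1 ?addr0// => v /negbTE ->.
    by rewrite mul0r.
  by move=> v _; case: eqP => _ /=; ring.
apply/funext => t; rewrite /count_prefix natr_sum mulr_sumr expR_sum.
by apply: eq_bigr => i _; rewrite /f; case: eqP => _; rewrite ?mulr1 ?mulr0 ?expR0.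
Qed.

Lemma integrableR_prefix i k (w : k.-tuple 'I_b) :
  integrableR P (fun t => (prefix k (S i t) == w)%:R) /\
  Ex P (fun t => (prefix k (S i t) == w)%:R) = word_weight mu p w.
Proof.
have mi := measurable_prefix i w.
rewrite (_ : (fun t => _) = \1_[set t | prefix k (S i t) = w]); last first.
  apply/funext => t; rewrite indicE; congr (_%:R); case: eqP => h.
    by rewrite mem_set.
  by rewrite memNset.
split; first exact: integrable_indic.
rewrite /Ex /Rintegral integral_indic// setIT [X in fine X](_ : _ =
  (word_weight mu p w)%:E)//; exact: markov_prefix_law.
Qed.

Lemma mean_count_prefix k (w : k.-tuple 'I_b) n :
  Ex P (fun t => (count_prefix w n t)%:R) = n%:R * word_weight mu p w.
Proof.
rewrite (_ : (fun t => _) =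
    fun t => \sum_(i < n) (prefix k (S i t) == w)%:R); last first.
  by apply/funext => t; rewrite natr_sum.
rewrite Ex_sum => [|i _]; last exact: (integrableR_prefix i w).1.
under eq_bigr do rewrite (integrableR_prefix _ w).2.
by rewrite sumr_const card_ord mulr_natl.
Qed.

End MarkovSource.

(** * Central limit theorem for bounded functions of a prefix *)

Section TaylorBounds.
Context {R : realType}.
Implicit Types x y : R.

Let MVT0 (f df : R -> R) x : (forall y, is_derive y 1 f (df y)) ->
  exists2 c, `|c| <= `|x| & f x - f 0 = df c * x.
Proof.
move=> fd; have cf A : {within A, continuous f}.
  apply: continuous_subspaceT => y.
  by apply: differentiable_continuous; apply/derivable1_diffP; have [] := fd y.
have [x0|x0] := leP 0 x.
  have [c] := MVT_segment x0 (fun y _ => fd y) (cf _).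
  rewrite in_itv/= subr0 => /andP[c0 cx] ->; exists c => //.
  by rewrite !ger0_norm.
have [c] := MVT_segment (ltW x0) (fun y _ => fd y) (cf _).
rewrite in_itv/= sub0r => /andP[c0 cx] E; exists c.
  by rewrite !ler0_norm ?(ltW x0)// lerN2.
by rewrite -opprB E mulrN opprK.
Qed.

Lemma sin_le_norm x : `|sin x| <= `|x|.
Proof.
have [c _] := @MVT0 sin cos x (@is_derive_sin R).
by rewrite sin0 subr0 => ->; rewrite normrM ler_piMl// cos_max.
Qed.

Lemma sin_taylor x : `|sin x - x| <= `|x| ^+ 3.
Proof.
have dsx y : is_derive y 1 (fun y : R => sin y - y) (cos y - 1).
  exact: is_deriveB.
have [c cx] := @MVT0 _ _ x dsx.
rewrite sin0 !subr0 => ->; rewrite normrM exprSr ler_wpM2r//.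
have -> : cos c - 1 = - (2 * sin (c / 2) ^+ 2).
  by rewrite sin2cos2 {1}(splitr c) cosD -!expr2 sin2cos2; ring.
rewrite normrN normrM ger0_norm// normrX.
have := sin_le_norm (c / 2); rewrite normrM normfV normr_nat => h.
have : `|sin (c / 2)| ^+ 2 <= (`|x| / 2) ^+ 2.
  rewrite lerXn2r ?nnegrE ?divr_ge0// (le_trans h)// ler_wpM2r//.
rewrite exprMn exprVn; have := sqr_ge0 `|x|; lra.
Qed.

Lemma cos_taylor x : `|cos x - (1 - x ^+ 2 / 2)| <= x ^+ 4.
Proof.
have -> : cos x - (1 - x ^+ 2 / 2) = 2 * ((x / 2 - sin (x / 2)) * (x / 2 + sin (x / 2))).
  by rewrite {1}(splitr x) cosD -!expr2 cos2sin2; field.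
rewrite !normrM ger0_norm// distrC.
have h1 := sin_taylor (x / 2); have h2 := sin_le_norm (x / 2).
have h3 := ler_normD (x / 2) (sin (x / 2)).
have x2 : `|x / 2| = `|x| / 2 by rewrite normrM normfV normr_nat.
have x4 : x ^+ 4 = `|x| ^+ 4 by rewrite -normrX ger0_norm// exprn_even_ge0.
rewrite x2 in h1 h2 h3; rewrite x4.
have h4 : `|x / 2 + sin (x / 2)| <= `|x| by lra.
apply: (@le_trans _ _ (2 * ((`|x| / 2) ^+ 3 * `|x|))).
  by rewrite ler_wpM2l// ler_pM.
rewrite exprMn exprVn [leLHS](_ : _ = `|x| ^+ 4 / 4).
  by rewrite ler_pdivrMr// ler_peMr// ?exprn_ge0// ler1n.
by field.
Qed.

Lemma expRN_taylor y : 0 <= y -> `|expR (- y) - (1 - y)| <= y ^+ 2.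
Proof.
move=> y0; have h1 := expR_ge1Dx (- y); have h2 := expR_ge1Dx y.
have e0 := expR_gt0 (- y).
have h3 : expR (- y) * (1 + y) <= 1.
  by rewrite expRN ler_pdivrMl ?expR_gt0// mulr1.
rewrite ger0_norm; last lra.
nra.
Qed.

Lemma expr_dist_le x y n : `|x| <= 1 -> `|y| <= 1 ->
  `|x ^+ n - y ^+ n| <= n%:R * `|x - y|.
Proof.
move=> x1 y1; elim: n => [|n IHn]; first by rewrite !expr0 subrr normr0 mul0r.
rewrite !exprS (_ : _ - _ = x * (x ^+ n - y ^+ n) + (x - y) * y ^+ n); last by ring.
rewrite (le_trans (ler_normD _ _))// -natr1 [leRHS]mulrDl mul1r lerD//.
  by rewrite normrM (le_trans _ IHn)// ler_piMl.
by rewrite normrM normrX ler_piMr// exprn_ile1.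
Qed.

Lemma cvg_invsqrt : (Num.sqrt n%:R)^-1 @[n --> \oo] --> (0 : R).
Proof.
apply/cvgrPdist_le => e e0; near=> n.
have n0 : (0 < n)%N by near: n; exists 1%N.
have s0 : 0 < Num.sqrt n%:R :> R by rewrite sqrtr_gt0 ltr0n.
rewrite sub0r normrN normfV ger0_norm// -[leRHS]invrK lef_pV2 ?posrE ?invr_gt0//.
rewrite -(ler_pXn2r (_ : 0 < 2)%N) ?nnegrE ?invr_ge0 ?(ltW e0)//.
rewrite sqr_sqrtr//; near: n; exact: nbhs_infty_ger.
Unshelve. all: by end_near. Qed.

End TaylorBounds.

Local Notation Re := complex.Re.
Local Notation Im := complex.Im.

Section ComplexExponential.
Context {R : realType}.
Local Open Scope complex_scope.

Definition cis (x : R) : R[i] := cos x +i* sin x.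

Lemma cisD x y : cis (x + y) = cis x * cis y.
Proof. by rewrite /cis cosD sinD; apply/eqP; rewrite eq_complex /= eqxx/= addrC. Qed.

Lemma cis_sum (I : Type) (s : seq I) (F : I -> R) :
  cis (\sum_(i <- s) F i) = \prod_(i <- s) cis (F i).
Proof.
elim: s => [|i s IHs]; last by rewrite !big_cons cisD IHs.
by rewrite !big_nil /cis cos0 sin0.
Qed.

Lemma Re_sum (I : Type) (s : seq I) (F : I -> R[i]) :
  Re (\sum_(i <- s) F i) = \sum_(i <- s) Re (F i).
Proof.
elim: s => [|i s IHs]; first by rewrite !big_nil.
by rewrite !big_cons -IHs; case: (F i) => ? ?; case: (\sum_(_ <- _) _).
Qed.

Lemma Im_sum (I : Type) (s : seq I) (F : I -> R[i]) :
  Im (\sum_(i <- s) F i) = \sum_(i <- s) Im (F i).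
Proof.
elim: s => [|i s IHs]; first by rewrite !big_nil.
by rewrite !big_cons -IHs; case: (F i) => ? ?; case: (\sum_(_ <- _) _).
Qed.

Lemma ReZ (a : R) (z : R[i]) : Re (a%:C * z) = a * Re z.
Proof. by case: z => x y /=; rewrite mul0r subr0. Qed.

Lemma ImZ (a : R) (z : R[i]) : Im (a%:C * z) = a * Im z.
Proof. by case: z => x y /=; rewrite mul0r addr0. Qed.

(** Each multiplication by [z] adds at most [|Im z|] to either error. *)
Lemma nearly_real_power (z : R[i]) n : `|Re z| <= 1 ->
  (forall j, `|Re (z ^+ j)| <= 1) -> (forall j, `|Im (z ^+ j)| <= 1) ->
  `|Re (z ^+ n) - Re z ^+ n| <= n%:R * `|Im z| /\
  `|Im (z ^+ n)| <= n%:R * `|Im z|.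
Proof.
move=> z1 rj ij; elim: n => [|n [IHr IHi]].
  by rewrite !expr0 /= subrr !normr0 mul0r.
have ImM : Im (z * z ^+ n) = Re z * Im (z ^+ n) + Im z * Re (z ^+ n).
  by case: (z) => ? ?; case: (_ ^+ n).
have ReM : Re (z * z ^+ n) = Re z * Re (z ^+ n) - Im z * Im (z ^+ n).
  by case: (z) => ? ?; case: (_ ^+ n).
rewrite !exprS ImM ReM -natr1 mulrDl mul1r; split.
  rewrite (_ : _ - _ = Re z * (Re (z ^+ n) - Re z ^+ n) + - (Im z * Im (z ^+ n)));
    last by ring.
  rewrite (le_trans (ler_normD _ _))// normrN lerD//.
    by rewrite normrM (le_trans _ IHr)// ler_piMl.
  by rewrite normrM ler_piMr.
rewrite (le_trans (ler_normD _ _))// lerD//.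
  by rewrite normrM (le_trans _ IHi)// ler_piMl.
by rewrite normrM ler_piMr.
Qed.

End ComplexExponential.

Section PrefixClt.
Context {R : realType} {b : nat}.
Hypothesis b0 : (0 < b)%N.
Variables (mu : 'I_b -> R) (p : 'M[R]_b).
Context {d : measure_display} {T : measurableType d} (P : probability T R).
Variable S : nat -> T -> string b.
Hypothesis hS : forall i, markov_chain P mu p (S i).
Hypothesis hSind : independent_strings P S.
Variables (L : nat) (g : string b -> R).
Hypothesis g_agree : forall u v, agree L u v -> g u = g v.

Local Notation word w := (word_string b0 (tval w)).
Local Notation wt w := (word_weight mu p (tval w)).

Let g_prefix u : g (word (prefix L u)) = g u.
Proof. by apply: g_agree; apply/agreeP; rewrite prefix_word_string. Qed.

Lemma prefix_fun_law (h : R -> R) :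
  integrableR P (fun t => h (g (S 0 t))) /\
  Ex P (fun t => h (g (S 0 t))) = \sum_(w : L.-tuple 'I_b) h (g (word w)) * wt w.
Proof.
have [i1 E1] := sample_law b0 hS hSind
  (fun x : {ffun 'I_1 -> L.-tuple 'I_b} => h (g (word (x ord0)))).
have fE : (fun t => h (g (word (sample S 1 L t ord0)))) = fun t => h (g (S 0 t)).
  by apply/funext => t; rewrite ffunE g_prefix.
rewrite fE in i1 E1; split=> //; rewrite E1.
rewrite (reindex (fun w : L.-tuple 'I_b => [ffun _ : 'I_1 => w])).
  by apply: eq_bigr => w _; rewrite big_ord1 !ffunE.
exists (fun x : {ffun 'I_1 -> L.-tuple 'I_b} => x ord0) => [w|x] _.
  by rewrite ffunE.
by apply/ffunP => i; rewrite ffunE (ord1 i).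
Qed.

Lemma prefix_sum_law n (h : R -> R) :
  integrableR P (fun t => h (\sum_(i < n) g (S i t))) /\
  Ex P (fun t => h (\sum_(i < n) g (S i t))) =
  \sum_(x : {ffun 'I_n -> L.-tuple 'I_b})
    h (\sum_i g (word (x i))) * \prod_i wt (x i).
Proof.
have [i1 E1] := sample_law b0 hS hSind
  (fun x : {ffun 'I_n -> L.-tuple 'I_b} => h (\sum_i g (word (x i)))).
have fE : (fun t => h (\sum_i g (word (sample S n L t i)))) =
    fun t => h (\sum_(i < n) g (S i t)).
  apply/funext => t; congr h; apply: eq_bigr => i _.
  by rewrite ffunE g_prefix.
by rewrite fE in i1 E1.
Qed.

(** The characteristic function of [g (S 0)]. *)
Let phi (th : R) : R[i] :=
  \sum_(w : L.-tuple 'I_b) (real_complex R (wt w)) * cis (th * g (word w)).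

Let phi_power th n :
  phi th ^+ n = \sum_(x : {ffun 'I_n -> L.-tuple 'I_b})
    (real_complex R (\prod_i wt (x i))) * cis (th * \sum_i g (word (x i))).
Proof.
rewrite -[in LHS](card_ord n) -prodr_const bigA_distr_bigA/=.
apply: eq_bigr => x _; rewrite big_split/= mulr_sumr cis_sum; congr (_ * _).
by rewrite rmorph_prod.
Qed.

Let Re_phi th n : Re (phi th ^+ n) = Ex P (fun t => cos (th * \sum_(i < n) g (S i t))).
Proof.
rewrite (prefix_sum_law n (fun x => cos (th * x))).2 phi_power Re_sum.
by apply: eq_bigr => x _; rewrite ReZ mulrC.
Qed.

Let Im_phi th n : Im (phi th ^+ n) = Ex P (fun t => sin (th * \sum_(i < n) g (S i t))).
Proof.
rewrite (prefix_sum_law n (fun x => sin (th * x))).2 phi_power Im_sum.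
by apply: eq_bigr => x _; rewrite ImZ mulrC.
Qed.

Hypothesis g_centered : Ex P (fun t => g (S 0 t)) = 0.
Let sigma2 := Ex P (fun t => g (S 0 t) ^+ 2).
Let M := \sum_(w : L.-tuple 'I_b) `|g (word w)|.

Let gM u : `|g u| <= M.
Proof.
rewrite -g_prefix /M (bigD1 (prefix L u))//= lerDl; exact: sumr_ge0.
Qed.

Let M0 : 0 <= M. Proof. exact: sumr_ge0. Qed.

Let ig (h : R -> R) : integrableR P (fun t => h (g (S 0 t))).
Proof. exact: (prefix_fun_law h).1. Qed.

Let sigma2_ge0 : 0 <= sigma2. Proof. by apply: Ex_ge0 => t; exact: sqr_ge0. Qed.

Let sigma2_le : sigma2 <= M ^+ 2.
Proof.
rewrite -[leRHS](Ex_cst P); apply: Ex_le => [||t].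
- exact: (ig (fun x => x ^+ 2)).
- exact: integrableR_cst.
- by rewrite -(real_normK (num_real (g _))) lerXn2r ?nnegrE.
Qed.

Let Re_phi1 th : Re (phi th) = Ex P (fun t => cos (th * g (S 0 t))).
Proof.
by rewrite -[phi th]expr1 Re_phi; congr Rintegral; apply/funext => t; rewrite big_ord1.
Qed.

Let Im_phi1 th : Im (phi th) = Ex P (fun t => sin (th * g (S 0 t))).
Proof.
by rewrite -[phi th]expr1 Im_phi; congr Rintegral; apply/funext => t; rewrite big_ord1.
Qed.

Let Im_phi_le th : `|Im (phi th)| <= `|th| ^+ 3 * M ^+ 3.
Proof.
rewrite Im_phi1.
have := @Ex_dist _ _ _ P (fun t => sin (th * g (S 0 t))) (fun t => th * g (S 0 t))
  (fun=> `|th| ^+ 3 * M ^+ 3).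
rewrite ExZ; last exact: (ig id).
rewrite g_centered mulr0 subr0 Ex_cst; apply.
- exact: (ig (fun x => sin (th * x))).
- exact: (ig (fun x => th * x)).
- exact: integrableR_cst.
move=> t; rewrite (le_trans (sin_taylor _))// normrM exprMn.
by rewrite ler_wpM2l ?exprn_ge0// lerXn2r ?nnegrE.
Qed.

Let Re_phi_le th : `|Re (phi th) - expR (- (th ^+ 2 * sigma2 / 2))| <=
  2 * th ^+ 4 * M ^+ 4.
Proof.
have th4 : 0 <= th ^+ 4 by rewrite exprn_even_ge0.
have M4 : 0 <= M ^+ 4 by rewrite exprn_ge0.
have h1 : `|Re (phi th) - (1 - th ^+ 2 * sigma2 / 2)| <= th ^+ 4 * M ^+ 4.
  rewrite Re_phi1 (mulrAC (th ^+ 2)).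
  have := @Ex_dist _ _ _ P (fun t => cos (th * g (S 0 t)))
    (fun t => 1 - th ^+ 2 / 2 * g (S 0 t) ^+ 2) (fun=> th ^+ 4 * M ^+ 4).
  rewrite ExB; [|exact: integrableR_cst|exact: (ig (fun x => th ^+ 2 / 2 * x ^+ 2))].
  rewrite ExZ; last exact: (ig (fun x => x ^+ 2)).
  rewrite !Ex_cst -/sigma2; apply.
  - exact: (ig (fun x => cos (th * x))).
  - exact: (ig (fun x => 1 - th ^+ 2 / 2 * x ^+ 2)).
  - exact: integrableR_cst.
  move=> t; rewrite (_ : th ^+ 2 / 2 * _ = (th * g (S 0 t)) ^+ 2 / 2); last first.
    by rewrite exprMn mulrAC.
  rewrite (le_trans (cos_taylor _))// exprMn ler_wpM2l//.
  rewrite -[X in X <= _]ger0_norm ?exprn_even_ge0// normrX.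
  by rewrite lerXn2r ?nnegrE.
have y0 : 0 <= th ^+ 2 * sigma2 / 2 by rewrite divr_ge0// mulr_ge0// sqr_ge0.
have h2 := expRN_taylor y0.
have h3 : (th ^+ 2 * sigma2 / 2) ^+ 2 <= th ^+ 4 * M ^+ 4.
  rewrite [leLHS](_ : _ = th ^+ 4 * (sigma2 ^+ 2 / 4)); last by field.
  rewrite ler_wpM2l// ler_pdivrMr//.
  have : sigma2 ^+ 2 <= (M ^+ 2) ^+ 2 by rewrite lerXn2r ?nnegrE ?sqr_ge0.
  rewrite -exprM => /le_trans; apply.
  by rewrite ler_peMr// ler1n.
move: h1 h2; rewrite !ler_norml => /andP[? ?] /andP[? ?].
by apply/andP; split; lra.
Qed.

Let cos1 th n : `|Re (phi th ^+ n)| <= 1.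
Proof.
rewrite Re_phi; apply: Ex_bound; last by move=> t; exact: cos_max.
exact: (prefix_sum_law n (fun x => cos (th * x))).1.
Qed.

Let sin1 th n : `|Im (phi th ^+ n)| <= 1.
Proof.
rewrite Im_phi; apply: Ex_bound; last by move=> t; exact: sin_max.
exact: (prefix_sum_law n (fun x => sin (th * x))).1.
Qed.

Let th n : R := (Num.sqrt n.+1%:R)^-1.

Let th_ge0 n : 0 <= th n. Proof. by rewrite invr_ge0. Qed.

Let th_sqr n : n.+1%:R * th n ^+ 2 = 1.
Proof. by rewrite exprVn sqr_sqrtr// divff// pnatr_eq0. Qed.

Let th_cvg : th n @[n --> \oo] --> 0.
Proof. by have := @cvg_invsqrt R; rewrite -cvg_shiftS. Qed.

Let th3M_cvg : th n * M ^+ 3 @[n --> \oo] --> 0.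
Proof.
by rewrite -[X in _ --> X](mul0r (M ^+ 3)); apply: cvgM th_cvg _; exact: cvg_cst.
Qed.

Let Im_phi_th n : n.+1%:R * `|Im (phi (th n))| <= th n * M ^+ 3.
Proof.
rewrite (le_trans (ler_wpM2l (ler0n _ _) (Im_phi_le _)))// (ger0_norm (th_ge0 n)).
rewrite [leLHS](_ : _ = (n.+1%:R * th n ^+ 2) * (th n * M ^+ 3)).
  by rewrite th_sqr mul1r.
by ring.
Qed.

(** The characteristic function of the normalized sum is the [n]-th power of
    [phi (th n)]. Its imaginary part and its distance to a real exponential are
    of order [n ^ (-3/2)] and [n ^ (-2)]: raising to the power [n] multiplies
    these errors by [n] only. *)
Lemma prefix_clt :
  Ex P (fun t => cos ((\sum_(i < n) g (S i t)) / Num.sqrt n%:R)) @[n --> \oo] -->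
    expR (- (sigma2 / 2)) /\
  Ex P (fun t => sin ((\sum_(i < n) g (S i t)) / Num.sqrt n%:R)) @[n --> \oo] --> 0.
Proof.
have pw n := nearly_real_power n.+1 (cos1 (th n) 1) (cos1 (th n)) (sin1 (th n)).
have M4 : 0 <= M ^+ 4 by rewrite exprn_ge0.
split; rewrite -cvg_shiftS /=; apply/cvgrPdist_le => e e0.
- have cM2 : th n * M ^+ 3 + 2 * (th n * th n) * M ^+ 4 @[n --> \oo] --> 0.
    rewrite -[X in _ --> X](addr0 0); apply: cvgD => //.
    rewrite -[X in _ --> X](mul0r (M ^+ 4)); apply: cvgM; last exact: cvg_cst.
    rewrite -[X in _ --> X](mulr0 2); apply: cvgM; first exact: cvg_cst.
    by rewrite -[X in _ --> X](mulr0 0); exact: cvgM th_cvg th_cvg.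
  have /cvgrPdist_le/(_ _ e0) := cM2; apply: filterS => n.
  rewrite sub0r normrN ger0_norm; last first.
    by rewrite addr_ge0 ?mulr_ge0 ?exprn_ge0.
  apply: le_trans; rewrite distrC.
  rewrite (_ : (fun t => _) = fun t => cos (th n * \sum_(i < n.+1) g (S i t)));
    last by apply/funext => t; rewrite mulrC.
  rewrite -Re_phi; have [h _] := pw n; rewrite expr1 in h.
  set G := expR (- (th n ^+ 2 * sigma2 / 2)).
  have -> : expR (- (sigma2 / 2)) = G ^+ n.+1.
    rewrite -expRM_natl; congr expR.
    rewrite [RHS](_ : _ = - ((n.+1%:R * th n ^+ 2) * (sigma2 / 2))).
      by rewrite th_sqr mul1r.
    by ring.
  have G1 : `|G| <= 1.
    rewrite ger0_norm ?expR_ge0// -[leRHS]expR0 ler_expR oppr_le0 divr_ge0//.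
    by rewrite mulr_ge0// sqr_ge0.
  have h2 : `|Re (phi (th n)) ^+ n.+1 - G ^+ n.+1| <=
      2 * (th n * th n) * M ^+ 4.
    have := cos1 (th n) 1; rewrite expr1 => R1.
    rewrite (le_trans (expr_dist_le _ R1 G1))//.
    rewrite (le_trans (ler_wpM2l (ler0n _ _) (Re_phi_le _)))//.
    rewrite [leLHS](_ : _ = (n.+1%:R * th n ^+ 2) * (2 * (th n * th n) * M ^+ 4)).
      by rewrite th_sqr mul1r.
    by ring.
  rewrite (le_trans (ler_distD (Re (phi (th n)) ^+ n.+1) _ _))//.
  by rewrite lerD// (le_trans h).
- have /cvgrPdist_le/(_ _ e0) := th3M_cvg; apply: filterS => n.
  rewrite !sub0r !normrN ger0_norm ?mulr_ge0 ?exprn_ge0//; apply: le_trans.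
  rewrite (_ : (fun t => _) = fun t => sin (th n * \sum_(i < n.+1) g (S i t)));
    last by apply/funext => t; rewrite mulrC.
  by rewrite -Im_phi; have [_ h] := pw n; rewrite expr1 in h; rewrite (le_trans h).
Qed.

End PrefixClt.

(** * Uniform control of all the counts *)

Section Deviations.
Context {R : realType} {b : nat}.
Hypothesis b0 : (0 < b)%N.
Variables (mu : 'I_b -> R) (p : 'M[R]_b).
Hypothesis hmu : forall i, 0 < mu i < 1.
Hypothesis hp : forall i j, 0 < p i j < 1.
Context {d : measure_display} {T : measurableType d} (P : probability T R).
Variable S : nat -> T -> string b.
Hypothesis hS : forall i, markov_chain P mu p (S i).
Hypothesis hSind : independent_strings P S.

Definition deviation n k (w : k.-tuple 'I_b) (t : T) : R :=
  (count_prefix S w n t * (1 < count_prefix S w n t))%:R -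
  n%:R * word_weight mu p w.

Lemma measurable_deviation n k (w : k.-tuple 'I_b) :
  measurable_fun [set: T] (deviation n w).
Proof.
exact: (measurable_count_fun b0 hS hSind w n
  (fun j => (j * (1 < j))%:R - n%:R * word_weight mu p w)).
Qed.

Lemma deviation0 k (w : k.-tuple 'I_b) t : deviation 0 w t = 0.
Proof. by rewrite /deviation /count_prefix big_ord0 mul0r subr0. Qed.

Variable q : R.
Hypothesis q01 : 0 < q < 1.
Hypothesis muq : forall i, mu i <= q.
Hypothesis pq : forall i j, p i j <= q.

Lemma word_weight_le1 s : word_weight mu p s <= 1.
Proof.
have /andP[q0 q1] := q01; apply: le_trans (word_weight_le hmu hp q01 muq pq s) _.
by rewrite exprn_ile1// ltW.
Qed.

(** One factor of each square is at most [q ^ k], and the other ones sum to 1. *)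
Lemma sum_sqr_weight k : \sum_(w : k.-tuple 'I_b) word_weight mu p w ^+ 2 <= q ^+ k.
Proof.
rewrite -[leRHS]mulr1 -(sum_word_weight b0 hS hSind k) mulr_sumr.
apply: ler_sum => w _; rewrite expr2 ler_wpM2r ?word_weight_ge0//.
by rewrite -[X in q ^+ X](size_tuple w); exact: (word_weight_le hmu hp q01 muq pq).
Qed.

Lemma deviation_moment r n k (w : k.-tuple 'I_b) : (1 < r)%N ->
  integrableR P (fun t => `|deviation n w t| ^+ r.*2) /\
  Ex P (fun t => `|deviation n w t| ^+ r.*2) <=
    moment_constant r * (n%:R ^+ r * word_weight mu p w ^+ 2).
Proof.
move=> r1; split; last first.
  apply: truncated_moment_le => //.
  - exact: (measurable_count_fun b0 hS hSind w n (fun j => j%:R)).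
  - by move=> t; exact: count_prefix_le.
  - by rewrite word_weight_ge0// word_weight_le1.
  - exact: mean_count_prefix.
  - by move=> y; exact: mgf_count_prefix.
apply: (@integrableR_bounded _ _ _ _ _ ((n%:R + n%:R) ^+ r.*2)).
  by apply: measurable_normX; exact: measurable_deviation.
move=> t; rewrite ger0_norm ?exprn_ge0// lerXn2r ?nnegrE ?addr_ge0//.
rewrite (le_trans (ler_normB _ _))// lerD//.
  rewrite ger0_norm// ler_nat (leq_trans _ (count_prefix_le S w n t))//.
  by case: (1 < _)%N; rewrite ?muln1 ?muln0.
rewrite ger0_norm ?mulr_ge0 ?word_weight_ge0//.
by rewrite ler_piMr// word_weight_le1.
Qed.

Section Control.
Variable r : nat.
Hypothesis r1 : (1 < r)%N.

Let rho : R := expR (ln q / (r.*2)%:R / 2).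

Let r20 : (r.*2)%:R != 0 :> R.
Proof. by rewrite pnatr_eq0 -lt0n double_gt0 ltnW. Qed.

Let rhoX : (rho ^+ r.*2) ^+ 2 = q.
Proof.
have /andP[q0 _] := q01.
rewrite -!expRM_natl (_ : _ * _ = ln q) ?lnK ?posrE//.
by field.
Qed.

Let rho0 : 0 < rho. Proof. exact: expR_gt0. Qed.
Let rho1 : rho < 1.
Proof.
have /andP[q0 q1] := q01; rewrite expR_lt1 pmulr_llt0// pmulr_llt0.
  by rewrite ln_lt0// q0.
by rewrite invr_gt0 lt0r r20/=.
Qed.

Let rs := rho ^+ r.*2.
Let rs0 : 0 < rs. Proof. by rewrite exprn_gt0. Qed.
Let rs1 : rs < 1. Proof. by rewrite exprn_ilt1 ?(ltW rho0)// -lt0n double_gt0 ltnW. Qed.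

(** The weights [rs ^- k] are affordable as the moments are of order [rs ^ 2k]. *)
Let u n k t : R :=
  rs ^- k * \sum_(w : k.-tuple 'I_b) (`|deviation n w t| / Num.sqrt n%:R) ^+ r.*2.

Let u0 n k t : 0 <= u n k t.
Proof.
apply: mulr_ge0; first by rewrite invr_ge0 exprn_ge0// ltW.
by apply: sumr_ge0 => w _; rewrite exprn_ge0// divr_ge0.
Qed.

Let sqrt_exp n : Num.sqrt n%:R ^+ r.*2 = n%:R ^+ r :> R.
Proof. by rewrite -mul2n exprM sqr_sqrtr. Qed.

Let uE n k : u n k = fun t => rs ^- k * \sum_(w : k.-tuple 'I_b)
  (n%:R ^- r * `|deviation n w t| ^+ r.*2).
Proof.
apply/funext => t; congr (_ * _); apply: eq_bigr => w _.
by rewrite exprMn exprVn sqrt_exp mulrC.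
Qed.

Let u_moment n k : integrableR P (u n k) /\ Ex P (u n k) <= moment_constant r * rs ^+ k.
Proof.
have id k' (w : k'.-tuple 'I_b) := (deviation_moment n w r1).1.
have iu : integrableR P (u n k).
  rewrite uE; apply: integrableRZ; apply: integrableR_sum => w _; exact: integrableRZ.
split=> //.
rewrite uE ExZ; last by apply: integrableR_sum => w _; exact: integrableRZ.
rewrite Ex_sum; last by move=> w _; exact: integrableRZ.
have c0 : 0 <= moment_constant r :> R by exact: moment_constant_ge0.
have -> : moment_constant r * rs ^+ k = rs ^- k * (moment_constant r * q ^+ k).
  by rewrite -rhoX -/rs -exprM mulnC exprM; field; rewrite gt_eqF// exprn_gt0.
apply: ler_wpM2l; first by rewrite invr_ge0 exprn_ge0// ltW.
apply: (@le_trans _ _ (\sum_(w : k.-tuple 'I_b) moment_constant r *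
    word_weight mu p w ^+ 2)); last first.
  by rewrite -mulr_sumr ler_wpM2l// sum_sqr_weight.
apply: ler_sum => w _; rewrite ExZ//.
have [->|n0] := eqVneq n 0%N.
  rewrite expr0n gtn_eqF ?(ltnW r1)//= invr0 mul0r.
  by rewrite mulr_ge0// exprn_even_ge0.
have nr : 0 < n%:R ^+ r :> R by rewrite exprn_gt0// ltr0n lt0n.
rewrite mulrC ler_pdivrMr// (le_trans (deviation_moment n w r1).2)//.
by rewrite mulrCA mulrC mulrA.
Qed.

Let U n t : \bar R := (\sum_(0 <= k <oo) (u n k t)%:E)%E.

Let CU : R := moment_constant r / (1 - rs).

Let mU n : measurable_fun [set: T] (U n).
Proof.
apply: ge0_emeasurable_sum => [k t _ _|k _]; first by rewrite lee_fin.
by apply/measurable_EFinP; exact: integrableR_measurable (u_moment n k).1.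
Qed.

Let U0 n t : (0 <= U n t)%E.
Proof. by apply: nneseries_ge0 => k _ _; rewrite lee_fin. Qed.

Let intU n : (\int[P]_t U n t <= CU%:E)%E.
Proof.
rewrite /U integral_nneseries//; last 2 first.
- by move=> k; apply/measurable_EFinP; exact: integrableR_measurable (u_moment n k).1.
- by move=> k t _; rewrite lee_fin.
apply: lime_le.
  by apply: is_cvg_nneseries => k _ _; apply: integral_ge0 => t _; rewrite lee_fin.
apply: nearW => N.
rewrite (eq_bigr (fun k => (Ex P (u n k))%:E)); last first.
  move=> k _; have := expectation_Ex (u_moment n k).1.
  by rewrite unlock => ->.
rewrite sumEFin lee_fin.
apply: (@le_trans _ _ (\sum_(0 <= k < N) moment_constant r * rs ^+ k)).
  by apply: ler_sum => k _; exact: (u_moment n k).2.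
rewrite -mulr_sumr ler_wpM2l//.
  exact: moment_constant_ge0.
rewrite -[leRHS]mul1r -(expr0 rs); apply: sum_geometric_le.
by rewrite (ltW rs0).
Qed.

Let iU n : P.-integrable [set: T] (U n).
Proof.
apply/integrableP; split; first exact: mU.
under eq_integral do rewrite gee0_abs//.
exact: le_lt_trans (intU n) (ltry _).
Qed.

Let V n t : R := (fine (U n t)) `^ ((r.*2)%:R)^-1.

Let VX n t : V n t ^+ r.*2 = fine (U n t).
Proof.
rewrite /V -powR_mulrn ?powR_ge0// -powRrM mulVf// powRr1//.
exact: fine_ge0.
Qed.

Lemma deviation_control : exists rho C : R, [/\ 0 < rho < 1, 0 <= C &
  forall n, exists V : T -> R, [/\ measurable_fun [set: T] V,
    forall t, 0 <= V t, integrableR P (fun t => V t ^+ r.*2),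
    Ex P (fun t => V t ^+ r.*2) <= C &
    {ae P, forall t, forall k (w : k.-tuple 'I_b),
      `|deviation n w t| <= Num.sqrt n%:R * rho ^+ k * V t}]].
Proof.
exists rho, CU; split; first by rewrite rho0.
  rewrite divr_ge0 ?subr_ge0 ?(ltW rs1)//.
  exact: moment_constant_ge0.
move=> n; exists (V n).
have iV : integrableR P (fun t => V n t ^+ r.*2).
  rewrite (_ : (fun t => _) = fun t => fine (U n t)); last first.
    by apply/funext => t; rewrite VX.
  apply/integrableP; split.
    by apply/measurable_EFinP; apply: measurableT_comp => //; exact: mU.
  apply: le_lt_trans (ltry CU); apply: le_trans (intU n).
  apply: ge0_le_integral => //.
  - apply/measurable_EFinP; apply: measurableT_comp => //.
    by apply: measurableT_comp => //; exact: mU.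
  - move=> t _ /=; rewrite ger0_norm ?fine_ge0//.
    by have := U0 n t; case: (U n t) => [x|_|]//=; rewrite leey.
have aeU : {ae P, forall t, U n t \is a fin_num}.
  by have := integrable_ae measurableT (iU n); apply: filterS => t; apply.
split=> //.
- apply: (@measurableT_comp _ _ _ _ _ _ (fun x : R => x `^ ((r.*2)%:R)^-1)).
    exact: measurable_powR.
  by apply: measurableT_comp => //; exact: mU.
- by move=> t; exact: powR_ge0.
- rewrite -lee_fin; have := expectation_Ex iV; rewrite unlock => <-.
  apply: le_trans (intU n); apply: ge0_le_integral => //.
  - by move=> t _; rewrite lee_fin VX fine_ge0.
  - exact: (measurable_int _ iV).
  - move=> t _; rewrite VX.
    by have := U0 n t; case: (U n t) => [x|_|]//=; rewrite leey.
apply: filterS aeU => t Ut k w.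
have [->|n0] := eqVneq n 0%N.
  by rewrite deviation0 normr0 !mulr_ge0 ?exprn_ge0 ?(ltW rho0) ?powR_ge0.
have sn : 0 < Num.sqrt n%:R :> R by rewrite sqrtr_gt0 ltr0n lt0n.
rewrite -mulrA -ler_pdivrMl// mulrC.
have rV : 0 <= rho ^+ k * V n t by rewrite mulr_ge0 ?powR_ge0 ?exprn_ge0 ?(ltW rho0).
rewrite -(ler_pXn2r (_ : 0 < r.*2)%N) ?nnegrE ?divr_ge0//; last first.
  by rewrite double_gt0 ltnW.
rewrite [leRHS]exprMn VX -exprM mulnC exprM -/rs -ler_pdivrMl ?exprn_gt0//.
have ukU : u n k t <= fine (U n t).
  rewrite -lee_fin fineK//; apply: le_trans (nneseries_lim_ge k.+1 _); last first.
    by move=> j _; rewrite lee_fin.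
  by rewrite big_nat_recr//= leeDr// sume_ge0// => j _; rewrite lee_fin.
apply: le_trans ukU; apply: ler_wpM2l; first by rewrite invr_ge0 exprn_ge0// ltW.
by rewrite (bigD1 w)//= lerDl sumr_ge0.
Qed.

End Control.
End Deviations.

(** * The maximum of Z and its approximations *)

Section ZExpansion.
Context {R : realType} {b : nat}.
Hypothesis b0 : (0 < b)%N.
Variables (mu : 'I_b -> R) (p : 'M[R]_b).
Hypothesis hmu : forall i, 0 < mu i < 1.
Hypothesis hp : forall i j, 0 < p i j < 1.
Variable q : R.
Hypothesis q01 : 0 < q < 1.
Hypothesis muq : forall i, mu i <= q.
Hypothesis pq : forall i j, p i j <= q.
Context {d : measure_display} {T : measurableType d}.
Variable S : nat -> T -> string b.

Local Notation mw v k := (word_weight mu p (mkseq v k)).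
Local Notation mx v := (m mu p v).
Local Notation mmax := (m_max mu p).

Definition Z_term n k (v : string b) t : R :=
  (count_prefix S (prefix k v) n t * (1 < count_prefix S (prefix k v) n t))%:R.

Lemma ZE n v t : Z R S n v t = (\sum_(0 <= k <oo) (Z_term n k v t)%:E)%E.
Proof.
by rewrite /Z; apply: eq_eseriesr => k _; rewrite LambdaE /Z_term natrM.
Qed.

Lemma Z_term_deviation n k v t :
  Z_term n k v t = deviation mu p S n (prefix k v) t + n%:R * mw v k.
Proof. by rewrite /deviation prefix_mkseq subrK. Qed.

Lemma Z_term_agree n k (u v : string b) t : agree k u v ->
  Z_term n k u t = Z_term n k v t.
Proof. by move=> /agreeP/eqP uv; rewrite /Z_term uv. Qed.

Lemma Z_partial_le n v t K :
  ((\sum_(0 <= k < K) Z_term n k v t)%:E <= Z R S n v t)%E.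
Proof.
rewrite ZE -sumEFin; apply: nneseries_lim_ge => k _; by rewrite lee_fin.
Qed.

Section Pointwise.
Variables (n : nat) (t : T) (rho V : R).
Hypothesis rho01 : 0 < rho < 1.
Hypothesis V0 : 0 <= V.
Hypothesis dev_le : forall k (w : k.-tuple 'I_b),
  `|deviation mu p S n w t| <= Num.sqrt n%:R * rho ^+ k * V.

Let sn := Num.sqrt n%:R : R.
Let B := V / (1 - rho).

Let rho01' : 0 <= rho < 1. Proof. by have /andP[/ltW -> ->] := rho01. Qed.

Let B0 : 0 <= B.
Proof. by have /andP[_ r1] := rho01; rewrite divr_ge0 ?subr_ge0// ltW. Qed.

Local Notation z v := (fine (Z R S n v t)).

Lemma Z_expansion v : Z R S n v t = (z v)%:E /\ forall L,
  `|z v - n%:R * mx v - \sum_(0 <= k < L) deviation mu p S n (prefix k v) t| <=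
  sn * B * rho ^+ L.
Proof.
have dk k : `|deviation mu p S n (prefix k v) t| <= sn * V * rho ^+ k.
  by rewrite (le_trans (dev_le _))// mulrAC.
have [ce tl] := geometric_series_tail rho01' dk.
have cm := m_cvg hmu hp q01 muq pq (v := v).
have cz : series (fun k => Z_term n k v t) @ \oo -->
    limn (series (fun k => deviation mu p S n (prefix k v) t)) + n%:R * mx v.
  rewrite (_ : series _ = fun N => series (fun k => deviation mu p S n (prefix k v) t) N +
      n%:R * series (fun k => mw v k) N).
    by apply: cvgD => //; apply: cvgM; [exact: cvg_cst|exact: cm].
  apply/funext => N; rewrite /series/= mulr_sumr -big_split/=.
  by apply: eq_bigr => k _; rewrite Z_term_deviation.
have ZEF := eseries_EFin cz.
rewrite -ZE in ZEF; rewrite ZEF; split=> // L.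
by rewrite /= addrK (le_trans (tl L))// le_eqVlt; apply/orP; left; apply/eqP;
  rewrite /B; ring.
Qed.

Let zE v : Z R S n v t = (z v)%:E. Proof. exact: (Z_expansion v).1. Qed.

Lemma Z_linear_le v : `|z v - n%:R * mx v| <= sn * B.
Proof.
by have [_ /(_ 0%N)] := Z_expansion v; rewrite big_geq// subr0 expr0 mulr1.
Qed.

Lemma Z_agree_le K (u v : string b) : agree K u v ->
  `|(z u - n%:R * mx u) - (z v - n%:R * mx v)| <= 2 * (sn * B * rho ^+ K).
Proof.
move=> uv.
have E : \sum_(0 <= k < K) deviation mu p S n (prefix k u) t =
    \sum_(0 <= k < K) deviation mu p S n (prefix k v) t.
  apply: eq_big_nat => k /andP[_ kK].
  by have /agreeP/eqP -> := agree_le (ltnW kK) uv.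
have [_ /(_ K)] := Z_expansion u; have [_ /(_ K)] := Z_expansion v; rewrite E.
move: (\sum_(_ <= _ < _) _) => x; rewrite !ler_norml => /andP[? ?] /andP[? ?].
by apply/andP; split; lra.
Qed.

Let ub v : z v <= n%:R * mmax + sn * B.
Proof.
have := Z_linear_le v; rewrite ler_norml => /andP[_ h].
have := ler_wpM2l (ler0n R n) (m_le_m_max hmu hp q01 muq pq b0 v); lra.
Qed.

Local Notation zmax := (fine (Z_max R S n t)).

Lemma Z_max_fin : (forall v, z v <= zmax) /\
  forall y, (forall v, z v <= y) -> zmax <= y.
Proof.
have le_ub y : (forall v, z v <= y) -> (Z_max R S n t <= y%:E)%E.
  by move=> zy; apply: ub_ereal_sup => _ [v _ <-]; rewrite zE lee_fin.
have lb v : ((z v)%:E <= Z_max R S n t)%E.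
  by rewrite -zE; apply: ereal_sup_ubound; exists v.
have fin : Z_max R S n t \is a fin_num.
  pose v0 : string b := fun=> Ordinal b0.
  rewrite fin_real// (lt_le_trans (ltNyr _) (lb v0))/=.
  exact: le_lt_trans (le_ub _ ub) (ltry _).
split=> [v|y zy]; first by rewrite -lee_fin (fineK fin).

by rewrite -lee_fin (fineK fin) le_ub.
Qed.

Lemma normalized_Z_max_le : `|normalized_Z_max S mmax n t| <= B.
Proof.
rewrite /normalized_Z_max; have [n0|n0] := eqVneq n 0%N.
  by rewrite n0 sqrtr0 invr0 mulr0 normr0.
have sn0 : 0 < sn by rewrite sqrtr_gt0 ltr0n lt0n.
rewrite normrM normfV (gtr0_norm sn0) ler_pdivrMr// [leRHS]mulrC.
have [zl zu] := Z_max_fin; have := zu _ ub => h1.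
have [v vmax] := Sigma_max_nonempty hmu hp q01 muq pq b0.
have := Z_linear_le v; have := zl v; rewrite vmax ler_norml => h2 /andP[h3 h4].
by rewrite ler_norml; apply/andP; split; lra.
Qed.

Definition centered_Z (v : string b) (s : T) : R :=
  (fine (Z R S n v s) - n%:R * mx v) / Num.sqrt n%:R.

Lemma centered_Z_le v : `|centered_Z v t| <= B.
Proof.
rewrite /centered_Z; have [n0|n0] := eqVneq n 0%N.
  by rewrite n0 sqrtr0 invr0 mulr0 normr0.
have sn0 : 0 < sn by rewrite sqrtr_gt0 ltr0n lt0n.
by rewrite normrM normfV (gtr0_norm sn0) ler_pdivrMr// [leRHS]mulrC Z_linear_le.
Qed.

Variables (N K : nat) (v_ : 'I_N.+1 -> string b) (delta : R).
Hypothesis v_max : forall i, Sigma_max mu p (v_ i).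
Hypothesis v_cover : forall u, Sigma_max mu p u -> exists i, agree K (v_ i) u.
Hypothesis delta0 : 0 < delta.
Hypothesis gap : forall v, (forall u, Sigma_max mu p u -> ~ agree K u v) ->
  mx v <= mmax - delta.

(** Strings that follow a maximizer to depth [K] are compared with one of the
    [v_ i]; for the others the linear term loses [sqrt n * delta], and
    [2 * B - y <= 4 * B ^+ 2 / y]. *)
Lemma normalized_Z_max_approx : (0 < n)%N ->
  `|normalized_Z_max S mmax n t - max_coord (fun i => centered_Z (v_ i) t)| <=
  2 * B * rho ^+ K + 4 * B ^+ 2 / (sn * delta).
Proof.
move=> n0; have sn0 : 0 < sn by rewrite sqrtr_gt0 ltr0n.
have /andP[r0 r1] := rho01.
set M := max_coord _.
have [zl zu] := Z_max_fin.
have sn2 : n%:R = sn * sn by rewrite -expr2 sqr_sqrtr.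
have zv v : z v = n%:R * mx v + sn * centered_Z v t.
  by rewrite /centered_Z -/sn (mulrC sn) divfK ?gt_eqF//; ring.
have lo : M <= normalized_Z_max S mmax n t.
  apply: max_coord_le => i; rewrite /normalized_Z_max ler_pdivlMr//.
  have := zl (v_ i); rewrite zv (v_max i : m mu p _ = _) => h.
  by rewrite lerBrDl [X in _ + X]mulrC (mulrC mmax).
have e1 : 0 <= 2 * B * rho ^+ K.
  by apply: mulr_ge0; [exact: mulr_ge0|exact: exprn_ge0 (ltW r0)].
have sd : 0 < sn * delta by rewrite mulr_gt0.
have e2 : 0 <= 4 * B ^+ 2 / (sn * delta).
  by apply: divr_ge0 (ltW sd); apply: mulr_ge0 => //; exact: sqr_ge0.
have MB : - B <= M.
  have := max_coord_ub (fun i => centered_Z (v_ i) t) ord0; apply: le_trans.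
  by have := centered_Z_le (v_ ord0); rewrite ler_norml => /andP[].
have hi : normalized_Z_max S mmax n t <= M + (2 * B * rho ^+ K + 4 * B ^+ 2 / (sn * delta)).
  rewrite /normalized_Z_max -/sn ler_pdivrMr// lerBlDr; apply: zu => v.
  have mv := m_le_m_max hmu hp q01 muq pq b0 v.
  have [[u [umax uv]]|nu] := pselect (exists u, Sigma_max mu p u /\ agree K u v).
    have [i iu] := v_cover umax; have iv := agree_trans iu uv.
    have := Z_agree_le (agree_sym iv); rewrite !zv ler_norml => /andP[_ h].
    have cM := max_coord_ub (fun i => centered_Z (v_ i) t) i; rewrite -/M in cM.
    have h1 := ler_wpM2l (ltW sn0) cM.
    have h2 := ler_wpM2l (ler0n R n) mv.
    have h3 := mulr_ge0 (ltW sn0) e2.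
    rewrite (mulrC (M + _)) !mulrDr; rewrite -/sn in h h1 *.
    move: h h1 h2 h3; set x := sn * _; set y := sn * _; lra.
  have mg : mx v <= mmax - delta.
    by apply: gap => u umax uv; apply: nu; exists u.
  have := centered_Z_le v; rewrite ler_norml => /andP[_ cv].
  have key : 2 * B - sn * delta <= 4 * B ^+ 2 / (sn * delta).
    by rewrite ler_pdivlMr//; have := sqr_ge0 (2 * B - sn * delta); nra.
  have h1 := ler_wpM2l (ler0n R n) mg.
  have h2 : centered_Z v t <= M + (2 * B * rho ^+ K + 4 * B ^+ 2 / (sn * delta)) +
    sn * delta by lra.
  have h3 := ler_wpM2l (ltW sn0) h2; rewrite zv; rewrite sn2 in h1 *.
  move: h1 h3; set E := _ + 4 * _ / _; set x := mx v; set c := centered_Z v t.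
  lra.
rewrite ger0_norm ?subr_ge0//; lra.
Qed.

End Pointwise.
End ZExpansion.

Section Measurability.
Context {R : realType} {b : nat}.
Hypothesis b0 : (0 < b)%N.
Variables (mu : 'I_b -> R) (p : 'M[R]_b).
Context {d : measure_display} {T : measurableType d} (P : probability T R).
Variable S : nat -> T -> string b.
Hypothesis hS : forall i, markov_chain P mu p (S i).
Hypothesis hSind : independent_strings P S.

Lemma measurable_Z_term n k v : measurable_fun [set: T] (Z_term (R := R) S n k v).
Proof.
exact: (measurable_count_fun b0 hS hSind (prefix k v) n (fun j => (j * (1 < j))%:R)).
Qed.

Lemma measurable_Z n v : measurable_fun [set: T] (Z R S n v).
Proof.
rewrite (_ : Z R S n v = fun t => (\sum_(0 <= k <oo) (Z_term S n k v t)%:E)%E).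
  apply: ge0_emeasurable_sum => [k t _ _|k _]; first by rewrite lee_fin.
  by apply/measurable_EFinP; exact: measurable_Z_term.
by apply/funext => t; rewrite ZE.
Qed.

Lemma measurable_centered_Z n v : measurable_fun [set: T] (centered_Z mu p S n v).
Proof.
apply: measurable_funM => //; apply: measurable_funB => //.
by apply: measurableT_comp => //; exact: measurable_Z.
Qed.

(** The supremum over all strings is one over finite words: the terms are
    nonnegative and the partial sums depend on a prefix only. *)
Lemma measurable_Z_max n : measurable_fun [set: T] (Z_max R S n).
Proof.
pose part K (v : string b) t := (\sum_(0 <= k < K) Z_term S n k v t)%:E : \bar R.
pose M K t := \big[maxe/-oo%E]_(w : K.-tuple 'I_b) part K (word_string b0 w) t.
have mpart K v : measurable_fun [set: T] (part K v).
  apply/measurable_EFinP; apply: measurable_sum => k; exact: measurable_Z_term.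
have mM K : measurable_fun [set: T] (M K).
  rewrite /M; elim: (index_enum _) => [|w s IHs].
    by rewrite (_ : (fun t => _) = cst -oo%E)//; apply/funext => t; rewrite big_nil.
  rewrite (_ : (fun t => _) = fun t => maxe (part K (word_string b0 w) t)
      (\big[maxe/-oo%E]_(j <- s) part K (word_string b0 j) t)).
    exact: measurable_maxe.
  by apply/funext => t; rewrite big_cons.
rewrite (_ : Z_max R S n = fun t => esups (fun K => M K t) 0%N).
  exact: measurable_fun_esups.
apply/funext => t; rewrite /esups /sdrop; apply/eqP; rewrite eq_le; apply/andP; split.
- apply: ub_ereal_sup => _ [v _ <-].
  rewrite ZE; apply: lime_le.
    by apply: is_cvg_nneseries => k _ _; rewrite lee_fin.
  apply: nearW => K; rewrite sumEFin.
  apply: (@le_trans _ _ (M K t)); last by apply: ereal_sup_ubound; exists K.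
  apply: (@le_trans _ _ (part K (word_string b0 (prefix K v)) t)).
    rewrite /part lee_fin le_eqVlt; apply/orP; left; apply/eqP.
    apply: eq_big_nat => k /andP[_ kK]; apply: Z_term_agree.
    by apply: (agree_le (ltnW kK)); apply/agreeP; rewrite prefix_word_string.
  exact: (@le_bigmax_cond _ _ _ _ _ _ (fun w => part K (word_string b0 (tval w)) t)).
- apply: ub_ereal_sup => _ [K _ <-]; apply: bigmax_le; first exact: leNye.
  move=> w _; apply: (le_trans (Z_partial_le S n (word_string b0 w) t K)).
  by apply: ereal_sup_ubound; exists (word_string b0 w).
Qed.

Lemma measurable_normalized_Z_max n :
  measurable_fun [set: T] (normalized_Z_max S (m_max mu p) n).
Proof.
apply: measurable_funM => //; apply: measurable_funB => //.
by apply: measurableT_comp => //; exact: measurable_Z_max.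
Qed.

End Measurability.

(** * The covariance of the depths of two strings *)

Lemma sum_cvg {R : realType} (I : Type) (s : seq I) (x : I -> nat -> R) (l : I -> R) :
  (forall i, x i n @[n --> \oo] --> l i) ->
  \sum_(i <- s) x i n @[n --> \oo] --> \sum_(i <- s) l i.
Proof.
move=> xl; elim: s => [|i s IHs].
  rewrite big_nil (_ : (fun n => _) = fun=> 0); first exact: cvg_cst.
  by apply/funext => n; rewrite big_nil.
rewrite big_cons (_ : (fun n => _) = fun n => x i n + \sum_(j <- s) x j n).
  exact: cvgD.
by apply/funext => n; rewrite big_cons.
Qed.

Section SquareIntegrable.
Context {R : realType} {d : measure_display} {T : measurableType d}.
Variable P : probability T R.
Implicit Types X Y : T -> R.

Definition square_integrable X :=
  measurable_fun [set: T] X /\ integrableR P (fun t => X t ^+ 2).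

Lemma square_integrable_cst c : square_integrable (fun=> c).
Proof. by split => //; exact: integrableR_cst. Qed.

Lemma square_integrableD X Y : square_integrable X -> square_integrable Y ->
  square_integrable (fun t => X t + Y t).
Proof.
move=> [mX iX] [mY iY]; have mXY := measurable_funD mX mY; split=> //.
apply: (integrableR_le _ _ (integrableRZ 2 (integrableRD iX iY))) => [|t].
  exact: measurable_funX.
rewrite ger0_norm ?sqr_ge0//; have := sqr_ge0 (X t - Y t); lra.
Qed.

Lemma square_integrableZ c X : square_integrable X ->
  square_integrable (fun t => c * X t).
Proof.
move=> [mX iX]; split; first exact: measurable_funM.
rewrite (_ : (fun t => _) = fun t => c ^+ 2 * X t ^+ 2); first exact: integrableRZ.
by apply/funext => t; rewrite exprMn.
Qed.

Lemma square_integrable_sum (I : Type) (s : seq I) (F : I -> T -> R) :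
  (forall i, square_integrable (F i)) ->
  square_integrable (fun t => \sum_(i <- s) F i t).
Proof.
move=> FI; elim: s => [|i s IHs].
  rewrite (_ : (fun t => _) = fun=> 0); first exact: square_integrable_cst.
  by apply/funext => t; rewrite big_nil.
rewrite (_ : (fun t => _) = fun t => F i t + \sum_(j <- s) F j t).
  exact: square_integrableD.
by apply/funext => t; rewrite big_cons.
Qed.

Lemma square_integrable_integrable X : square_integrable X -> integrableR P X.
Proof.
move=> [mX iX].
apply: (integrableR_le mX _ (integrableRD (integrableR_cst P 1) iX)) => t.
rewrite -(real_normK (num_real (X t))).
by have := sqr_ge0 (`|X t| - 1); have := sqr_ge0 `|X t|; nra.
Qed.

Lemma square_integrableM X Y : square_integrable X -> square_integrable Y ->
  integrableR P (fun t => X t * Y t).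
Proof.
move=> [mX iX] [mY iY].
apply: (integrableR_le _ _ (integrableRD iX iY)) => [|t].
  exact: measurable_funM.
have h1 := sqr_ge0 (X t - Y t); have h2 := sqr_ge0 (X t + Y t).
have h3 := sqr_ge0 (X t); have h4 := sqr_ge0 (Y t).
by rewrite ler_norml; apply/andP; split; nra.
Qed.

Lemma Ex_sqr_sum (n : nat) (c : 'I_n -> R) (F : 'I_n -> T -> R) :
  (forall i, square_integrable (F i)) ->
  Ex P (fun t => (\sum_i c i * F i t) ^+ 2) =
  \sum_i \sum_j c i * c j * Ex P (fun t => F i t * F j t).
Proof.
move=> FI; have iM i j := square_integrableM (FI i) (FI j).
rewrite (_ : (fun t => _) =
    fun t => \sum_i \sum_j c i * c j * (F i t * F j t)); last first.
  apply/funext => t; rewrite expr2 big_distrlr/=.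
  by apply: eq_bigr => i _; apply: eq_bigr => j _; rewrite mulrACA.
rewrite Ex_sum => [|i _]; last first.
  by apply: integrableR_sum => j _; exact: integrableRZ.
apply: eq_bigr => i _; rewrite Ex_sum => [|j _]; last exact: integrableRZ.
by apply: eq_bigr => j _; rewrite ExZ.
Qed.

End SquareIntegrable.

Section Depth.
Context {R : realType} {b : nat}.
Hypothesis b0 : (0 < b)%N.
Variables (mu : 'I_b -> R) (p : 'M[R]_b).
Hypothesis hmu : forall i, 0 < mu i < 1.
Hypothesis hp : forall i j, 0 < p i j < 1.
Variable q : R.
Hypothesis q01 : 0 < q < 1.
Hypothesis muq : forall i, mu i <= q.
Hypothesis pq : forall i j, p i j <= q.
Context {d : measure_display} {T : measurableType d} (P : probability T R).
Variable S : nat -> T -> string b.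
Hypothesis hS : forall i, markov_chain P mu p (S i).

Local Notation mw v k := (word_weight mu p (mkseq v k)).

Let ind (v : string b) k t : R := (prefix k (S 0%N t) == prefix k v)%:R.

Definition depth (v : string b) (t : T) : R := fine (lcp R v (S 0%N t)).

Definition truncated_depth L (v : string b) (t : T) : R :=
  \sum_(0 <= k < L) (prefix k (S 0%N t) == prefix k v)%:R.

Let ind_law v k : integrableR P (ind v k) /\ Ex P (ind v k) = mw v k.
Proof. by rewrite -prefix_mkseq; exact: (integrableR_prefix b0 hS 0%N (prefix k v)). Qed.

Let mw_le v k : mw v k <= q ^+ k.
Proof.
by rewrite -[X in q ^+ X](size_mkseq v); exact: (word_weight_le hmu hp q01 muq pq).
Qed.

Lemma measurable_truncated_depth L v : measurable_fun [set: T] (truncated_depth L v).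
Proof. by apply: measurable_sum => k; exact: integrableR_measurable (ind_law v k).1. Qed.

Lemma truncated_depth_ge0 L v t : 0 <= truncated_depth L v t.
Proof. exact: sumr_ge0. Qed.

Lemma truncated_depth_le L v t : truncated_depth L v t <= L%:R.
Proof.
rewrite /truncated_depth; elim: L => [|L IHL]; first by rewrite big_geq.
rewrite big_nat_recr//= -(natr1 L) lerD//.
by case: (_ == _).
Qed.

Lemma integrableR_truncated_depth L v : integrableR P (truncated_depth L v).
Proof.
apply: (@integrableR_bounded _ _ _ _ _ L%:R) => [|t].
  exact: measurable_truncated_depth.
by rewrite ger0_norm ?truncated_depth_ge0// truncated_depth_le.
Qed.

Lemma mean_truncated_depth L v :
  Ex P (truncated_depth L v) = \sum_(0 <= k < L) mw v k.
Proof.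
rewrite Ex_sum => [|k _]; last exact: (ind_law v k).1.
by apply: eq_bigr => k _; exact: (ind_law v k).2.
Qed.

Let sqr_le L v t : truncated_depth L v t ^+ 2 <=
  \sum_(0 <= k < L) (2 * k%:R + 1) * ind v k t.
Proof.
elim: L => [|L IHL]; first by rewrite /truncated_depth !big_geq// expr0n.
rewrite big_nat_recr//= /truncated_depth big_nat_recr//= -/(truncated_depth L v t).
have xL := truncated_depth_le L v t; have x0 := truncated_depth_ge0 L v t.
rewrite -/(ind v L t); have : ind v L t = 0 \/ ind v L t = 1.
  by rewrite /ind; case: (_ == _); [right|left].
by case=> ->; nra.
Qed.

Let sum_odd_geometric L : (1 - q) * \sum_(0 <= k < L) (2 * k%:R + 1) * q ^+ k =
  2 * \sum_(0 <= k < L) q ^+ k - 1 - (2 * L%:R - 1) * q ^+ L.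
Proof.
elim: L => [|L IHL]; first by rewrite !big_geq// expr0; ring.
by rewrite !big_nat_recr//= mulrDr IHL -(natr1 L) exprS; ring.
Qed.

Let C2 := 2 / (1 - q) / (1 - q).

Let sum_odd_le L : \sum_(0 <= k < L) (2 * k%:R + 1) * q ^+ k <= C2.
Proof.
have /andP[q0 q1] := q01; have q10 : 0 < 1 - q by rewrite subr_gt0.
rewrite ler_pdivlMr// mulrC sum_odd_geometric.
have h : \sum_(0 <= k < L) q ^+ k <= 1 / (1 - q).
  by rewrite -(expr0 q); apply: sum_geometric_le; rewrite (ltW q0).
have qL : 0 <= q ^+ L by rewrite exprn_ge0// ltW.
have : 0 <= 1 + (2 * L%:R - 1) * q ^+ L.
  case: L {h} qL => [|L] qL; first by rewrite expr0; lra.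
  have : 0 <= (2 * L.+1%:R - 1) * q ^+ L.+1.
    by rewrite mulr_ge0// -(natr1 L); have := ler0n R L; lra.
  lra.
have -> : 2 / (1 - q) = 2 * (1 / (1 - q)) by rewrite mul1r.
lra.
Qed.

Lemma truncated_depth_sqr_le L v : Ex P (fun t => truncated_depth L v t ^+ 2) <= C2.
Proof.
apply: le_trans (sum_odd_le L).
apply: (@le_trans _ _ (Ex P (fun t => \sum_(0 <= k < L) (2 * k%:R + 1) * ind v k t))).
  apply: Ex_le => // .
  - apply: (@integrableR_bounded _ _ _ _ _ (L%:R ^+ 2)) => [|t].
      by apply: measurable_funX; exact: measurable_truncated_depth.
    rewrite ger0_norm ?sqr_ge0// lerXn2r ?nnegrE ?truncated_depth_ge0//.
    exact: truncated_depth_le.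
  - by apply: integrableR_sum => k _; apply: integrableRZ; exact: (ind_law v k).1.
rewrite Ex_sum => [|k _]; last by apply: integrableRZ; exact: (ind_law v k).1.
apply: ler_sum => k _; rewrite ExZ; last exact: (ind_law v k).1.
by rewrite (ind_law v k).2 ler_wpM2l// addr_ge0// mulr_ge0.
Qed.

(** Almost surely the string differs from [v], and then the depth is finite. *)
Lemma ae_finite_depth v : {ae P, forall t, exists j, [/\ depth v t = j%:R,
  forall L, (j < L)%N -> truncated_depth L v t = depth v t + 1 &
  forall L, truncated_depth L v t <= depth v t + 1]}.
Proof.
pose N := \bigcap_(k in [set: nat]) [set t | prefix k (S 0%N t) = prefix k v].
have mN : measurable N.
  by apply: bigcapT_measurable => k; exact: (measurable_prefix b0 hS).
have PN : P N = 0%E.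
  apply/eqP; rewrite eq_le measure_ge0 andbT.
  have Pk k : (P N <= (q ^+ k)%:E)%E.
    apply: (@le_trans _ _ (P [set t | prefix k (S 0%N t) = prefix k v])).
      apply: le_measure; rewrite ?inE//; first exact: (measurable_prefix b0 hS).
      by move=> t; apply.
    rewrite (markov_prefix_law b0 hS) lee_fin prefix_mkseq; exact: mw_le.
  have qc : (q ^+ k)%:E @[k --> \oo] --> 0%E.
    apply: cvg_EFin; first exact: nearW.
    have /andP[q0 q1] := q01.
    by apply: cvg_expr; rewrite ger0_norm// ltW.
  rewrite -(cvg_lim _ qc)//; apply: lime_ge; first by apply/cvg_ex; eexists; exact: qc.
  exact: nearW.
have aeN : {ae P, forall t, ~ N t}.
  by exists N; split=> // t /= /contrapT.
apply: filterS aeN => t Nt.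
have {Nt} [k kt] : exists k, prefix k (S 0%N t) != prefix k v.
  apply: contrapT => h; apply: Nt => k _ /=; apply: contrapT => kt.
  by apply: h; exists k; apply/eqP.
have [j jP jmin] : exists2 j, prefix j.+1 (S 0%N t) != prefix j.+1 v &
    forall k, prefix k (S 0%N t) != prefix k v -> (j < k)%N.
  have ex : exists k, prefix k (S 0%N t) != prefix k v by exists k.
  case: (ex_minnP ex) => -[|j] jP jmin.
    by case/negP: jP; apply/agreeP.
  by exists j.
have agE k' : (prefix k' (S 0%N t) == prefix k' v) = (k' <= j)%N.
  apply/idP/idP => [kv|kj].
    rewrite leqNgt; apply/negP => jk; case/negP: jP; apply/agreeP.
    exact: agree_le jk (elimT (agreeP _ _ _) kv).
  by apply/negPn/negP => /jmin; rewrite ltnNge kj.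
have lcpE : lcp R v (S 0%N t) = (j%:R)%:E.
  apply/eqP; rewrite eq_le; apply/andP; split.
    apply: ub_ereal_sup => _ [l vl <-]; rewrite lee_fin ler_nat -agE.
    by apply/agreeP; exact: agree_sym.
  by rewrite agree_lcp eq_sym agE.
have dE : depth v t = j%:R by rewrite /depth lcpE.
have tE L : truncated_depth L v t = (minn L j.+1)%:R.
  rewrite /truncated_depth; elim: L => [|L IHL]; first by rewrite big_geq// min0n.
  rewrite big_nat_recr//= IHL agE -natrD; congr (_%:R).
  case: (leqP L j) => Lj.
    by rewrite (minn_idPl (leqW Lj)) (minn_idPl (_ : (L.+1 <= j.+1)%N))// addn1.
  by rewrite (minn_idPr Lj) (minn_idPr (leqW Lj)) addn0.
exists j; rewrite dE natr1; split=> // L; rewrite tE.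
  by move=> jL; rewrite (minn_idPr jL).
by rewrite ler_nat geq_minr.
Qed.

Lemma measurable_depth v : measurable_fun [set: T] (depth v).
Proof.
apply: (@measurableT_comp _ _ _ _ _ _ fine) => //.
rewrite (_ : (fun t => lcp R v (S 0%N t)) =
    fun t => esups (fun k => (k%:R * ind v k t)%:E) 0%N).
  apply: measurable_fun_esups => k; apply/measurable_EFinP.
  by apply: measurable_funM => //; exact: integrableR_measurable (ind_law v k).1.
apply/funext => t; rewrite /esups /sdrop; apply/eqP; rewrite eq_le; apply/andP; split.
  apply: ub_ereal_sup => _ [k vk <-]; apply: ereal_sup_ubound; exists k => //.
  by rewrite /ind; have /agreeP -> := agree_sym vk; rewrite mulr1.
apply: ub_ereal_sup => _ [k _ <-]; rewrite /ind; case: eqP => kv.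
  by rewrite mulr1 agree_lcp eq_sym; apply/eqP.
by rewrite mulr0 (_ : 0 = 0%:R)// agree_lcp; apply/agreeP.
Qed.

Lemma ae_truncated_depth_cvg v :
  {ae P, forall t, truncated_depth L v t @[L --> \oo] --> depth v t + 1}.
Proof.
apply: filterS (ae_finite_depth v) => t [j [_ tj _]].
by apply: cvg_near_cst; exists j.+1 => // L /= jL; exact: tj.
Qed.

Lemma square_integrable_depth v : square_integrable P (depth v).
Proof.
have mD := measurable_depth v.
have mD1 : measurable_fun [set: T] (fun t => depth v t + 1) by exact: measurable_funD.
suff : square_integrable P (fun t => depth v t + 1).
  move=> h; have := square_integrableD h (square_integrable_cst P (- 1)).
  by rewrite (_ : (fun t => _) = depth v)//; apply/funext => t; rewrite addrK.
split=> //; have [||A|//] := @integrableR_of_truncations _ _ _ P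
    (fun t => (depth v t + 1) ^+ 2) C2.
- exact: measurable_funX.
- by move=> t; exact: sqr_ge0.
pose f (x : R) := Num.min (x ^+ 2) A%:R.
have cf : continuous f.
  move=> x; apply: (@continuous_min _ _ (fun y : R => y ^+ 2) (fun=> A%:R)).
    exact: exprn_continuous.
  exact: cvg_cst.
have fA x : `|f x| <= A%:R.
  by rewrite ger0_norm /f ?le_min ?sqr_ge0 ?ler0n// ge_min lexx orbT.
have mf X : measurable_fun [set: T] X -> measurable_fun [set: T] (f \o X).
  by move=> mX; apply: measurableT_comp => //; exact: continuous_measurable_fun.
have [|||||_ cv] := @Ex_dominated _ _ _ P (fun L t => f (truncated_depth L v t))
    (fun t => f (depth v t + 1)) (fun=> A%:R).
- by move=> L; apply: mf; exact: measurable_truncated_depth.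
- exact: mf.
- apply: filterS (ae_truncated_depth_cvg v) => t ct.
  exact: cvg_comp ct (cf _).
- exact: integrableR_cst.
- by apply: aeW => t L; exact: fA.
rewrite -(cvg_lim _ cv)//; apply: limr_le; first by apply/cvg_ex; eexists; exact: cv.
apply: nearW => L; apply: le_trans (truncated_depth_sqr_le L v).
have i2 : integrableR P (fun t => truncated_depth L v t ^+ 2).
  apply: (@integrableR_bounded _ _ _ _ _ (L%:R ^+ 2)) => [|t].
    by apply: measurable_funX; exact: measurable_truncated_depth.
  rewrite ger0_norm ?sqr_ge0// lerXn2r ?nnegrE ?truncated_depth_ge0//.
  exact: truncated_depth_le.
apply: Ex_le => //; last by move=> t; rewrite ge_min lexx.
apply: (@integrableR_bounded _ _ _ _ _ A%:R) => [|t]; last exact: fA.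
by apply: mf; exact: measurable_truncated_depth.
Qed.

Lemma mean_depth_cvg v :
  \sum_(0 <= k < L) mw v k @[L --> \oo] --> Ex P (depth v) + 1.
Proof.
have sq := square_integrable_depth v; have iD := square_integrable_integrable sq.
have iD1 : integrableR P (fun t => depth v t + 1).
  by apply: integrableRD => //; exact: integrableR_cst.
have [|||||_] := @Ex_dominated _ _ _ P (fun L => truncated_depth L v)
    (fun t => depth v t + 1) (fun t => depth v t + 1).
- by move=> L; exact: measurable_truncated_depth.
- exact: integrableR_measurable iD1.
- exact: ae_truncated_depth_cvg.
- by [].
- apply: filterS (ae_finite_depth v) => t [j [_ _ tj]] L.
  by rewrite ger0_norm ?truncated_depth_ge0.
rewrite ExD//; last exact: integrableR_cst.
rewrite Ex_cst; apply: cvg_trans; apply: near_eq_cvg; apply: nearW => L.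
by rewrite mean_truncated_depth.
Qed.

(** The truncated depths count the empty prefix and so tend to the depth plus
    one; the shift disappears upon centering. *)
Lemma truncated_variance_cvg N (c : 'I_N -> R) (v_ : 'I_N -> string b) :
  Ex P (fun t => (\sum_i c i * (truncated_depth L (v_ i) t -
    \sum_(0 <= k < L) mw (v_ i) k)) ^+ 2) @[L --> \oo] -->
  Ex P (fun t => (\sum_i c i * (depth (v_ i) t - Ex P (depth (v_ i)))) ^+ 2).
Proof.
pose D t := \sum_i `|c i| * (depth (v_ i) t + (1 + (Ex P (depth (v_ i)) + 1))).
have sqD : square_integrable P D.
  apply: square_integrable_sum => i; apply: square_integrableZ.
  apply: square_integrableD; first exact: square_integrable_depth.
  exact: square_integrable_cst.
have partial_le i L : \sum_(0 <= k < L) mw (v_ i) k <= Ex P (depth (v_ i)) + 1.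
  have cv := @mean_depth_cvg (v_ i).
  rewrite -(cvg_lim _ cv)//; apply: limr_ge; first by apply/cvg_ex; eexists; exact: cv.
  exists L => // n /= Ln; rewrite (@big_cat_nat _ _ _ L 0 n)//= lerDl.
  by apply: sumr_ge0 => k _; rewrite word_weight_ge0.
have [|||||_] := @Ex_dominated _ _ _ P (fun L t => (\sum_i c i *
    (truncated_depth L (v_ i) t - \sum_(0 <= k < L) mw (v_ i) k)) ^+ 2)
    (fun t => (\sum_i c i * (depth (v_ i) t - Ex P (depth (v_ i)))) ^+ 2)
    (fun t => D t ^+ 2); last by [].
- move=> L; apply: measurable_funX; apply: measurable_sum => i.
  apply: measurable_funM => //; apply: measurable_funB => //.
  exact: measurable_truncated_depth.
- apply: measurable_funX; apply: measurable_sum => i.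
  apply: measurable_funM => //; apply: measurable_funB => //.
  exact: measurable_depth.
- have aeC : {ae P, forall t, forall i,
      truncated_depth L (v_ i) t @[L --> \oo] --> depth (v_ i) t + 1}.
    by apply: filter_forall => i; exact: ae_truncated_depth_cvg.
  apply: filterS aeC => t ct.
  have cs : \sum_i c i * (truncated_depth L (v_ i) t -
      \sum_(0 <= k < L) mw (v_ i) k) @[L --> \oo] -->
      \sum_i c i * (depth (v_ i) t - Ex P (depth (v_ i))).
    apply: sum_cvg => i.
    apply: cvgM; first exact: cvg_cst.
    rewrite (_ : _ - _ = depth (v_ i) t + 1 - (Ex P (depth (v_ i)) + 1)); last by ring.
    by apply: cvgB; [exact: ct|exact: mean_depth_cvg].
  rewrite expr2 (_ : (fun L => _) = fun L => (\sum_i c i * (truncated_depth L (v_ i) t -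
      \sum_(0 <= k < L) mw (v_ i) k)) * (\sum_i c i * (truncated_depth L (v_ i) t -
      \sum_(0 <= k < L) mw (v_ i) k))); last by apply/funext => L; rewrite expr2.
  exact: (cvgM cs cs).
- exact: sqD.2.
- have aeF : {ae P, forall t, forall i L,
      truncated_depth L (v_ i) t <= depth (v_ i) t + 1}.
    apply: filter_forall => i.
    by apply: filterS (ae_finite_depth (v_ i)) => t [j [_ _ h]].
  apply: filterS aeF => t ft L; rewrite ger0_norm ?sqr_ge0//.
  rewrite -(real_normK (num_real (\sum_i _))).
  have le : `|\sum_i c i * (truncated_depth L (v_ i) t -
      \sum_(0 <= k < L) mw (v_ i) k)| <= D t.
    apply: le_trans (ler_norm_sum _ _ _) _; apply: ler_sum => i _.
    rewrite normrM ler_wpM2l// (le_trans (ler_normB _ _))//.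
    rewrite !ger0_norm ?truncated_depth_ge0//; last first.
      by apply: sumr_ge0 => k _; rewrite word_weight_ge0.
    by rewrite addrA lerD.
  by rewrite lerXn2r ?nnegrE ?(le_trans _ le).
Qed.

End Depth.

(** * The joint characteristic function of finitely many values of Z *)

Section Approximation.
Context {R : realType}.

(** Interchange of limits: [y L] approximates [x], up to an error [e L] that does
    not depend on [n] and an error [h L] that vanishes as [n] grows. *)
Lemma cvg_approx (x : nat -> R) (y h : nat -> nat -> R) (e l : nat -> R) (l0 : R) :
  (forall L n, (0 < n)%N -> `|x n - y L n| <= e L + h L n) ->
  (forall L, h L n @[n --> \oo] --> 0) ->
  (forall L, y L n @[n --> \oo] --> l L) ->
  e L @[L --> \oo] --> 0 -> l L @[L --> \oo] --> l0 -> x n @[n --> \oo] --> l0.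
Proof.
move=> xy h0 yl e0 ll; apply/cvgrPdist_le => eps eps0.
have d0 : 0 < eps / 4 by rewrite divr_gt0.
have [L [eL lL]] : exists L, `|0 - e L| <= eps / 4 /\ `|l0 - l L| <= eps / 4.
  move: e0 ll => /cvgrPdist_le/(_ _ d0) h1 /cvgrPdist_le/(_ _ d0) h2.
  exact: filter_ex (filterI h1 h2).
move: (h0 L) (yl L) => /cvgrPdist_le/(_ _ d0) h1 /cvgrPdist_le/(_ _ d0) h2.
near=> n.
have n0 : (0 < n)%N by near: n; exists 1%N.
have a1 : `|0 - h L n| <= eps / 4 by near: n.
have a2 : `|l L - y L n| <= eps / 4 by near: n.
have a3 := xy L n n0.
move: eL lL a1 a2 a3; rewrite !ler_norml.
move=> /andP[? ?] /andP[? ?] /andP[? ?] /andP[? ?] /andP[? ?].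
by apply/andP; split; lra.
Unshelve. all: by end_near. Qed.

Lemma cos_lipschitz (x y : R) : `|cos x - cos y| <= `|x - y|.
Proof.
have -> : cos x - cos y = - 2 * (sin ((x + y) / 2) * sin ((x - y) / 2)).
  rewrite (_ : cos x = cos ((x + y) / 2 + (x - y) / 2)); last by congr cos; field.
  rewrite (_ : cos y = cos ((x + y) / 2 - (x - y) / 2)); last by congr cos; field.
  by rewrite cosD cosB; ring.
rewrite !normrM normrN normr_nat.
apply: (@le_trans _ _ (2 * (1 * `|(x - y) / 2|))).
  by rewrite ler_wpM2l// ler_pM// ?sin_max// sin_le_norm.
by rewrite normrM normfV normr_nat le_eqVlt; apply/orP; left; apply/eqP; field.
Qed.

Lemma sin_lipschitz (x y : R) : `|sin x - sin y| <= `|x - y|.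
Proof.
have -> : sin x - sin y = 2 * (cos ((x + y) / 2) * sin ((x - y) / 2)).
  rewrite (_ : sin x = sin ((x + y) / 2 + (x - y) / 2)); last by congr sin; field.
  rewrite (_ : sin y = sin ((x + y) / 2 - (x - y) / 2)); last by congr sin; field.
  by rewrite sinD sinB; ring.
rewrite !normrM normr_nat.
apply: (@le_trans _ _ (2 * (1 * `|(x - y) / 2|))).
  by rewrite ler_wpM2l// ler_pM// ?cos_max// sin_le_norm.
by rewrite normrM normfV normr_nat le_eqVlt; apply/orP; left; apply/eqP; field.
Qed.

Context {d : measure_display} {T : measurableType d} (P : probability T R).

Lemma integrableR_cos (X : T -> R) : measurable_fun [set: T] X ->
  integrableR P (fun t => cos (X t)).
Proof.
move=> mX; apply: (@integrableR_bounded _ _ _ _ _ 1) => [|t]; last exact: cos_max.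
apply: (@measurableT_comp _ _ _ _ _ _ (@cos R)) => //.
by apply: continuous_measurable_fun => y; exact: continuous_cos.
Qed.

Lemma integrableR_sin (X : T -> R) : measurable_fun [set: T] X ->
  integrableR P (fun t => sin (X t)).
Proof.
move=> mX; apply: (@integrableR_bounded _ _ _ _ _ 1) => [|t]; last exact: sin_max.
apply: (@measurableT_comp _ _ _ _ _ _ (@sin R)) => //.
by apply: continuous_measurable_fun => y; exact: continuous_sin.
Qed.

Lemma characteristic_dist (X Y Z : T -> R) : measurable_fun [set: T] X ->
  measurable_fun [set: T] Y -> integrableR P Z ->
  {ae P, forall t, `|X t - Y t| <= Z t} ->
  `|Ex P (fun t => cos (X t)) - Ex P (fun t => cos (Y t))| <= Ex P Z /\
  `|Ex P (fun t => sin (X t)) - Ex P (fun t => sin (Y t))| <= Ex P Z.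
Proof.
move=> mX mY iZ XYZ; split; apply: ae_Ex_dist => //.
- exact: integrableR_cos.
- exact: integrableR_cos.
- by apply: filterS XYZ => t; apply: le_trans; exact: cos_lipschitz.
- exact: integrableR_sin.
- exact: integrableR_sin.
- by apply: filterS XYZ => t; apply: le_trans; exact: sin_lipschitz.
Qed.

End Approximation.

Section CharacteristicZ.
Context {R : realType} {b : nat}.
Hypothesis b0 : (0 < b)%N.
Variables (mu : 'I_b -> R) (p : 'M[R]_b).
Hypothesis hmu : forall i, 0 < mu i < 1.
Hypothesis hp : forall i j, 0 < p i j < 1.
Variable q : R.
Hypothesis q01 : 0 < q < 1.
Hypothesis muq : forall i, mu i <= q.
Hypothesis pq : forall i j, p i j <= q.
Context {d : measure_display} {T : measurableType d} (P : probability T R).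
Variable S : nat -> T -> string b.
Hypothesis hS : forall i, markov_chain P mu p (S i).
Hypothesis hSind : independent_strings P S.
Variables (N : nat) (v_ : 'I_N -> string b) (c : 'I_N -> R).

Local Notation mw v k := (word_weight mu p (mkseq v k)).
Local Notation cnt v k n t := (count_prefix S (prefix k v) n t).

(** Summed over the sample, this is the centered count of all prefixes up to
    depth [L], ones included; it is linear in the sample. *)
Let g L (u : string b) : R := \sum_i c i *
  \sum_(0 <= k < L) ((prefix k u == prefix k (v_ i))%:R - mw (v_ i) k).

Let g_agree L u w : agree L u w -> g L u = g L w.
Proof.
move=> uw; apply: eq_bigr => i _; congr (_ * _); apply: eq_big_nat => k /andP[_ kL].
by have /agreeP/eqP -> := agree_le (ltnW kL) uw.
Qed.

Let gE L t : g L (S 0%N t) = \sum_i c i * (truncated_depth S L (v_ i) t -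
  \sum_(0 <= k < L) mw (v_ i) k).
Proof. by apply: eq_bigr => i _; rewrite sumrB. Qed.

Let g_centered L : Ex P (fun t => g L (S 0%N t)) = 0.
Proof.
have it i := integrableR_truncated_depth b0 hS L (v_ i).
rewrite (_ : (fun t => _) = fun t => \sum_i c i * (truncated_depth S L (v_ i) t -
    \sum_(0 <= k < L) mw (v_ i) k)); last by apply/funext => t; rewrite gE.
have iB i : integrableR P (fun t => truncated_depth S L (v_ i) t -
    \sum_(0 <= k < L) mw (v_ i) k) by apply: integrableRB => //; exact: integrableR_cst.
rewrite Ex_sum => [|i _]; last exact: integrableRZ.
rewrite big1// => i _; rewrite ExZ// ExB//; last exact: integrableR_cst.
by rewrite Ex_cst (mean_truncated_depth b0 hS) subrr mulr0.
Qed.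

Let sum_gE L n t : \sum_(j < n) g L (S j t) = \sum_i c i *
  \sum_(0 <= k < L) ((cnt (v_ i) k n t)%:R - n%:R * mw (v_ i) k).
Proof.
rewrite exchange_big; apply: eq_bigr => i _; rewrite -mulr_sumr; congr (_ * _).
rewrite exchange_big; apply: eq_bigr => k _.
by rewrite sumrB sumr_const card_ord mulr_natl /count_prefix natr_sum.
Qed.

Let partial_sum L n t := (\sum_(j < n) g L (S j t)) / Num.sqrt n%:R.

Let measurable_partial_sum L n : measurable_fun [set: T] (partial_sum L n).
Proof.
apply: measurable_funM => //.
rewrite (_ : (fun t => _) = fun t => \sum_i c i *
    \sum_(0 <= k < L) ((cnt (v_ i) k n t)%:R - n%:R * mw (v_ i) k)); last first.
  by apply/funext => t; rewrite sum_gE.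
apply: measurable_sum => i; apply: measurable_funM => //.
apply: measurable_sum => k.
exact: (measurable_count_fun b0 hS hSind (prefix k (v_ i)) n
  (fun j => j%:R - n%:R * mw (v_ i) k)).
Qed.

Let X n t := \sum_i c i * centered_Z mu p S n (v_ i) t.

Let measurable_X n : measurable_fun [set: T] (X n).
Proof.
apply: measurable_sum => i; apply: measurable_funM => //.
exact: (measurable_centered_Z b0 hS hSind).
Qed.

Let A : R := \sum_i `|c i|.

(** Truncation discards the deviations beyond depth [L]; before that, [Z] drops
    the counts equal to 1, which amounts to at most 1 per level. *)
Let truncation n t rho V : 0 < rho < 1 -> 0 <= V ->
  (forall k (w : k.-tuple 'I_b),
    `|deviation mu p S n w t| <= Num.sqrt n%:R * rho ^+ k * V) -> forall L, (0 < n)%N ->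
  `|X n t - partial_sum L n t| <=
    A * (V / (1 - rho) * rho ^+ L + L%:R / Num.sqrt n%:R).
Proof.
move=> rho01 V0 dev L n0; have sn0 : 0 < Num.sqrt n%:R :> R by rewrite sqrtr_gt0 ltr0n.
rewrite /X /partial_sum sum_gE mulr_suml -sumrB /A mulr_suml.
apply: le_trans (ler_norm_sum _ _ _) _; apply: ler_sum => i _.
rewrite -mulrA -mulrBr normrM ler_wpM2l// /centered_Z -mulrBl normrM normfV.
rewrite (gtr0_norm sn0) ler_pdivrMr// [leRHS]mulrDl divfK ?gt_eqF//.
have [_ /(_ L)] := Z_expansion hmu hp q01 muq pq rho01 dev (v_ i).
have : `|\sum_(0 <= k < L) ((cnt (v_ i) k n t)%:R - n%:R * mw (v_ i) k) -
    \sum_(0 <= k < L) deviation mu p S n (prefix k (v_ i)) t| <= L%:R.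
  rewrite -sumrB; apply: le_trans (ler_norm_sum _ _ _) _.
  rewrite -[leRHS]mulr1 mulr_natl -[L in leRHS]subn0 -sumr_const_nat.
  apply: ler_sum => k _; rewrite /deviation prefix_mkseq opprB addrA subrK.
  case: (cnt _ _ _ _) => [|[|x]]; rewrite ?muln0 ?subrr ?normr0//=.
    by rewrite subr0 normr1.
  by rewrite muln1 subrr normr0.
move: (\sum_(0 <= k < L) _) (\sum_(0 <= k < L) _) => x y.
rewrite (_ : Num.sqrt n%:R * (V / (1 - rho)) * rho ^+ L =
  V / (1 - rho) * rho ^+ L * Num.sqrt n%:R); last by ring.
rewrite !ler_norml => /andP[? ?] /andP[? ?].
by apply/andP; split; lra.
Qed.

Lemma characteristic_centered_Z : let s2 := Ex P (fun t =>
    (\sum_i c i * (depth S (v_ i) t - Ex P (depth S (v_ i)))) ^+ 2) in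
  Ex P (fun t => cos (\sum_i c i * centered_Z mu p S n (v_ i) t)) @[n --> \oo] -->
    expR (- (s2 / 2)) /\
  Ex P (fun t => sin (\sum_i c i * centered_Z mu p S n (v_ i) t)) @[n --> \oo] --> 0.
Proof.
move=> s2.
have [rho [C [rho01 C0 VC]]] := deviation_control b0 hmu hp hS hSind q01 muq pq
  (isT : (1 < 2)%N).
have /andP[r0 r1] := rho01.
have A0 : 0 <= A by exact: sumr_ge0.
have r10 : 0 < 1 - rho by rewrite subr_gt0.
pose e L := A * ((1 + C) / (1 - rho) * rho ^+ L).
pose h L n : R := A * (L%:R / Num.sqrt n%:R).
have dist L n : (0 < n)%N ->
    `|Ex P (fun t => cos (X n t)) - Ex P (fun t => cos (partial_sum L n t))| <=
      e L + h L n /\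
    `|Ex P (fun t => sin (X n t)) - Ex P (fun t => sin (partial_sum L n t))| <=
      e L + h L n.
  move=> n0; have [V [mV V0 iV4 EV4 dev]] := VC n.
  have V1 t : `|V t| <= 1 + V t ^+ 4.
    rewrite ger0_norm//; have := sqr_ge0 (V t ^+ 2 - 1); have := sqr_ge0 (V t - 1).
    rewrite (_ : V t ^+ 4 = (V t ^+ 2) ^+ 2); last by rewrite -exprM.
    nra.
  have i1 : integrableR P (fun t => 1 + V t ^+ 4).
    by apply: integrableRD => //; exact: integrableR_cst.
  have iV := integrableR_le mV V1 i1.
  have EV : Ex P V <= 1 + C.
    apply: (@le_trans _ _ (Ex P (fun t => 1 + V t ^+ 4))).
      by apply: Ex_le => // t; apply: le_trans (V1 t); exact: ler_norm.
    by rewrite ExD//; [rewrite Ex_cst lerD2l|exact: integrableR_cst].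
  pose Z t := A * (rho ^+ L / (1 - rho)) * V t + h L n.
  have iZ : integrableR P Z.
    by apply: integrableRD; [exact: integrableRZ|exact: integrableR_cst].
  have EZ : Ex P Z <= e L + h L n.
    rewrite ExD; [|exact: integrableRZ|exact: integrableR_cst].
    rewrite Ex_cst lerD2r ExZ// /e -mulrA; apply: ler_wpM2l => //.
    rewrite [leRHS](_ : _ = rho ^+ L / (1 - rho) * (1 + C)); last by ring.
    by apply: ler_wpM2l => //; rewrite divr_ge0 ?exprn_ge0// ltW.
  have XZ : {ae P, forall t, `|X n t - partial_sum L n t| <= Z t}.
    apply: filterS dev => t /(truncation rho01 (V0 t)) /(_ L n0).
    move=> /le_trans; apply; rewrite le_eqVlt; apply/orP; left; apply/eqP.
    by rewrite /Z /h; ring.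
  have [h1 h2] := characteristic_dist (measurable_X n) (measurable_partial_sum L n) iZ XZ.
  by split; apply: le_trans EZ.
have e0 : e L @[L --> \oo] --> 0.
  rewrite -[X in _ --> X](mulr0 A); apply: cvgM; first exact: cvg_cst.
  rewrite -[X in _ --> X](mulr0 ((1 + C) / (1 - rho))); apply: cvgM; first exact: cvg_cst.
  by apply: cvg_expr; rewrite ger0_norm// ltW.
have h0 L : h L n @[n --> \oo] --> 0.
  rewrite -[X in _ --> X](mulr0 A); apply: cvgM; first exact: cvg_cst.
  rewrite -[X in _ --> X](mulr0 L%:R); apply: cvgM; first exact: cvg_cst.
  exact: cvg_invsqrt.
have clt L := prefix_clt b0 hS hSind (g_agree (L := L)) (g_centered L).
have vc := @truncated_variance_cvg _ _ b0 _ _ hmu hp _ q01 muq pq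
  _ _ _ _ hS _ c v_.
have l0 : expR (- (Ex P (fun t => g L (S 0%N t) ^+ 2) / 2)) @[L --> \oo] -->
    expR (- (s2 / 2)).
  suff c2 : - (Ex P (fun t => g L (S 0%N t) ^+ 2) / 2) @[L --> \oo] --> - (s2 / 2).
    exact: cvg_comp c2 (@continuous_expR R _).
  apply: cvgN; apply: cvgM; last exact: cvg_cst.
  rewrite (_ : (fun L => _) = fun L => Ex P (fun t => (\sum_i c i *
    (truncated_depth S L (v_ i) t - \sum_(0 <= k < L) mw (v_ i) k)) ^+ 2)) //.
  by apply/funext => L; congr Rintegral; apply/funext => t; rewrite gE.
split.
- by apply: (cvg_approx (fun L n n0 => (dist L n n0).1) h0 _ e0 l0) => L; exact: (clt L).1.
- apply: (@cvg_approx _ _ _ _ _ (fun=> 0) _ (fun L n n0 => (dist L n n0).2) h0 _ e0 _).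
    by move=> L; exact: (clt L).2.
  exact: cvg_cst.
Qed.

End CharacteristicZ.

(** * The supremum of the limit process *)

Section FiniteCovers.
Context {R : realType} {b : nat}.
Variable A : set (string b).
Hypothesis A0 : A !=set0.

(** There are finitely many prefixes of length [K]; each one carried by an
    element of [A] gets a representative in [A]. *)
Lemma finite_prefix_cover K : exists (N : nat) (v : nat -> string b),
  (forall i, A (v i)) /\
  forall u, A u -> exists i : 'I_N.+1, agree K (v i) u.
Proof.
have [u0 Au0] := A0.
have /choice[f fP] : forall w : K.-tuple 'I_b, exists u, A u /\
    ((exists2 u', A u' & prefix K u' = w) -> prefix K u = w).
  move=> w; have [[u Au uw]|nw] := pselect (exists2 u', A u' & prefix K u' = w).
    by exists u.
  by exists u0; split.
pose s := enum [set: K.-tuple 'I_b]%SET.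
exists (size s), (fun i => f (nth (prefix K u0) s i)); split=> [i|u Au].
  exact: (fP _).1.
have us : (index (prefix K u) s < (size s).+1)%N by rewrite ltnS index_size.
exists (Ordinal us); apply/agreeP/eqP => /=.
rewrite nth_index; last by rewrite mem_enum inE.
by apply: (fP _).2; exists u.
Qed.

Variables (N : nat -> nat) (v : nat -> nat -> string b).
Hypothesis Av : forall K i, A (v K i).
Hypothesis v_cover : forall K u, A u -> exists i : 'I_(N K).+1, agree K (v K i) u.

Lemma cover_max_cvg (f : string b -> R) : continuous f ->
  max_coord (fun i : 'I_(N K).+1 => f (v K i)) @[K --> \oo] --> sup [set f u | u in A].
Proof.
move=> cf.
have hs : has_sup [set f u | u in A].
  split; first by have [u Au] := A0; exists (f u), u.
  have cr : compact (range f).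
    apply: continuous_compact; last exact: string_compact.
    exact: continuous_subspaceT.
  have [|_ [M fM]] := compact_has_sup _ cr.
    by have [u _] := A0; exists (f u), u.
  by exists M => _ [u _ <-]; apply: fM; exists u.
apply/cvgrPdist_le => e e0; have e20 : 0 < e / 2 by rewrite divr_gt0.
have [_ [u Au <-] fu] := sup_adherent e20 hs.
have : nbhs u [set w | `|f u - f w| < e / 2].
  exact: (cf u _ (nbhsx_ballx (f u) _ e20)).
move=> /nbhs_agree[K0 K0f]; exists K0 => // K /= KK.
have [i iu] := v_cover K Au.
have := K0f _ (agree_le KK iu); rewrite /= ltr_norml => /andP[h1 h2].
have h3 := max_coord_ub (fun i : 'I_(N K).+1 => f (v K i)) i.
have h4 : max_coord (fun i : 'I_(N K).+1 => f (v K i)) <= sup [set f u | u in A].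
  by apply: max_coord_le => j; apply: (ub_le_sup hs.2); exists (v K j).
rewrite ger0_norm ?subr_ge0//; lra.
Qed.

End FiniteCovers.

Section CenteredGaussian.
Context {R : realType} {I : Type}.
Context {d' : measure_display} {T' : measurableType d'} (P' : probability T' R).
Variable H : I -> {RV P' >-> R}.
Hypothesis hHgauss : gaussian_process H.
Hypothesis hHcentered : forall v, ('E_P'[H v] = 0)%E.

Lemma gaussian_process_square_integrable v : square_integrable P' (H v).
Proof.
have mH : measurable_fun [set: T'] (H v) by exact: measurable_funP.
have := hHgauss (fun _ : 'I_1 => v) (fun=> 1).
rewrite (_ : (fun t => _) = H v); last first.
  by apply/funext => t; rewrite big_ord1 mul1r.
move=> [a [s [_ /(gaussian_mean_variance mH)[_ _ i2 _]]]].
have sqa : square_integrable P' (fun t => H v t - a).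
  by split=> //; exact: measurable_funB.
have := square_integrableD sqa (square_integrable_cst P' a).
by rewrite (_ : (fun t => _) = H v)//; apply/funext => t; rewrite subrK.
Qed.

Lemma Ex_centered v : Ex P' (H v) = 0.
Proof.
have iH := square_integrable_integrable (gaussian_process_square_integrable v).
by have := hHcentered v; rewrite expectation_Ex// => -[].
Qed.

Lemma gaussian_combination_characteristic N (v : 'I_N -> I) (c : 'I_N -> R) :
  let s2 := Ex P' (fun t => (\sum_i c i * H (v i) t) ^+ 2) in
  Ex P' (fun t => cos (\sum_i c i * H (v i) t)) = expR (- (s2 / 2)) /\
  Ex P' (fun t => sin (\sum_i c i * H (v i) t)) = 0.
Proof.
move=> s2.
have iH i := square_integrable_integrable (gaussian_process_square_integrable (v i)).
pose X t := \sum_i c i * H (v i) t.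
have mX : measurable_fun [set: T'] X.
  by apply: measurable_sum => i; apply: measurable_funM => //; exact: measurable_funP.
have EX : Ex P' X = 0.
  rewrite Ex_sum => [|i _]; last exact: integrableRZ.
  by rewrite big1// => i _; rewrite ExZ// Ex_centered mulr0.
have char := gaussian_characteristic mX (hHgauss v c) EX.
split.
- have := char 0; rewrite cos0 mulr1 mulNr => <-.
  by congr Rintegral; apply/funext => t; rewrite addr0.
- have := char (- (pi / 2)); rewrite cosN cos_pihalf mulr0 => EX0; rewrite -[RHS]EX0.
  by congr Rintegral; apply/funext => t; rewrite cosBpihalf.
Qed.

End CenteredGaussian.

Section LimitCovariance.
Context {R : realType} {b : nat}.
Hypothesis b0 : (0 < b)%N.
Variables (mu : 'I_b -> R) (p : 'M[R]_b).
Hypothesis hmu : forall i, 0 < mu i < 1.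
Hypothesis hp : forall i j, 0 < p i j < 1.
Variable q : R.
Hypothesis q01 : 0 < q < 1.
Hypothesis muq : forall i, mu i <= q.
Hypothesis pq : forall i j, p i j <= q.
Context {d : measure_display} {T : measurableType d} (P : probability T R).
Variable S : nat -> T -> string b.
Hypothesis hS : forall i, markov_chain P mu p (S i).
Hypothesis hSind : independent_strings P S.
Context {d' : measure_display} {T' : measurableType d'} (P' : probability T' R).
Variable H : string b -> {RV P' >-> R}.
Hypothesis hHgauss : gaussian_process H.
Hypothesis hHcentered : forall v, ('E_P'[H v] = 0)%E.
Hypothesis hHcov : forall v w, ('E_P'[H v \* H w] =
  covariance P (fun t => fine (lcp R v (S 0%N t)))
               (fun t => fine (lcp R w (S 0%N t))))%E.

Let sqH v := gaussian_process_square_integrable hHgauss v.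
Let sqD v := square_integrable_depth b0 hmu hp q01 muq pq hS v.

Let sqDc v : square_integrable P (fun t => depth S v t - Ex P (depth S v)).
Proof. by apply: square_integrableD (sqD v) _; exact: square_integrable_cst. Qed.

Lemma covariance_depth v w : Ex P' (fun t => H v t * H w t) =
  Ex P (fun t => (depth S v t - Ex P (depth S v)) * (depth S w t - Ex P (depth S w))).
Proof.
have := hHcov v w; rewrite covariance.unlock -/(depth S v) -/(depth S w).
rewrite !(expectation_Ex (square_integrable_integrable (sqD _))) /=.
rewrite (expectation_Ex (square_integrableM (sqH v) (sqH w))).
by rewrite (expectation_Ex (square_integrableM (sqDc v) (sqDc w))) => -[].
Qed.

Variables (N : nat) (v_ : 'I_N -> string b) (c : 'I_N -> R).

Lemma joint_characteristic_cvg :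
  Ex P (fun t => cos (\sum_i c i * centered_Z mu p S n (v_ i) t)) @[n --> \oo] -->
    Ex P' (fun t => cos (\sum_i c i * H (v_ i) t)) /\
  Ex P (fun t => sin (\sum_i c i * centered_Z mu p S n (v_ i) t)) @[n --> \oo] -->
    Ex P' (fun t => sin (\sum_i c i * H (v_ i) t)).
Proof.
have [-> ->] := gaussian_combination_characteristic hHgauss hHcentered v_ c.
rewrite (_ : Ex P' (fun t => (\sum_i c i * H (v_ i) t) ^+ 2) = Ex P (fun t =>
    (\sum_i c i * (depth S (v_ i) t - Ex P (depth S (v_ i)))) ^+ 2)).
  exact: (characteristic_centered_Z b0 hmu hp q01 muq pq hS hSind).
rewrite !Ex_sqr_sum//; apply: eq_bigr => i _; apply: eq_bigr => j _.
by rewrite covariance_depth.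
Qed.

End LimitCovariance.

(** * Convergence of the normalized maximum *)

Section NormalizedMaximum.
Context {R : realType} {b : nat}.
Hypothesis b0 : (0 < b)%N.
Variables (mu : 'I_b -> R) (p : 'M[R]_b).
Hypothesis hmu : forall i, 0 < mu i < 1.
Hypothesis hp : forall i j, 0 < p i j < 1.
Variable q : R.
Hypothesis q01 : 0 < q < 1.
Hypothesis muq : forall i, mu i <= q.
Hypothesis pq : forall i j, p i j <= q.
Context {d : measure_display} {T : measurableType d} (P : probability T R).
Variable S : nat -> T -> string b.
Hypothesis hS : forall i, markov_chain P mu p (S i).
Hypothesis hSind : independent_strings P S.

Let X n := normalized_Z_max S (m_max mu p) n.
Let cZ n v := centered_Z mu p S n v.
Let Smax : set (string b) := Sigma_max mu p.

Let mX n : measurable_fun [set: T] (X n).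
Proof. exact: (measurable_normalized_Z_max b0 hS hSind). Qed.

Let mcZ n v : measurable_fun [set: T] (cZ n v).
Proof. exact: (measurable_centered_Z b0 hS hSind). Qed.

(** What the control of the deviations implies outside of a null set; [B] is the
    sum of their geometric majorants. *)
Let envelope r : (1 < r)%N -> exists rho C : R, [/\ 0 < rho < 1, 0 <= C &
  forall n, exists B : T -> R, [/\ measurable_fun [set: T] B, forall t, 0 <= B t,
    integrableR P (fun t => B t ^+ r.*2) /\ Ex P (fun t => B t ^+ r.*2) <= C,
    {ae P, forall t, `|X n t| <= B t /\ forall v, `|cZ n v t| <= B t} &
    {ae P, forall t N K (v : 'I_N.+1 -> string b) delta,
      (forall i, Smax (v i)) ->
      (forall u, Smax u -> exists i, agree K (v i) u) -> 0 < delta ->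
      (forall w, (forall u, Smax u -> ~ agree K u w) ->
        m mu p w <= m_max mu p - delta) -> (0 < n)%N ->
      `|X n t - max_coord (fun i => cZ n (v i) t)| <=
        2 * B t * rho ^+ K + 4 * B t ^+ 2 / (Num.sqrt n%:R * delta)}]].
Proof.
move=> r1.
have [rho [C [rho01 C0 VC]]] := deviation_control b0 hmu hp hS hSind q01 muq pq r1.
have /andP[_ rho1] := rho01.
have w0 : 0 <= (1 - rho)^-1 by rewrite invr_ge0 subr_ge0 ltW.
exists rho, ((1 - rho)^-1 ^+ r.*2 * C); split=> // [|n].
  by apply: mulr_ge0 => //; exact: exprn_ge0.
have [V [mV V0 iV EV dev]] := VC n.
have BE : (fun t => (V t / (1 - rho)) ^+ r.*2) =
    fun t => (1 - rho)^-1 ^+ r.*2 * V t ^+ r.*2.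
  by apply/funext => t; rewrite exprMn mulrC.
exists (fun t => V t / (1 - rho)); split.
- exact: measurable_funM.
- by move=> t; apply: mulr_ge0.
- rewrite BE; split; first exact: integrableRZ.
  by rewrite ExZ//; apply: ler_wpM2l => //; exact: exprn_ge0.
- apply: filterS dev => t dt; split.
    exact: (normalized_Z_max_le b0 hmu hp q01 muq pq rho01 (V0 t) dt).
  by move=> v; exact: (centered_Z_le hmu hp q01 muq pq rho01 (V0 t) dt).
- apply: filterS dev => t dt N K v delta vmax vcov d0 gap n0.
  exact: (normalized_Z_max_approx b0 hmu hp q01 muq pq rho01 (V0 t) dt
    vmax vcov d0 gap n0).
Qed.

Let lower_moment (B : T -> R) k l : (k <= l)%N -> measurable_fun [set: T] B ->
  (forall t, 0 <= B t) -> integrableR P (fun t => B t ^+ l) ->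
  integrableR P (fun t => B t ^+ k) /\
  Ex P (fun t => B t ^+ k) <= 1 + Ex P (fun t => B t ^+ l).
Proof.
move=> kl mB B0.
have E j : (fun t => B t ^+ j) = (fun t => `|B t| ^+ j).
  by apply/funext => t; rewrite ger0_norm.
by rewrite !E; exact: integrableR_expr_le.
Qed.

Lemma normalized_Z_max_moments k : exists C, forall n,
  integrableR P (fun t => `|X n t| ^+ k) /\ Ex P (fun t => `|X n t| ^+ k) <= C.
Proof.
have [rho [C [_ _ envC]]] := @envelope k.+2 isT.
exists (1 + C) => n; have [B [mB B0 [iB EB] XB _]] := envC n.
have kk : (k <= k.+2.*2)%N by rewrite -addnn !addSn !leqW// leq_addr.
have [iBk EBk] := lower_moment kk mB B0 iB.
have XBk : {ae P, forall t, `|X n t| ^+ k <= B t ^+ k}.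
  by apply: filterS XB => t [h _]; rewrite lerXn2r ?nnegrE.
have iX : integrableR P (fun t => `|X n t| ^+ k).
  apply: (ae_integrableR_le _ _ iBk); first exact: measurable_normX.
  by apply: filterS XBk => t; rewrite (ger0_norm (exprn_ge0 _ _)).
split=> //; apply: le_trans (ae_Ex_le iX iBk XBk) _.
by rewrite (le_trans EBk)// lerD2l.
Qed.

Context {d' : measure_display} {T' : measurableType d'} (P' : probability T' R).
Variable H : string b -> {RV P' >-> R}.
Hypothesis hHcont : forall t, continuous (fun v => H v t).
Hypothesis hHgauss : gaussian_process H.
Hypothesis hHcentered : forall v, ('E_P'[H v] = 0)%E.
Hypothesis hHcov : forall v w, ('E_P'[H v \* H w] =
  covariance P (fun t => fine (lcp R v (S 0%N t)))
               (fun t => fine (lcp R w (S 0%N t))))%E.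

Let Y t := sup [set H v t | v in Smax].

Section Cover.
Variables (N : nat -> nat) (v : nat -> nat -> string b).
Hypothesis v_max : forall K i, Smax (v K i).
Hypothesis v_cover : forall K u, Smax u -> exists i : 'I_(N K).+1, agree K (v K i) u.

Let MZ K n t := max_coord (fun i : 'I_(N K).+1 => cZ n (v K i) t).
Let MH K t := max_coord (fun i : 'I_(N K).+1 => H (v K i) t).

Let mMZ K n : measurable_fun [set: T] (MZ K n).
Proof. by apply: measurable_max_coord => i; exact: mcZ. Qed.

Let mMH K : measurable_fun [set: T'] (MH K).
Proof. by apply: measurable_max_coord => i; exact: measurable_funP. Qed.

Let MH_cvg t : MH K t @[K --> \oo] --> Y t.
Proof.
exact: (cover_max_cvg (Sigma_max_nonempty hmu hp q01 muq pq b0) v_max v_cover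
  (@hHcont t)).
Qed.

Let mY : measurable_fun [set: T'] Y.
Proof. by apply: (@measurable_fun_cvg _ _ _ _ MH) => // t _; exact: MH_cvg. Qed.

Let iH u : integrableR P' (H u).
Proof.
exact: square_integrable_integrable (gaussian_process_square_integrable hHgauss u).
Qed.

Let max_weak_cvg K f (B : R) : continuous f -> (forall y, `|f y| <= B) ->
  Ex P (fun t => f (MZ K n t)) @[n --> \oo] --> Ex P' (fun t => f (MH K t)).
Proof.
move=> cf fB.
have [rho [C [_ C0 envC]]] := @envelope 2 isT.
have cZC n i : integrableR P (cZ n (v K i)) /\ Ex P (fun t => `|cZ n (v K i) t|) <= 1 + C.
  have [U [mU U0 [iU EU] XU _]] := envC n.
  have [iU1 EU1] := lower_moment (isT : (1 <= 2.*2)%N) mU U0 iU.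
  have ZU : {ae P, forall t, `|cZ n (v K i) t| <= U t ^+ 1}.
    by apply: filterS XU => t [_ h]; rewrite expr1.
  have iZ := ae_integrableR_le (mcZ n (v K i)) ZU iU1.
  split=> //; apply: le_trans (ae_Ex_le (integrableR_norm iZ) iU1 ZU) _.
  by rewrite (le_trans EU1)// lerD2l.
pose C' := 1 + C + \sum_(i < (N K).+1) Ex P' (fun t => `|H (v K i) t|).
have s0 : 0 <= \sum_(i < (N K).+1) Ex P' (fun t => `|H (v K i) t|).
  by apply: sumr_ge0 => i _; exact: Ex_ge0.
have joint := @joint_characteristic_cvg _ _ b0 _ _ hmu hp _ q01 muq pq _ _ _ _ hS hSind
  _ _ _ _ hHgauss hHcentered hHcov _ (fun i : 'I_(N K).+1 => v K i).
apply: (@levy_max_coord _ _ _ _ P _ _ P' (fun n i => cZ n (v K i))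
  (fun i : 'I_(N K).+1 => H (v K i)) C' _ _ _ _ _ _ f B cf fB).
- by move=> n i; exact: (cZC n i).1.
- by move=> i; exact: iH.
- by move=> n i; rewrite (le_trans (cZC n i).2)// lerDl.
- move=> i; rewrite /C' (bigD1 i)//= addrCA lerDl addr_ge0 ?addr_ge0//.
  by apply: sumr_ge0 => j _; exact: Ex_ge0.
- by move=> c; exact: (joint c).1.
- by move=> c; exact: (joint c).2.
Qed.

(** The first moments of the maxima over the covers are bounded, being limits of
    those of the maxima of [Z]; their limit inherits the bound. *)
Let Y_moment : integrableR P' Y /\ exists C, Ex P' (fun t => `|Y t|) <= C.
Proof.
have [rho [C [_ C0 envC]]] := @envelope 2 isT.
have [iY YC] : integrableR P' (fun t => `|Y t|) /\ Ex P' (fun t => `|Y t|) <= 1 + C.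
  apply: integrableR_of_truncations => [|t|A].
  - exact: measurableT_comp.
  - exact: normr_ge0.
  pose f (y : R) := Num.min `|y| A%:R.
  have cf : continuous f.
    move=> y; apply: (@continuous_min _ _ (fun y : R => `|y|) (fun=> A%:R)).
      exact: norm_continuous.
    exact: cvg_cst.
  have f0 y : 0 <= f y by rewrite le_min normr_ge0 ler0n.
  have fA y : `|f y| <= A%:R by rewrite ger0_norm// ge_min lexx orbT.
  have mf : measurable_fun [set: R] f by exact: continuous_measurable_fun.
  have MHC K : Ex P' (fun t => f (MH K t)) <= 1 + C.
    have cv := max_weak_cvg (K := K) cf fA.
    rewrite -(cvg_lim _ cv)//; apply: limr_le; first by apply/cvg_ex; eexists; exact: cv.
    apply: nearW => n; have [U [mU U0 [iU EU] XU _]] := envC n.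
    have [iU1 EU1] := lower_moment (isT : (1 <= 2.*2)%N) mU U0 iU.
    apply: (@le_trans _ _ (1 + Ex P (fun t => U t ^+ 2.*2))); last by rewrite lerD2l.
    apply: le_trans EU1; apply: ae_Ex_le => //.
      apply: (@integrableR_bounded _ _ _ _ _ A%:R) => [|t]; last exact: fA.
      exact: measurableT_comp.
    apply: filterS XU => t [_ h]; rewrite expr1 /f ge_min.
    by apply/orP; left; apply: max_coord_norm_le => i; exact: h.
  have [|||||_ cv] := @Ex_dominated _ _ _ P' (fun K t => f (MH K t))
      (fun t => f (Y t)) (fun=> A%:R).
  - by move=> K; exact: measurableT_comp.
  - exact: measurableT_comp.
  - by apply: aeW => t; exact: cvg_comp (@MH_cvg t) (cf _).
  - exact: integrableR_cst.
  - by apply: aeW => t K; exact: fA.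
  rewrite -(cvg_lim _ cv)//; apply: limr_le; first by apply/cvg_ex; eexists; exact: cv.
  by apply: nearW => K; exact: MHC.
split; last by exists (1 + C).
by apply: (integrableR_le mY _ iY) => t.
Qed.

Let characteristic_cvg r :
  Ex P (fun t => cos (r * X n t)) @[n --> \oo] --> Ex P' (fun t => cos (r * Y t)) /\
  Ex P (fun t => sin (r * X n t)) @[n --> \oo] --> Ex P' (fun t => sin (r * Y t)).
Proof.
have [rho [C [rho01 C0 envC]]] := @envelope 2 isT.
have /andP[r0 r1] := rho01.
have /choice[delta deltaP] : forall K, exists delta : R, 0 < delta /\
    forall w, (forall u, Smax u -> ~ agree K u w) -> m mu p w <= m_max mu p - delta.
  move=> K; have [delta d0 gap] := m_max_gap hmu hp q01 muq pq b0 K.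
  by exists delta.
pose e K := `|r| * (2 * (1 + C)) * rho ^+ K.
pose h K n : R := `|r| * (4 * (1 + C) / delta K) * (Num.sqrt n%:R)^-1.
have dist K n : (0 < n)%N ->
    `|Ex P (fun t => cos (r * X n t)) - Ex P (fun t => cos (r * MZ K n t))| <=
      e K + h K n /\
    `|Ex P (fun t => sin (r * X n t)) - Ex P (fun t => sin (r * MZ K n t))| <=
      e K + h K n.
  move=> n0; have [U [mU U0 [iU EU] _ XU]] := envC n.
  have [iU1 EU1] := lower_moment (isT : (1 <= 2.*2)%N) mU U0 iU.
  have [iU2 EU2] := lower_moment (isT : (2 <= 2.*2)%N) mU U0 iU.
  have [d0 gap] := deltaP K.
  have s0 : 0 < Num.sqrt n%:R :> R by rewrite sqrtr_gt0 ltr0n.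
  pose a := `|r| * 2 * rho ^+ K; pose c := `|r| * (4 / delta K) * (Num.sqrt n%:R)^-1.
  have a0 : 0 <= a.
    by apply: mulr_ge0; [exact: mulr_ge0|exact: exprn_ge0 (ltW r0)].
  have c0 : 0 <= c.
    apply: mulr_ge0; last by rewrite invr_ge0.
    by apply: mulr_ge0 => //; apply: divr_ge0 => //; exact: ltW.
  pose Z t := a * U t ^+ 1 + c * U t ^+ 2.
  have iZ : integrableR P Z by apply: integrableRD; exact: integrableRZ.
  have EZ : Ex P Z <= e K + h K n.
    rewrite ExD; [|exact: integrableRZ|exact: integrableRZ].
    rewrite !ExZ//.
    have -> : e K = a * (1 + C) by rewrite /e /a; ring.
    have -> : h K n = c * (1 + C) by rewrite /h /c; ring.
    apply: lerD; apply: ler_wpM2l => //.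
      by rewrite (le_trans EU1)// lerD2l.
    by rewrite (le_trans EU2)// lerD2l.
  have XZ : {ae P, forall t, `|r * X n t - r * MZ K n t| <= Z t}.
    apply: filterS XU => t Xt.
    have := Xt _ _ _ _ (fun i : 'I_(N K).+1 => v_max K i) (v_cover K) d0 gap n0.
    move=> /(ler_wpM2l (normr_ge0 r)); rewrite -normrM mulrBr => /le_trans; apply.
    rewrite le_eqVlt; apply/orP; left; apply/eqP; rewrite /Z /a /c.
    by field; rewrite !gt_eqF.
  have mrX : measurable_fun [set: T] (fun t => r * X n t) by exact: measurable_funM.
  have mrM : measurable_fun [set: T] (fun t => r * MZ K n t) by exact: measurable_funM.
  have [h1 h2] := characteristic_dist mrX mrM iZ XZ.
  by split; apply: le_trans EZ.
have e0 : e K @[K --> \oo] --> 0.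
  rewrite -[X in _ --> X](mulr0 (`|r| * (2 * (1 + C)))); apply: cvgM; first exact: cvg_cst.
  by apply: cvg_expr; rewrite ger0_norm// ltW.
have h0 K : h K n @[n --> \oo] --> 0.
  rewrite -[X in _ --> X](mulr0 (`|r| * (4 * (1 + C) / delta K))).
  by apply: cvgM; [exact: cvg_cst|exact: cvg_invsqrt].
have mr (f : R -> R) : continuous f -> continuous (fun y => f (r * y)).
  move=> cf y; apply: (@continuous_comp _ _ _ (fun y : R => r * y) f); last exact: cf.
  exact: mulrl_continuous.
have limK (f : R -> R) : continuous f -> (forall y, `|f y| <= 1) ->
    Ex P' (fun t => f (r * MH K t)) @[K --> \oo] --> Ex P' (fun t => f (r * Y t)).
  move=> cf f1; have cfr := mr _ cf.
  have mf : measurable_fun [set: R] (fun y => f (r * y)).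
    exact: continuous_measurable_fun.
  have [|||||_ //] := @Ex_dominated _ _ _ P' (fun K t => f (r * MH K t))
      (fun t => f (r * Y t)) (fun=> 1).
  - by move=> K; exact: (measurableT_comp mf (mMH K)).
  - exact: (measurableT_comp mf mY).
  - by apply: aeW => t; exact: cvg_comp (@MH_cvg t) (cfr _).
  - exact: integrableR_cst.
  - by apply: aeW => t K; exact: f1.
split.
- apply: (cvg_approx (fun K n n0 => (dist K n n0).1) h0 _ e0
    (limK _ (@continuous_cos R) (@cos_max R))) => K.
  exact: (max_weak_cvg (K := K) (mr _ (@continuous_cos R)) (fun y => cos_max (r * y))).
- apply: (cvg_approx (fun K n n0 => (dist K n n0).2) h0 _ e0
    (limK _ (@continuous_sin R) (@sin_max R))) => K.
  exact: (max_weak_cvg (K := K) (mr _ (@continuous_sin R)) (fun y => sin_max (r * y))).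
Qed.

Lemma weak_cvg_of_cover : weak_cvg P P' X Y /\ measurable_fun [set: T'] Y.
Proof.
have [iY [CY YC]] := Y_moment.
have [CX XC] := normalized_Z_max_moments 1.
have E1 n : (fun t => `|X n t| ^+ 1) = (fun t => `|X n t|).
  by apply/funext => t; rewrite expr1.
have iX n : integrableR P (fun t => `|X n t|) by have := (XC n).1; rewrite E1.
split; last exact: mY.
apply: (@weak_cvg_characteristic _ _ _ _ _ _ _ _ _ (Num.max CX CY)) => //.
- by move=> n; apply: (integrableR_le (mX n) _ (iX n)) => t.
- by move=> n; rewrite le_max; have := (XC n).2; rewrite E1 => ->.
- by rewrite le_max YC orbT.
- by move=> r; exact: (characteristic_cvg r).1.
- by move=> r; exact: (characteristic_cvg r).2.
Qed.

End Cover.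

Lemma normalized_Z_max_weak_cvg : measurable_fun [set: T'] Y /\ weak_cvg P P' X Y.
Proof.
have /choice[Nv NvP] : forall K, exists Nv : nat * (nat -> string b),
    (forall i, Smax (Nv.2 i)) /\
    forall u, Smax u -> exists i : 'I_Nv.1.+1, agree K (Nv.2 i) u.
  move=> K; have [N [v vP]] := finite_prefix_cover
    (Sigma_max_nonempty hmu hp q01 muq pq b0) K.
  by exists (N, v).
have [] := @weak_cvg_of_cover (fun K => (Nv K).1) (fun K => (Nv K).2)
  (fun K i => (NvP K).1 i) (fun K => (NvP K).2).
by [].
Qed.

Lemma normalized_Z_max_cvg_in_distribution : cvg_in_distribution P P' X Y.
Proof.
have [mY XY] := normalized_Z_max_weak_cvg.
split=> // f cf bf.
have [B fB] : exists B : R, forall y, `|f y| <= B.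
  have [M [_ MB]] := bf; exists (M + 1) => y.
  by apply: (MB (M + 1)) => //; rewrite ltrDl.
have mf : measurable_fun [set: R] f by exact: continuous_measurable_fun.
have if1 d1 (T1 : measurableType d1) (P1 : probability T1 R) (U : T1 -> R) :
    measurable_fun [set: T1] U -> integrableR P1 (f \o U).
  move=> mU; apply: (@integrableR_bounded _ _ _ _ _ B) => [|t]; last exact: fB.
  exact: measurableT_comp.
rewrite (expectation_Ex (if1 _ _ _ _ mY)).
rewrite (_ : (fun n => 'E_P[f \o X n])%E = fun n => (Ex P (f \o X n))%:E).
  by apply: cvg_EFin; [exact: nearW|exact: XY cf fB].
by apply/funext => n; rewrite (expectation_Ex (if1 _ _ _ _ (mX n))).
Qed.

Lemma normalized_Z_max_cvg_moments : cvg_moments P P' X Y.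
Proof.
have [mY XY] := normalized_Z_max_weak_cvg.
move=> k; have [C XC] := normalized_Z_max_moments k.*2.
have [iX iY cv] := weak_cvg_moments mX mY XY (fun n => (XC n).1) (fun n => (XC n).2).
split; [exact: iX|exact: iY|].
rewrite (expectation_Ex iY).
rewrite (_ : (fun n => 'E_P[fun t => (X n t ^+ k)%R])%E =
    fun n => (Ex P (fun t => X n t ^+ k))%:E).
  by apply: cvg_EFin; [exact: nearW|exact: cv].
by apply/funext => n; rewrite (expectation_Ex (iX n)).
Qed.

End NormalizedMaximum.

Theorem theorem1p5 (R : realType) (b : nat) (hb : (2 <= b)%N)
    (mu : 'I_b -> R) (p : 'M[R]_b)
    (hmu : forall i, 0 < mu i < 1) (hmu1 : \sum_i mu i = 1)
    (hp : forall i j, 0 < p i j < 1) (hp1 : forall i, \sum_j p i j = 1)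
    (d : measure_display) (T : measurableType d) (P : probability T R)
    (S : nat -> T -> string b)
    (hS : forall i, markov_chain P mu p (S i))
    (hSind : independent_strings P S)
    (d' : measure_display) (T' : measurableType d') (P' : probability T' R)
    (H : string b -> {RV P' >-> R})
    (hHcont : forall t, continuous (fun v => H v t))
    (hHgauss : gaussian_process H)
    (hHcentered : forall v, ('E_P'[H v] = 0)%E)
    (hHcov : forall v w, ('E_P'[H v \* H w] =
       covariance P (fun t => fine (lcp R v (S 0%N t)))
                    (fun t => fine (lcp R w (S 0%N t))))%E) :
  let X := normalized_Z_max S (m_max mu p) in
  let Y := fun t => sup [set H v t | v in Sigma_max mu p] in
  cvg_in_distribution P P' X Y /\ cvg_moments P P' X Y.
Proof.
move=> X Y; have b0 : (0 < b)%N by exact: ltnW.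
have [q q01 [muq pq]] := weight_ratio_ex hmu hp.
split; first exact: (normalized_Z_max_cvg_in_distribution b0 hmu hp q01 muq pq).
exact: (normalized_Z_max_cvg_moments b0 hmu hp q01 muq pq).
Qed.
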